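(* The group $G=\mathrm{SL}(2,\mathbb{F}_3)$ of $2\times 2$ matrices of determinant $1$ over the field with three elements does not satisfy the HTW-decomposition. That is, it is not true that for every noetherian ring $R$ and every integer $n\ge 0$ there is an isomorphism of abelian groups $$G_n(RG)\cong\bigoplus_{\rho\in X(G)}G_n(R\otimes_{\mathbb{Z}}\Lambda_\rho).$$
   Context: For a noetherian ring $A$, $G_n(A)$ denotes the $n$-th $G$-theory group of $A$, i.e. the $n$-th Quillen $K$-group of the abelian category of finitely generated $A$-modules. $RG$ is the group ring of $G$ over $R$. Let $G$ be a finite group. $X(G)$ is the set of isomorphism classes of rational irreducible representations $\rho\colon G\to\mathrm{Aut}(V_\rho)$ ($V_\rho$ a simple $\mathbb{Q}G$-module). For $\rho\in X(G)$: - $D_\rho=\mathrm{End}_{\mathbb{Q}G}(V_\rho)$ is the associated division algebra; - $k_\rho=|\ker\rho|$ is the order of the kernel of $\rho$; - $d_\rho$ is the dimension of any irreducible complex constituent of $\mathbb{C}\otimes_{\mathbb{Q}}V_\rho$; - $\omega_\rho=\dfrac{|G|}{k_\rho d_\rho}$, which is a positive integer; - $\Lambda_\rho$ is a maximal $\mathbb{Z}[1/\omega_\rho]$-order in $D_\rho$. A finite group $G$ is said to satisfy the HTW-decomposition (Hambleton-Taylor-Williams) if $G_n(RG)\cong\bigoplus_{\rho\in X(G)}G_n(R\otimes_{\mathbb{Z}}\Lambda_\rho)$ for every noetherian ring $R$ and all $n\geq 0$. *)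

(* Defs.v *)
From HB Require Import structures.
From Stdlib Require Import Relations.
From mathcomp Require Import all_boot all_order all_algebra all_fingroup.
From mathcomp Require Import generic_quotient mxrepresentation complex.
From mathcomp Require Import boolp classical_sets reals topology normedtype.

Set Implicit Arguments.
Unset Strict Implicit.
Unset Printing Implicit Defensive.

Import Order.TTheory GRing.Theory Num.Theory.
Import numFieldNormedType.Exports.

Local Open Scope quotient_scope.
Local Open Scope ring_scope.

(* Rings are [pzRingType]s: the zero ring is allowed, and it does occur, e.g. *)
(* as F_3 tensored with an algebra in which 3 is invertible.                  *)

Section FiniteGeneration.
Variables (A : pzRingType) (M : lmodType A).

Definition fin_gen (S : M -> Prop) : Prop :=
  exists (n : nat) (v : 'I_n -> M), (forall i, S (v i)) /\
    forall x, S x -> exists c : 'I_n -> A, x = \sum_(i < n) c i *: v i.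

Definition is_submodule (S : M -> Prop) : Prop :=
  S 0 /\ forall (a : A) (x y : M), S x -> S y -> S (a *: x + y).

End FiniteGeneration.

Definition left_noetherian (A : pzRingType) : Prop :=
  forall S : A^o -> Prop, is_submodule S -> fin_gen S.

Definition noetherian (A : pzRingType) : Prop :=
  left_noetherian A /\ left_noetherian A^c.

Definition grpring (R : pzRingType) (gT : finGroupType) : Type :=
  {ffun gT -> R}.

Section GroupRing.
Variables (R : pzRingType) (gT : finGroupType).
Implicit Types a b c : grpring R gT.

HB.instance Definition _ := GRing.Zmodule.on (grpring R gT).

Definition grpring_one : grpring R gT := [ffun x => (x == 1%g)%:R].
Definition grpring_mul a b : grpring R gT :=
  [ffun x => \sum_(y : gT) a y * b (y^-1 * x)%g].

Lemma grpring_mulA : associative grpring_mul.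
Proof.
move=> a b c; apply/ffunP => x; rewrite !ffunE.
transitivity (\sum_y \sum_z a y * (b z * c (z^-1 * (y^-1 * x))%g)).
  by apply: eq_bigr => y _; rewrite ffunE mulr_sumr.
transitivity (\sum_y \sum_z a y * (b (y^-1 * z)%g * c (z^-1 * x)%g)).
  apply: eq_bigr => y _; rewrite (reindex_inj (mulgI y^-1%g)) /=.
  by apply: eq_bigr => z _; rewrite invMg invgK !mulgA mulgK.
rewrite exchange_big /=; apply: eq_bigr => z _.
by rewrite ffunE mulr_suml; apply: eq_bigr => y _; rewrite mulrA.
Qed.

Lemma grpring_mul1r : left_id grpring_one grpring_mul.
Proof.
move=> a; apply/ffunP => x; rewrite ffunE (bigD1 1%g) //= ffunE eqxx mul1r.
rewrite invg1 mul1g big1 ?addr0 // => y /negPf y1.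
by rewrite ffunE y1 mul0r.
Qed.

Lemma grpring_mulr1 : right_id grpring_one grpring_mul.
Proof.
move=> a; apply/ffunP => x; rewrite ffunE (bigD1 x) //= ffunE mulVg eqxx mulr1.
rewrite big1 ?addr0 // => y yx.
by rewrite ffunE -eq_mulVg1 (negPf yx) mulr0.
Qed.

Lemma grpring_mulDl : left_distributive grpring_mul +%R.
Proof.
move=> a b c; apply/ffunP => x; rewrite !ffunE -big_split /=.
by apply: eq_bigr => y _; rewrite ffunE mulrDl.
Qed.

Lemma grpring_mulDr : right_distributive grpring_mul +%R.
Proof.
move=> a b c; apply/ffunP => x; rewrite !ffunE -big_split /=.
by apply: eq_bigr => y _; rewrite ffunE mulrDr.
Qed.

HB.instance Definition _ := GRing.Zmodule_isPzRing.Build (grpring R gT)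
  grpring_mulA grpring_mul1r grpring_mulr1 grpring_mulDl grpring_mulDr.

End GroupRing.

Definition biadditive (A B Z : zmodType) (f : A -> B -> Z) : Prop :=
  (forall a a' b, f (a + a') b = f a b + f a' b) /\
  (forall a b b', f a (b + b') = f a b + f a b').

Section TensorProduct.
Variables (A B : pzRingType).

(* A formal sum [:: (a_1, b_1); ...; (a_n, b_n)] of pure tensors; two of them *)
(* are identified when no biadditive map can tell them apart.                 *)
Definition tsum : Type := seq (A * B).
HB.instance Definition _ := Choice.on tsum.

Definition tsum_eval (Z : zmodType) (f : A -> B -> Z) (s : tsum) : Z :=
  \sum_(p <- s) f p.1 p.2.

Definition tsum_eqv (s t : tsum) : bool :=
  `[< forall (Z : zmodType) (f : A -> B -> Z), biadditive f ->
        tsum_eval f s = tsum_eval f t >].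

Lemma tsum_eqv_equiv : equiv_class_of tsum_eqv.
Proof.
split=> [s|s t|t s u].
- exact/asboolP.
- by apply/asboolP/asboolP => h Z f bf; rewrite h.
- by move=> /asboolP h /asboolP h'; apply/asboolP => Z f bf; rewrite h // h'.
Qed.

Canonical tsum_equiv : equiv_rel tsum := EquivRelPack tsum_eqv_equiv.

Definition tensor : Type := {eq_quot tsum_equiv}.
HB.instance Definition _ := Choice.on tensor.
HB.instance Definition _ := EqQuotient.on tensor.

Lemma tensorP (s t : tsum) :
  (forall (Z : zmodType) (f : A -> B -> Z), biadditive f ->
     tsum_eval f s = tsum_eval f t) <-> \pi_tensor s = \pi_tensor t.
Proof.
by split=> [h|/eqmodP /asboolP //]; apply/eqmodP/asboolP.
Qed.

Lemma tsum_eval_repr (Z : zmodType) (f : A -> B -> Z) (s : tsum) :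
  biadditive f -> tsum_eval f (repr (\pi_tensor s)) = tsum_eval f s.
Proof.
move=> bf; apply: ((tensorP _ s).2 _ Z f bf); exact: reprK.
Qed.

Definition tsum_opp (s : tsum) : tsum := [seq (- p.1, p.2) | p <- s].
Definition tsum_mul (s t : tsum) : tsum :=
  [seq (p.1 * q.1, p.2 * q.2) | p <- s, q <- t].

Definition tensor_zero : tensor := \pi_tensor ([::] : tsum).
Definition tensor_one : tensor := \pi_tensor ([:: (1, 1)] : tsum).
Definition tensor_add (x y : tensor) : tensor :=
  \pi_tensor (repr x ++ repr y : tsum).
Definition tensor_opp (x : tensor) : tensor := \pi_tensor (tsum_opp (repr x)).
Definition tensor_mul (x y : tensor) : tensor :=
  \pi_tensor (tsum_mul (repr x) (repr y)).

Lemma tsum_eval_cat (Z : zmodType) (f : A -> B -> Z) (s t : tsum) :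
  tsum_eval f (s ++ t) = tsum_eval f s + tsum_eval f t.
Proof. exact: big_cat. Qed.

Lemma biadditive0l (Z : zmodType) (f : A -> B -> Z) b :
  biadditive f -> f 0 b = 0.
Proof. by move=> [fl _]; apply: (@addrI _ (f 0 b)); rewrite -fl !addr0. Qed.

Lemma biadditiveNl (Z : zmodType) (f : A -> B -> Z) a b :
  biadditive f -> f (- a) b = - f a b.
Proof.
move=> bf; apply/eqP; rewrite -addr_eq0; case: (bf) => fl _.
by rewrite -fl addNr biadditive0l.
Qed.

Lemma tsum_eval_opp (Z : zmodType) (f : A -> B -> Z) s : biadditive f ->
  tsum_eval f (tsum_opp s) = - tsum_eval f s.
Proof.
move=> bf; rewrite /tsum_eval big_map -sumrN.
by apply: eq_bigr => p _ /=; rewrite biadditiveNl.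
Qed.

Lemma tsum_eval_mul (Z : zmodType) (f : A -> B -> Z) s t :
  tsum_eval f (tsum_mul s t) =
  tsum_eval (fun a b => tsum_eval (fun a' b' => f (a * a') (b * b')) t) s.
Proof. by rewrite /tsum_eval big_allpairs_dep. Qed.

Lemma biadditive_mull (Z : zmodType) (f : A -> B -> Z) a b : biadditive f ->
  biadditive (fun a' b' => f (a * a') (b * b')).
Proof. by move=> [fl fr]; split=> *; rewrite mulrDr ?fl ?fr. Qed.

Lemma biadditive_mulr (Z : zmodType) (f : A -> B -> Z) t : biadditive f ->
  biadditive (fun a b => tsum_eval (fun a' b' => f (a * a') (b * b')) t).
Proof.
by move=> [fl fr]; split=> *; rewrite /tsum_eval -big_split /=;
  apply: eq_bigr => p _; rewrite mulrDl ?fl ?fr.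
Qed.

Lemma pi_add s t :
  tensor_add (\pi_tensor s) (\pi_tensor t) = \pi_tensor (s ++ t : tsum).
Proof.
by apply/tensorP => Z f bf; rewrite !tsum_eval_cat !tsum_eval_repr.
Qed.

Lemma pi_opp s : tensor_opp (\pi_tensor s) = \pi_tensor (tsum_opp s).
Proof.
by apply/tensorP => Z f bf; rewrite !tsum_eval_opp // tsum_eval_repr.
Qed.

Lemma pi_mul s t :
  tensor_mul (\pi_tensor s) (\pi_tensor t) = \pi_tensor (tsum_mul s t).
Proof.
apply/tensorP => Z f bf; rewrite !tsum_eval_mul.
rewrite tsum_eval_repr; last exact: biadditive_mulr.
apply: eq_bigr => p _; rewrite tsum_eval_repr //.
exact: biadditive_mull.
Qed.

Lemma tensorE (x : tensor) : exists s : tsum, x = \pi_tensor s.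
Proof. by exists (repr x); rewrite reprK. Qed.

Lemma tensor_addA : associative tensor_add.
Proof.
move=> x y z; have [s ->] := tensorE x.
by have [[t ->] [u ->]] := conj (tensorE y) (tensorE z); rewrite !pi_add catA.
Qed.

Lemma tensor_addC : commutative tensor_add.
Proof.
move=> x y; have [[s ->] [t ->]] := conj (tensorE x) (tensorE y).
rewrite !pi_add.
by apply/tensorP => Z f _; rewrite !tsum_eval_cat addrC.
Qed.

Lemma tensor_add0 : left_id tensor_zero tensor_add.
Proof. by move=> x; have [s ->] := tensorE x; rewrite pi_add. Qed.

Lemma tensor_addN : left_inverse tensor_zero tensor_opp tensor_add.
Proof.
move=> x; have [s ->] := tensorE x; rewrite pi_opp pi_add.
apply/tensorP => Z f bf.
by rewrite tsum_eval_cat tsum_eval_opp // addNr /tsum_eval big_nil.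
Qed.

HB.instance Definition _ := GRing.isZmodule.Build tensor
  tensor_addA tensor_addC tensor_add0 tensor_addN.

Lemma tensor_mulA : associative tensor_mul.
Proof.
move=> x y z; have [s ->] := tensorE x.
have [[t ->] [u ->]] := conj (tensorE y) (tensorE z); rewrite !pi_mul.
apply/tensorP => Z f bf; rewrite !tsum_eval_mul.
apply: eq_bigr => p _; rewrite tsum_eval_mul.
by do 2!apply: eq_bigr => ? _; rewrite !mulrA.
Qed.

Lemma tensor_mul1r : left_id tensor_one tensor_mul.
Proof.
move=> x; have [s ->] := tensorE x; rewrite pi_mul; apply/tensorP => Z f bf.
rewrite tsum_eval_mul /tsum_eval big_seq1 /=.
by apply: eq_bigr => p _; rewrite !mul1r.
Qed.

Lemma tensor_mulr1 : right_id tensor_one tensor_mul.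
Proof.
move=> x; have [s ->] := tensorE x; rewrite pi_mul; apply/tensorP => Z f bf.
rewrite tsum_eval_mul /tsum_eval.
by apply: eq_bigr => p _; rewrite big_seq1 /= !mulr1.
Qed.

Lemma tensor_mulDl : left_distributive tensor_mul +%R.
Proof.
move=> x y z; have [s ->] := tensorE x.
have [[t ->] [u ->]] := conj (tensorE y) (tensorE z).
rewrite /GRing.add /= pi_add !pi_mul pi_add; apply/tensorP => Z f bf.
by rewrite tsum_eval_cat !tsum_eval_mul tsum_eval_cat.
Qed.

Lemma tensor_mulDr : right_distributive tensor_mul +%R.
Proof.
move=> x y z; have [s ->] := tensorE x.
have [[t ->] [u ->]] := conj (tensorE y) (tensorE z).
rewrite /GRing.add /= pi_add !pi_mul pi_add; apply/tensorP => Z f bf.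
rewrite tsum_eval_cat !tsum_eval_mul [in RHS]/tsum_eval -big_split /=.
by apply: eq_bigr => p _; rewrite tsum_eval_cat.
Qed.

HB.instance Definition _ := GRing.Zmodule_isPzRing.Build tensor
  tensor_mulA tensor_mul1r tensor_mulr1 tensor_mulDl tensor_mulDr.

Definition pure_tensor (a : A) (b : B) : tensor :=
  \pi_tensor ([:: (a, b)] : tsum).

Lemma pure_tensor_biadditive : biadditive pure_tensor.
Proof.
split=> *; rewrite /GRing.add /= pi_add; apply/tensorP => Z f [fl fr];
by rewrite /tsum_eval !big_cons !big_nil /= ?fl ?fr !addr0.
Qed.

Lemma pi_pure (s : tsum) :
  \pi_tensor s = \sum_(p <- s) pure_tensor p.1 p.2.
Proof.
elim: s => [|[a b] s IH]; first by rewrite big_nil.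
by rewrite big_cons -IH /GRing.add /= pi_add.
Qed.

Lemma tensor_universal (Z : zmodType) (f : A -> B -> Z) : biadditive f ->
  exists! g : tensor -> Z,
    {morph g : x y / x + y} /\ forall a b, g (pure_tensor a b) = f a b.
Proof.
move=> bf; exists (fun x => tsum_eval f (repr x)); split.
  split=> [x y|a b].
    have [[s ->] [t ->]] := conj (tensorE x) (tensorE y).
    by rewrite /GRing.add /= pi_add !tsum_eval_repr // tsum_eval_cat.
  by rewrite tsum_eval_repr // /tsum_eval big_seq1.
move=> g [gD gf]; apply/funext => x; have [s ->] := tensorE x.
have g0 : g 0 = 0 by apply: (@addrI _ (g 0)); rewrite -gD !addr0.
rewrite tsum_eval_repr // pi_pure (big_morph g gD g0).
by apply: eq_bigr => p _.
Qed.

End TensorProduct.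

Definition monotone (m n : nat) (th : 'I_m.+1 -> 'I_n.+1) : Prop :=
  forall i j : 'I_m.+1, (i <= j)%N -> (th i <= th j)%N.

Lemma monotone_id n : monotone (@id 'I_n.+1).
Proof. by []. Qed.

Lemma monotone_comp m n p (th : 'I_m.+1 -> 'I_n.+1) (et : 'I_n.+1 -> 'I_p.+1) :
  monotone th -> monotone et -> monotone (et \o th).
Proof. by move=> h h' i j ij; apply/h'/h. Qed.

Record sset : Type := SSet {
  simp :> nat -> Type;
  sact : forall (m n : nat) (th : 'I_m.+1 -> 'I_n.+1),
    monotone th -> simp n -> simp m;
  sact_id : forall n (x : simp n), sact (@monotone_id n) x = x;
  sact_comp : forall m n p (th : 'I_m.+1 -> 'I_n.+1) (et : 'I_n.+1 -> 'I_p.+1)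
    (hth : monotone th) (het : monotone et) (x : simp p),
    sact (monotone_comp hth het) x = sact hth (sact het x) }.

(* A group is handled through representatives of its elements: [peq] is       *)
(* equality in the group and [pop] the group operation.                       *)
Record pgroup : Type := PGroup {
  pcar :> Type;
  peq : pcar -> pcar -> Prop;
  pop : pcar -> pcar -> pcar }.

Definition pgroup_iso (G H : pgroup) : Prop :=
  exists phi : G -> H,
    [/\ forall x y : G, peq x y <-> peq (phi x) (phi y),
        forall x y : G, peq (phi (pop x y)) (pop (phi x) (phi y)) &
        forall z : H, exists x : G, peq (phi x) z].

Definition pgroup_dsum (I : finType) (G : I -> pgroup) : pgroup :=
  @PGroup (forall i, G i) (fun x y => forall i, peq (x i) (y i))
    (fun x y i => pop (x i) (y i)).

Local Open Scope classical_set_scope.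

Section Realization.
Variables (K : realType) (X : sset).

Definition std_simplex (n : nat) : set 'rV[K]_n.+1 :=
  [set t | (forall i, 0 <= t 0 i) /\ \sum_i t 0 i = 1].

Definition push (m n : nat) (th : 'I_m.+1 -> 'I_n.+1) (t : 'rV[K]_m.+1) :
    'rV[K]_n.+1 :=
  \row_j \sum_(i | th i == j) t 0 i.

Lemma push_simplex m n (th : 'I_m.+1 -> 'I_n.+1) t :
  std_simplex t -> std_simplex (push th t).
Proof.
move=> [t0 t1]; split=> [j|]; first by rewrite mxE sumr_ge0.
rewrite -[RHS]t1 [RHS](partition_big th xpredT) //=.
by apply: eq_bigr => j _; rewrite mxE.
Qed.

Record rpoint : Type := RPoint {
  rdim : nat;
  rsimp : X rdim;
  rbary : 'rV[K]_rdim.+1;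
  rbaryP : std_simplex rbary }.

Inductive rglue : rpoint -> rpoint -> Prop :=
  RGlue m n (th : 'I_m.+1 -> 'I_n.+1) (hth : monotone th) (x : X n)
    (t : 'rV[K]_m.+1) (ht : std_simplex t) :
  rglue (RPoint (sact hth x) ht) (RPoint x (push_simplex th ht)).

(* The geometric realization |X| is the quotient of [rpoint] by [req]. As the *)
(* simplices of [qnerve] below form a type too large to be a [choiceType], it *)
(* cannot be a [topologicalType]: its quotient topology is given by [ropen],  *)
(* and maps to |X| are maps to [rpoint], considered up to [req].              *)
Definition req : rpoint -> rpoint -> Prop := clos_refl_sym_trans _ rglue.

Definition ropen (U : rpoint -> Prop) : Prop :=
  (forall p q, req p q -> U p -> U q) /\
  forall n (x : X n), open
    ([set t : 'rV[K]_n.+1 | exists ht : std_simplex t, U (RPoint x ht)] :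
       set (subspace (@std_simplex n))).

Definition rcontinuous (T : topologicalType) (D : set T) (f : T -> rpoint) :
    Prop :=
  forall U, ropen U -> open ([set t | U (f t)] : set (subspace D)).

Lemma vertex_bary : std_simplex (const_mx 1 : 'rV[K]_1).
Proof. by split=> [i|]; rewrite ?big_ord1 mxE. Qed.

Definition rvertex (x : X 0) : rpoint := RPoint x vertex_bary.

Definition cube (n : nat) : set 'rV[K]_n :=
  [set s | forall i, 0 <= s 0 i <= 1].

Definition cube_boundary (n : nat) : set 'rV[K]_n :=
  [set s | cube s /\ exists i, s 0 i = 0 \/ s 0 i = 1].

Record sphere (n : nat) (x : X 0) : Type := Sphere {
  sph_fun :> 'rV[K]_n -> rpoint;
  sph_cont : rcontinuous (@cube n) sph_fun;
  sph_base : forall s, cube_boundary s -> req (sph_fun s) (rvertex x) }.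
Arguments sph_cont {n x} s : rename.
Arguments sph_base {n x} s : rename.

Definition sph_homotopic (n : nat) (x : X 0) (f g : sphere n x) : Prop :=
  exists H : K * 'rV[K]_n -> rpoint,
    [/\ rcontinuous [set us : K * 'rV[K]_n | 0 <= us.1 <= 1 /\ cube us.2] H,
        forall s, cube s -> req (H (0, s)) (f s),
        forall s, cube s -> req (H (1, s)) (g s) &
        forall u s, 0 <= u <= 1 -> cube_boundary s ->
          req (H (u, s)) (rvertex x)].

Definition dilate (n : nat) (c : K) (s : 'rV[K]_n.+1) : 'rV[K]_n.+1 :=
  \row_i (if i == ord0 then 2 * s 0 i - c else s 0 i).

Definition sph_concat_fun (n : nat) (f g : 'rV[K]_n.+1 -> rpoint)
    (s : 'rV[K]_n.+1) : rpoint :=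
  if s 0 ord0 <= 2^-1 then f (dilate 0 s) else g (dilate 1 s).

Lemma req_refl p : req p p. Proof. exact: rst_refl. Qed.
Lemma req_sym p q : req p q -> req q p. Proof. exact: rst_sym. Qed.
Lemma req_trans p q r : req p q -> req q r -> req p r.
Proof. exact: rst_trans. Qed.

Lemma rcontinuousP (T : topologicalType) (D : set T) (f : T -> rpoint) :
  rcontinuous D f <->
  forall U, ropen U -> exists2 V : set T, closed V &
    forall t, D t -> (V t <-> ~ U (f t)).
Proof.
split=> [h U /h oU|h U /h[V cV VE]].
  have /closed_subspaceP[V cV /seteqP[V1 V2]] :
    closed ([set t | ~ U (f t)] : set (subspace D)) by exact: open_closedC.
  by exists V => // t Dt; split=> H; [case: (V1 t)|case: (V2 t)].
rewrite -[X in open X]setCK; apply: closed_openC; apply/closed_subspaceP.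
exists V => //; apply/seteqP; split=> t [Ht Dt]; split=> //; exact/VE.
Qed.

Lemma dilate_continuous n c : continuous (@dilate n c).
Proof.
have -> : @dilate n c =
    (fun s => s + ((s 0 ord0 - c) *: delta_mx 0 ord0 : 'rV[K]_n.+1)).
  apply/funext => s; apply/rowP => i; rewrite !mxE eqxx /=.
  case: eqP => [->|_]; last by rewrite mulr0 addr0.
  by rewrite mulr1 mulr_natl mulr2n addrA.
move=> s; apply: (cvgD (@cvg_id _ (nbhs s))).
apply: cvgZr_tmp; apply: cvgB; [exact: coord_continuous|exact: cvg_cst].
Qed.

Lemma dilate_cube0 n (s : 'rV[K]_n.+1) :
  cube s -> s 0 ord0 <= 2^-1 -> cube (dilate 0 s).
Proof.
move=> cs s2 i; rewrite mxE subr0; case: eqP => [->|_]; last exact: cs.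
have /andP[s0 _] := cs ord0.
by rewrite mulr_ge0 //= mulrC -ler_pdivlMr ?mul1r.
Qed.

Lemma dilate_cube1 n (s : 'rV[K]_n.+1) :
  cube s -> 2^-1 <= s 0 ord0 -> cube (dilate 1 s).
Proof.
move=> cs s2 i; rewrite mxE; case: eqP => [->|_]; last exact: cs.
have /andP[_ s1] := cs ord0.
rewrite subr_ge0 lerBlDr [2 * _]mulrC -ler_pdivrMr // mul1r s2 /=.
by rewrite -[1 + 1]mul1r ler_pM2r.
Qed.

Lemma dilate_boundary n c (s : 'rV[K]_n.+1) i :
  cube (dilate c s) -> i != ord0 -> s 0 i = 0 \/ s 0 i = 1 ->
  cube_boundary (dilate c s).
Proof.
by move=> cs /negPf i0 si; split=> //; exists i; rewrite mxE i0.
Qed.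

Lemma dilate_seam c n (s : 'rV[K]_n.+1) : cube (dilate c s) ->
  2 * s 0 ord0 - c = 0 \/ 2 * s 0 ord0 - c = 1 -> cube_boundary (dilate c s).
Proof. by move=> cs sE; split=> //; exists ord0; rewrite mxE eqxx. Qed.

Section Concatenation.
Variables (n : nat) (x : X 0) (f g : sphere n.+1 x).

Lemma sph_concat_seam (s : 'rV[K]_n.+1) : cube s -> s 0 ord0 = 2^-1 ->
  req (f (dilate 0 s)) (g (dilate 1 s)).
Proof.
move=> cs sE; apply: (@req_trans _ (rvertex x)).
  apply: sph_base; apply: dilate_seam.
    by apply: dilate_cube0; rewrite ?sE.
  by right; rewrite sE mulfV ?pnatr_eq0 // subr0.
apply/req_sym/sph_base/dilate_seam; first by apply: dilate_cube1; rewrite ?sE.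
by left; rewrite sE mulfV ?pnatr_eq0 // subrr.
Qed.

Lemma sph_concat_cont : rcontinuous (@cube n.+1) (sph_concat_fun f g).
Proof.
apply/rcontinuousP => U oU; have [Usat _] := oU.
have /rcontinuousP/(_ U oU)[V cV VE] := sph_cont f.
have /rcontinuousP/(_ U oU)[W cW WE] := sph_cont g.
have c0 : continuous (fun s : 'rV[K]_n.+1 => s 0 ord0).
  by move=> s; exact: coord_continuous.
exists ([set s : 'rV[K]_n.+1 | s 0 ord0 <= 2^-1] `&` @dilate n 0 @^-1` V `|`
        [set s : 'rV[K]_n.+1 | 2^-1 <= s 0 ord0] `&` @dilate n 1 @^-1` W).
  apply: closedU; apply: closedI.
  - by apply: (preimage_closed _ (@closed_le K 2^-1)) => ? _; exact: c0.
  - by apply: preimage_closed => // ? _; exact: dilate_continuous.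
  - by apply: (preimage_closed _ (@closed_ge K 2^-1)) => ? _; exact: c0.
  - by apply: preimage_closed => // ? _; exact: dilate_continuous.
move=> s cs; rewrite /sph_concat_fun; split=> [[[/= s2 Vs]|[/= s2 Ws]]|].
- by rewrite s2; apply/VE => //; exact: dilate_cube0.
- have Ugs : ~ U (g (dilate 1 s)) by apply/WE => //; exact: dilate_cube1.
  case: ifP => // s2'; apply: contra_not Ugs; apply: Usat.
  by apply: sph_concat_seam => //; apply/le_anti/andP.
case: ifP => [s2 Uf|/negbT s2 Ug].
  by left; split=> //=; apply/VE => //; exact: dilate_cube0.
have s2' : 2^-1 <= s 0 ord0 by apply: ltW; rewrite ltNge.
by right; split=> //=; apply/WE => //; exact: dilate_cube1.
Qed.

Lemma sph_concat_base (s : 'rV[K]_n.+1) : cube_boundary s ->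
  req (sph_concat_fun f g s) (rvertex x).
Proof.
move=> [cs [i si]]; rewrite /sph_concat_fun; case: ifP => [s2|/negbT s2].
  have cd := dilate_cube0 cs s2; apply: sph_base.
  have [i0|] := eqVneq i ord0; last by move=> /dilate_boundary; exact.
  apply: dilate_seam => //; move: s2 si; rewrite i0 => s2 [->|s1].
    by left; rewrite mulr0 subr0.
  by move: s2; rewrite s1 leNgt invf_lt1 ?ltr1n.
have s2' : 2^-1 <= s 0 ord0 by apply: ltW; rewrite ltNge.
have cd := dilate_cube1 cs s2'; apply: sph_base.
have [i0|] := eqVneq i ord0; last by move=> /dilate_boundary; exact.
apply: dilate_seam => //; move: s2 si; rewrite i0 => s2 [s0|->].
  by move: s2; rewrite s0 invr_ge0 ler0n.
by right; rewrite mulr1 addrK.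
Qed.

Definition sph_concat : sphere n.+1 x :=
  Sphere sph_concat_cont sph_concat_base.

End Concatenation.

(* Beware of the shift: this is the homotopy group in dimension n + 1.        *)
Definition homotopy_group (n : nat) (x : X 0) : pgroup :=
  @PGroup (sphere n.+1 x) (@sph_homotopic n.+1 x) (@sph_concat n x).

End Realization.

Record fgmod (A : pzRingType) : Type := FGMod {
  fgmod_sort :> lmodType A;
  fgmodP : @fin_gen A fgmod_sort (fun=> True) }.

Section QConstruction.
Variable A : pzRingType.
Implicit Types M N : fgmod A.

(* M <<- P >-> N; in the abelian category of finitely generated modules over  *)
(* a noetherian ring all epimorphisms and monomorphisms are admissible.       *)
Record span M N : Type := Span {
  apex : fgmod A;
  span_epi : {linear apex -> M};
  span_mono : {linear apex -> N};
  span_epiP : forall x, exists p, span_epi p = x;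
  span_monoP : injective span_mono }.

Definition span_iso M N (s t : span M N) : Prop :=
  exists h : {linear apex s -> apex t}, bijective h /\
    forall p, span_epi t (h p) = span_epi s p /\
              span_mono t (h p) = span_mono s p.

Definition span_rel M N (s : span M N) (x : M) (y : N) : Prop :=
  exists p, span_epi s p = x /\ span_mono s p = y.

(* Morphisms of QA are isomorphism classes of spans; by this lemma such a     *)
(* class is faithfully recorded by the relation [span_rel], and under this    *)
(* encoding the composition of spans by pullback is composition of relations. *)
Lemma span_isoP M N (s t : span M N) :
  span_iso s t <-> (forall x y, span_rel s x y <-> span_rel t x y).
Proof.
split=> [[h [[k hk kh] hE]] x y|st].
  split=> [[p [<- <-]]|[p [<- <-]]].
    by exists (h p); case: (hE p).
  by exists (k p); case: (hE (k p)) => <- <-; rewrite kh.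
have lift (u v : span M N) (uv : forall x y, span_rel u x y -> span_rel v x y)
    p : {q : apex v | span_epi v q = span_epi u p /\
                      span_mono v q = span_mono u p}.
  by apply/cid/uv; exists p.
pose h p := sval (lift s t (fun x y => (st x y).1) p).
pose k p := sval (lift t s (fun x y => (st x y).2) p).
have hE p : span_epi t (h p) = span_epi s p /\
            span_mono t (h p) = span_mono s p.
  by rewrite /h; case: (lift _ _ _ p).
have kE p : span_mono s (k p) = span_mono t p.
  by rewrite /k; case: (lift _ _ _ p) => q /= [].
have hlin : linear h.
  move=> a p q; apply: (@span_monoP _ _ t).
  by rewrite linearP !(hE _).2 linearP.
pose hL := GRing.isLinear.Build A (apex s) (apex t) *:%R h hlin.
pose h' : {linear apex s -> apex t} := HB.pack h hL.
exists h'; split; last exact: hE.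
exists k => p.
  by apply: (@span_monoP _ _ s); rewrite kE (hE p).2.
by apply: (@span_monoP _ _ t); rewrite (hE _).2 kE.
Qed.

Lemma span_comp_pullback M N P (s : span M N) (t : span N P) (u : span M P)
    (a : {linear apex u -> apex s}) (b : {linear apex u -> apex t}) :
  (forall r, span_mono s (a r) = span_epi t (b r)) ->
  (forall p q, span_mono s p = span_epi t q ->
     exists! r, a r = p /\ b r = q) ->
  (forall r, span_epi u r = span_epi s (a r)) ->
  (forall r, span_mono u r = span_mono t (b r)) ->
  forall x z, span_rel u x z <-> exists y, span_rel s x y /\ span_rel t y z.
Proof.
move=> ab pb ue um x z; split=> [[r [<- <-]]|[y [[p [<- py]] [q [qy <-]]]]].
  exists (span_mono s (a r)); split; first by exists (a r).
  by exists (b r); rewrite -ab.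
have [r [[rp rq] _]] := pb p q (etrans py (esym qy)).
by exists r; rewrite ue um rp rq.
Qed.

(* n-simplices of the nerve of QA, as functors from {0, ..., n} to QA.        *)
Record qsimplex (n : nat) : Type := QSimplex {
  qobj : 'I_n.+1 -> fgmod A;
  qarr : forall i j : 'I_n.+1, (i <= j)%N -> qobj i -> qobj j -> Prop;
  qarr_span : forall (i j : 'I_n.+1) (ij : (i <= j)%N),
    exists s : span (qobj i) (qobj j), qarr ij = span_rel s;
  qarr_id : forall (i : 'I_n.+1) (ii : (i <= i)%N) x y, qarr ii x y <-> x = y;
  qarr_comp : forall (i j k : 'I_n.+1)
    (ij : (i <= j)%N) (jk : (j <= k)%N) (ik : (i <= k)%N) x z,
      qarr ik x z <-> exists y, qarr ij x y /\ qarr jk y z }.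

Definition qsimplex_act (m n : nat) (th : 'I_m.+1 -> 'I_n.+1)
    (hth : monotone th) (x : qsimplex n) : qsimplex m :=
  @QSimplex m (fun i => qobj x (th i))
    (fun i j ij => @qarr n x (th i) (th j) (hth i j ij))
    (fun i j ij => qarr_span x (hth i j ij))
    (fun i ii => @qarr_id n x (th i) (hth i i ii))
    (fun i j k ij jk ik =>
       @qarr_comp n x (th i) (th j) (th k)
         (hth i j ij) (hth j k jk) (hth i k ik)).

Lemma qsimplex_eq n (o : 'I_n.+1 -> fgmod A)
    (a a' : forall i j : 'I_n.+1, (i <= j)%N -> o i -> o j -> Prop)
    h1 h2 h3 h1' h2' h3' :
  (forall i j ij, a i j ij = a' i j ij) ->
  @QSimplex n o a h1 h2 h3 = @QSimplex n o a' h1' h2' h3'.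
Proof.
move=> aa'; have e : a = a' by do 3!apply: functional_extensionality_dep => ?.
by subst a'; congr QSimplex; exact: Prop_irrelevance.
Qed.

Lemma qsimplex_act_id n (x : qsimplex n) :
  qsimplex_act (@monotone_id n) x = x.
Proof.
case: x => o a h1 h2 h3; apply: qsimplex_eq => i j ij /=.
by congr (a i j); exact: bool_irrelevance.
Qed.

Lemma qsimplex_act_comp m n p (th : 'I_m.+1 -> 'I_n.+1)
    (et : 'I_n.+1 -> 'I_p.+1) (hth : monotone th) (het : monotone et)
    (x : qsimplex p) :
  qsimplex_act (monotone_comp hth het) x =
  qsimplex_act hth (qsimplex_act het x).
Proof.
by apply: qsimplex_eq => i j ij; congr qarr; exact: bool_irrelevance.
Qed.

Definition qnerve : sset :=
  @SSet qsimplex qsimplex_act qsimplex_act_id qsimplex_act_comp.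

Lemma zero_fgmodP : @fin_gen A 'rV[A]_0 (fun=> True).
Proof.
exists 0%N, (fun=> 0); split=> // x _; exists (fun=> 0).
by rewrite big_ord0; apply/matrixP => i [].
Qed.

Definition zero_fgmod : fgmod A := FGMod zero_fgmodP.

Lemma id_span_subproof (M : fgmod A) :
  exists s : span M M, (fun x y : M => x = y) = span_rel s.
Proof.
exists (@Span M M M idfun idfun (fun x => ex_intro _ x erefl) (fun _ _ => id)).
apply/funext => x; apply/funext => y; apply/propext.
by split=> [->|[p [<- <-]]]; [exists y|].
Qed.

Definition qvertex (M : fgmod A) : qnerve 0.
Proof.
apply: (@QSimplex 0 (fun=> M) (fun _ _ _ x y => x = y)) => //.
- by move=> *; exact: id_span_subproof.
- by move=> i j k _ _ _ x z; split=> [->|[y [-> ->]]] //; exists z.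
Defined.

End QConstruction.

(* G_n(A) = K_n of the category of finitely generated left A-modules, which   *)
(* is the (n + 1)-st homotopy group of the classifying space of QA at 0.      *)
Definition Gtheory (K : realType) (A : pzRingType) (n : nat) : pgroup :=
  @homotopy_group K (qnerve A) n (qvertex (zero_fgmod A)).

Record subring (A : pzRingType) : Type := Subring {
  subring_mem :> {pred A};
  subringP : subring_closed subring_mem }.

Section SubringType.
Variables (A : pzRingType) (S : subring A).

Definition subring_type : Type := {x : A | x \in subring_mem S}.
HB.instance Definition _ := SubChoice.on subring_type.
HB.instance Definition _ := GRing.SubChoice_isSubPzRing.Build A
  (subring_mem S) subring_type (subringP S).

End SubringType.

(* q lies in Z[1/w]. *)
Definition Zinv (w : nat) (q : rat) : Prop :=
  exists (a : int) (k : nat), q = a%:~R / w%:R ^+ k.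

Section Orders.
Variables (w n : nat) (D : {pred 'M[rat]_n}).

(* Z[1/w]-orders in a Q-subalgebra D of the n x n rational matrices: subrings *)
(* of D that are finitely generated over Z[1/w] and span D over Q.            *)
Definition is_order (L : subring 'M[rat]_n) : Prop :=
  [/\ {subset L <= D},
      exists (m : nat) (v : 'I_m -> 'M[rat]_n), forall x,
        x \in L <-> exists c : 'I_m -> rat,
          (forall i, Zinv w (c i)) /\ x = \sum_(i < m) c i *: v i &
      forall x, x \in D ->
        exists (m : nat) (v : 'I_m -> 'M[rat]_n) (c : 'I_m -> rat),
          (forall i, v i \in L) /\ x = \sum_(i < m) c i *: v i].

Definition is_maximal_order (L : subring 'M[rat]_n) : Prop :=
  is_order L /\
  forall L' : subring 'M[rat]_n, is_order L' ->
    {subset L <= L'} -> {subset L' <= L}.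

End Orders.

Section RationalRepresentations.
Variables (K : realType) (gT : finGroupType) (G : {group gT}).
Variables (n : nat) (rG : mx_representation rat G n).

Definition complexification : mx_representation K[i] G n :=
  map_repr (ratr : {rmorphism rat -> K[i]}) rG.

(* The QG-endomorphisms of V_rho, both G and endomorphisms acting by left     *)
(* multiplication on column vectors.                                          *)
Definition endo_algebra : {pred 'M[rat]_n} := [pred f | centgmx rG f].

(* All irreducible complex constituents have the same dimension, so that the  *)
(* choice made by [xget] is immaterial.                                       *)
Definition constituent_dim : nat :=
  xget 0%N [set d | exists2 U : 'M[K[i]]_n,
                      mxsimple complexification U & \rank U = d].

Definition omega : nat := #|G| %/ (#|rker rG| * constituent_dim).

End RationalRepresentations.

(* The elements rho of [sG : irrType rat G] index the irreducible rational    *)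
(* representations [irr_repr rho] of G up to isomorphism: sG is X(G). The     *)
(* maximal orders [L rho] are a parameter.                                    *)
Definition HTW_decomposition (K : realType) (gT : finGroupType)
    (G : {group gT}) (sG : irrType rat G)
    (L : forall rho : sG, subring 'M[rat]_(irr_degree rho)) : Prop :=
  forall (R : pzRingType) (n : nat), noetherian R ->
    pgroup_iso (Gtheory K (grpring R (subg_of G)) n)
      (pgroup_dsum (fun rho : sG =>
         Gtheory K (tensor R (subring_type (L rho))) n)).

Definition SL2F3_set : {set {'GL_2(3)}} :=
  finset (fun u : {'GL_2(3)} => \det (GLval u) == 1).

Lemma SL2F3_group_set : group_set SL2F3_set.
Proof.
apply/group_setP; split=> [|u v]; first by rewrite inE det1.
by rewrite !inE => /eqP du /eqP dv; rewrite det_mulmx du dv mulr1.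
Qed.

Definition SL2F3 : {group {'GL_2(3)}} := Group SL2F3_group_set.

(* Main.v *)
Require Import Defs.
From HB Require Import structures.
From Stdlib Require Import Relations.
From mathcomp Require Import all_boot all_order all_algebra all_fingroup.
From mathcomp Require Import mxrepresentation complex ring lra zify.
From mathcomp Require Import boolp classical_sets reals topology normedtype.

Set Implicit Arguments.
Unset Strict Implicit.
Unset Printing Implicit Defensive.
Set Bullet Behavior "Strict Subproofs".

Import Order.TTheory GRing.Theory Num.Theory.
Import numFieldNormedType.Exports.
Import Defs.

Local Open Scope ring_scope.
Local Open Scope classical_set_scope.

(** Take R = F_3 and n = 0. A morphism of Q(F_3 G) is a relation N of modules;
    for an idempotent e of F_3 G, log_3 of the number of e-fixed y related to 0 is
    additive under composition, hence extends affinely over simplices to a map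
    from the classifying space to R/Z, whose winding numbers give a homomorphism
    from pi_1(Q(F_3 G)) = G_0(F_3 G) to the integers. Three idempotents, evaluated on
    the trivial module, the natural module and the 2x2 matrices under
    conjugation, give three linearly independent homomorphisms.

    On the other side, F_3 (x) Lambda_rho is zero when 3 divides omega_rho, which
    fails only for the trivial representation and for the 3-dimensional monomial
    one. For these two D_rho = Q, every nonzero element of F_3 (x) Lambda_rho is
    invertible, every module is free, and a homomorphism from pi_1 to an abelian
    group is zero as soon as it vanishes on the loop of the free module of rank
    one. A nonzero combination of the three winding numbers vanishes on these two
    loops, hence everywhere.

    The last fact on pi_1 is obtained without cellular approximation: every point
    of the realization has a neighbourhood that deforms, naturally in simplicial
    operators, onto a vertex, and a loop is subdivided accordingly. *)

(** * Paths in the realization *)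

(** The obstruction is one of rank. Modulo 3 the group has three simple modules, so the left side
    has rank 3, while only two factors on the right contribute and each is generated by one class.
    Neither side is computed: three independent functionals on the left are played against two
    vectors on the right.

    An idempotent e makes M -> eM exact, whence additivity. Averages over the cyclic groups of order
    4 and 2 exist mod 3, and the third idempotent is 1; the values on the three test modules are (1,
    1, 1), (0, 0, 2) and (2, 4, 4).

    When 3 divides omega the order is a module over Z[1/omega], which contains 1/3; this kills the
    tensor product. The two exceptional representations have omega = 1 and 4.

    The realization has a quotient topology and its points are given by representatives, so equality
    of points is [req] and a construction must be made on all simplices at once, compatibly with
    simplicial operators. Hence a neighbourhood of a point is described by data meaningful in every
    simplex: a subinterval of [0, 1] and a module. *)

Section Clamp.
Variable K : realType.
Implicit Types s u : K.

Definition clamp u : K := Num.max 0 (Num.min 1 u).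

Lemma clamp_itv u : 0 <= clamp u <= 1.
Proof. by rewrite /clamp le_max lexx ge_max ler01 ge_min lexx. Qed.

Lemma clamp_id u : 0 <= u <= 1 -> clamp u = u.
Proof. by case/andP=> u0 u1; rewrite /clamp min_r // max_r. Qed.

Lemma clamp_le0 u : u <= 0 -> clamp u = 0.
Proof. by move=> u0; rewrite /clamp min_r ?max_l // (le_trans u0). Qed.

Lemma clamp_ge1 u : 1 <= u -> clamp u = 1.
Proof. by move=> u1; rewrite /clamp min_l ?max_r. Qed.

Lemma clamp_continuous : continuous clamp.
Proof.
move=> u; rewrite /clamp; apply: continuous_max; first exact: cst_continuous.
by apply: continuous_min; [exact: cst_continuous|exact: cvg_id].
Qed.

End Clamp.

Lemma continuous_pair (T U V : topologicalType) (f : T -> U) (g : T -> V) :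
  continuous f -> continuous g -> continuous (fun x => (f x, g x)).
Proof. by move=> cf cg x; apply: cvg_pair => /=; [exact: cf|exact: cg]. Qed.

Section RealizationMaps.
Variables (K : realType) (X : sset).
Local Notation point := (rpoint K X).

Lemma rcontinuousPo (T : topologicalType) (D : set T) (f : T -> point) :
  rcontinuous D f <->
  forall U, ropen U -> exists2 O : set T, open O &
    forall t, D t -> (O t <-> U (f t)).
Proof.
split=> [h U /h /open_subspaceP[O oO OE]|h U /h[O oO OE]].
  move/seteqP: OE => [O1 O2].
  by exists O => // t Dt; split=> H; [case: (O1 t)|case: (O2 t)].
apply/open_subspaceP; exists O => //.
by apply/seteqP; split=> t [Ht Dt]; split=> //; exact/OE.
Qed.

Lemma rcontinuous_comp (T T' : topologicalType) (D : set T) (D' : set T')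
    (h : T' -> T) (f : T -> point) :
  continuous h -> (forall t, D' t -> D (h t)) -> rcontinuous D f ->
  rcontinuous D' (f \o h).
Proof.
move=> ch DD /rcontinuousPo cf; apply/rcontinuousPo => U /cf[O oO OE].
exists (h @^-1` O); first by apply: open_comp => // t _; exact: ch.
by move=> t /DD /OE.
Qed.

Lemma rcontinuous_cst (T : topologicalType) (D : set T) (p : point) :
  rcontinuous D (fun=> p).
Proof.
apply/rcontinuousPo => U _; have [Up|nUp] := pselect (U p).
  by exists setT => //; exact: openT.
by exists set0 => //; exact: open0.
Qed.

Lemma rcontinuous_req (T : topologicalType) (D : set T) (f g : T -> point) :
  rcontinuous D f -> (forall t, D t -> req (f t) (g t)) -> rcontinuous D g.
Proof.
move=> /rcontinuousPo cf fg; apply/rcontinuousPo => U oU.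
have [O oO OE] := cf U oU; exists O => // t Dt; rewrite OE //.
by have [Us _] := oU; split; apply: Us; [exact: fg|apply/req_sym/fg].
Qed.

Lemma rcontinuous_paste (T : topologicalType) (D A B : set T) (f : T -> point) :
  closed A -> closed B -> D `<=` A `|` B ->
  rcontinuous (D `&` A) f -> rcontinuous (D `&` B) f -> rcontinuous D f.
Proof.
move=> cA cB DAB /rcontinuousP fA /rcontinuousP fB; apply/rcontinuousP => U oU.
have [V cV VE] := fA U oU; have [W cW WE] := fB U oU.
exists ((V `&` A) `|` (W `&` B)).
  by apply: closedU; apply: closedI.
move=> t Dt; split=> [[[Vt At]|[Wt Bt]]|nU].
- exact/VE.
- exact/WE.
- by have [At|Bt] := DAB _ Dt; [left|right]; split=> //; [apply/VE|apply/WE].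
Qed.

Lemma rpoint_eq n (x : X n) (t t' : 'rV[K]_n.+1) (ht : std_simplex t)
    (ht' : std_simplex t') : t = t' -> RPoint x ht = RPoint x ht'.
Proof. by move=> e; case: t' / e ht' => ht'; congr RPoint; exact: Prop_irrelevance. Qed.

Lemma rcontinuous_simplex (T : topologicalType) (D : set T) n (x : X n)
    (phi : T -> 'rV[K]_n.+1) (hphi : forall t, std_simplex (phi t)) :
  continuous phi -> rcontinuous D (fun t => RPoint x (hphi t)).
Proof.
move=> cphi; apply/rcontinuousPo => U [_ oU].
have /open_subspaceP[O oO /seteqP[OE1 OE2]] := oU n x.
exists (phi @^-1` O); first by apply: open_comp => // t _; exact: cphi.
move=> t _; split=> [Ot|Ut].
  by have [] := OE1 (phi t) (conj Ot (hphi t)) => -[ht]; rewrite (Prop_irrelevance ht (hphi t)).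
by have [] := OE2 (phi t) (conj (ex_intro _ (hphi t) Ut) (hphi t)).
Qed.

(** The parameter is clamped so that the result stays in the simplex for every real [u]. Segments
    are then total functions on [K]. *)
Definition convex (n : nat) (u : K) (t t' : 'rV[K]_n.+1) : 'rV[K]_n.+1 :=
  (1 - clamp u) *: t + clamp u *: t'.

Lemma convex_simplex n u (t t' : 'rV[K]_n.+1) :
  std_simplex t -> std_simplex t' -> std_simplex (convex u t t').
Proof.
move=> [t0 t1] [t0' t1']; have /andP[u0 u1] := clamp_itv u.
split=> [i|]; first by rewrite !mxE addr_ge0 // mulr_ge0 // subr_ge0.
under eq_bigr => i _ do rewrite !mxE.
by rewrite big_split /= -!mulr_sumr t1 t1' !mulr1 subrK.
Qed.

Lemma convex_le0 n u (t t' : 'rV[K]_n.+1) : u <= 0 -> convex u t t' = t.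
Proof. by move=> u0; rewrite /convex clamp_le0 // subr0 scale1r scale0r addr0. Qed.

Lemma convex_ge1 n u (t t' : 'rV[K]_n.+1) : 1 <= u -> convex u t t' = t'.
Proof. by move=> u0; rewrite /convex clamp_ge1 // subrr scale1r scale0r add0r. Qed.

Lemma convexxx n u (t : 'rV[K]_n.+1) : convex u t t = t.
Proof. by rewrite /convex -scalerDl subrK scale1r. Qed.

Lemma convex_cvg (T : topologicalType) n (u : T -> K) (t t' : T -> 'rV[K]_n.+1) :
  continuous u -> continuous t -> continuous t' ->
  continuous (fun x => convex (u x) (t x) (t' x)).
Proof.
move=> cu ct ct' x.
have cc : {for x, continuous (fun x => clamp (u x))}.
  by apply: continuous_comp; [exact: cu|exact: clamp_continuous].
apply: cvgD; apply: cvgZ; [|exact: ct|exact: cc|exact: ct'].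
by apply: cvgB; [exact: cvg_cst|exact: cc].
Qed.

Lemma convex_cst_cvg (T : topologicalType) n (u : T -> K)
    (t t' : 'rV[K]_n.+1) :
  continuous u -> continuous (fun x => convex (u x) t t').
Proof. by move=> cu; apply: convex_cvg => // ?; exact: cvg_cst. Qed.

Definition seg n (x : X n) (t t' : 'rV[K]_n.+1) (ht : std_simplex t)
    (ht' : std_simplex t') (u : K) : point := RPoint x (convex_simplex u ht ht').

End RealizationMaps.

Lemma continuous_minr (K : realType) (T : topologicalType) (f g : T -> K) :
  continuous f -> continuous g -> continuous (fun x => Num.min (f x) (g x)).
Proof. by move=> cf cg x; apply: continuous_min; [exact: cf|exact: cg]. Qed.

Lemma continuous_maxr (K : realType) (T : topologicalType) (f g : T -> K) :
  continuous f -> continuous g -> continuous (fun x => Num.max (f x) (g x)).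
Proof. by move=> cf cg x; apply: continuous_max; [exact: cf|exact: cg]. Qed.

Lemma continuous_subr (K : realType) (T : topologicalType) (f g : T -> K) :
  continuous f -> continuous g -> continuous (fun x => f x - g x).
Proof. by move=> cf cg x; apply: cvgB; [exact: cf|exact: cg]. Qed.

Lemma continuous_mulr (K : realType) (T : topologicalType) (f g : T -> K) :
  continuous f -> continuous g -> continuous (fun x => f x * g x).
Proof. by move=> cf cg x; apply: cvgM; [exact: cf|exact: cg]. Qed.

Section Paths.
Variables (K : realType) (X : sset).
Local Notation point := (rpoint K X).
Implicit Types f g h : K -> point.

Definition unit_itv : set K := [set s | 0 <= s <= 1].
Definition square : set (K * K) :=
  [set us | 0 <= us.1 <= 1 /\ 0 <= us.2 <= 1].

Definition ispath f := rcontinuous unit_itv f.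

Definition path_homotopic f g : Prop :=
  exists H : K * K -> point,
    [/\ rcontinuous square H,
        forall s, 0 <= s <= 1 -> req (H (0, s)) (f s),
        forall s, 0 <= s <= 1 -> req (H (1, s)) (g s) &
        forall u, 0 <= u <= 1 ->
          req (H (u, 0)) (f 0) /\ req (H (u, 1)) (f 1)].
Local Notation "f ~~ g" := (path_homotopic f g) (at level 70).

Lemma homotopic_ends f g : f ~~ g -> req (f 0) (g 0) /\ req (f 1) (g 1).
Proof.
case=> H [_ H0 H1 He].
have [e0 e1] := He 1 (introT andP (conj ler01 (lexx _))).
split; [apply: req_trans (req_sym e0) _|apply: req_trans (req_sym e1) _];
by apply: H1; rewrite ?lexx ?ler01.
Qed.

Lemma cont_fst : continuous (fst : K * K -> K).
Proof. by move=> x; exact: cvg_fst. Qed.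
Lemma cont_snd : continuous (snd : K * K -> K).
Proof. by move=> x; exact: cvg_snd. Qed.

Lemma homotopic_req f g : ispath f ->
  (forall s, 0 <= s <= 1 -> req (f s) (g s)) -> f ~~ g.
Proof.
move=> cf fg; exists (fun us => f us.2); split.
- by apply: (rcontinuous_comp cont_snd _ cf) => -[u r] /= [].
- by move=> s _; exact: req_refl.
- by [].
- by move=> u _; split; exact: req_refl.
Qed.

Lemma homotopic_refl f : ispath f -> f ~~ f.
Proof. by move=> cf; apply: homotopic_req => // s _; exact: req_refl. Qed.

Lemma homotopic_sym f g : f ~~ g -> g ~~ f.
Proof.
move=> fg; have [e0 e1] := homotopic_ends fg; case: fg => H [cH H0 H1 He].
exists (fun us => H (1 - us.1, us.2)); split=> /=.
- apply: (rcontinuous_comp (h := fun us : K * K => (1 - us.1, us.2)) _ _ cH).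
    apply: continuous_pair; last exact: cont_snd.
    by move=> us; apply: cvgB; [exact: cvg_cst|exact: cont_fst].
  by move=> [u s] [/= /andP[u0 u1] ?]; split => //=; rewrite subr_ge0 u1 gerBl u0.
- by move=> s s01; rewrite subr0; exact: H1.
- by move=> s s01; rewrite subrr; exact: H0.
- move=> u /andP[u0 u1]; have [] := He (1 - u).
    by rewrite subr_ge0 u1 gerBl u0.
  by move=> h0 h1; split; [exact: req_trans h0 _|exact: req_trans h1 _].
Qed.

Lemma req_if (b : bool) (p q r : point) :
  (b -> req p r) -> (~~ b -> req q r) -> req (if b then p else q) r.
Proof. by case: b => h1 h2; [exact: h1|exact: h2]. Qed.

(** Continuity into the realization is insensitive to [req], so the two halves only have to agree up
    to [req] on the seam. *)
Lemma rcontinuous_half (T : topologicalType) (D : set T) (c : T -> K)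
    (F G : T -> point) : continuous c ->
  rcontinuous (D `&` [set t | c t <= 2^-1]) F ->
  rcontinuous (D `&` [set t | 2^-1 <= c t]) G ->
  (forall t, D t -> c t = 2^-1 -> req (F t) (G t)) ->
  rcontinuous D (fun t => if c t <= 2^-1 then F t else G t).
Proof.
move=> cc cF cG FG.
have cA : closed [set t | c t <= 2^-1].
  by apply: (preimage_closed _ (@closed_le K 2^-1)) => ? _; exact: cc.
have cB : closed [set t | 2^-1 <= c t].
  by apply: (preimage_closed _ (@closed_ge K 2^-1)) => ? _; exact: cc.
apply: (rcontinuous_paste cA cB) => [t _ /=||].
- by case: (leP (c t) 2^-1) => [|/ltW]; [left|right].
- apply: (rcontinuous_req cF) => t [_ /= ->]; exact: req_refl.
- apply: (rcontinuous_req cG) => t [Dt /= tc]; case: ifP => [tc'|_].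
    by apply/req_sym/FG => //; apply/le_anti/andP.
  exact: req_refl.
Qed.

Lemma homotopic_trans f g h : f ~~ g -> g ~~ h -> f ~~ h.
Proof.
move=> fg; have [e0 e1] := homotopic_ends fg; case: fg => H [cH H0 H1 He].
move=> [G [cG G0 G1 Ge]].
exists (fun us => if us.1 <= 2^-1 then H (2 * us.1, us.2)
                  else G (2 * us.1 - 1, us.2)); split=> /=.
- apply: (rcontinuous_half cont_fst).
  + apply: (rcontinuous_comp (h := fun us : K * K => (2 * us.1, us.2)) _ _ cH).
      apply: continuous_pair; last exact: cont_snd.
      by move=> us; apply: cvgM; [exact: cvg_cst|exact: cont_fst].
    move=> [u s] [[/= /andP[u0 u1] s01] u2]; split=> //=; apply/andP.
    by split; lra.
  + apply: (rcontinuous_comp (h := fun us : K * K => (2 * us.1 - 1, us.2)) _ _ cG).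
      apply: continuous_pair; last exact: cont_snd.
      move=> us; apply: cvgB; last exact: cvg_cst.
      by apply: cvgM; [exact: cvg_cst|exact: cont_fst].
    move=> [u s] [[/= /andP[u0 u1] s01] u2]; split=> //=; apply/andP.
    by split; lra.
  + move=> [u s] [/= _ s01] ->; rewrite mulfV ?pnatr_eq0 // subrr.
    by apply: req_trans (H1 s s01) _; apply/req_sym/G0.
- by move=> s s01; rewrite ifT ?mulr0; [exact: H0|rewrite invr_ge0 ler0n].
- move=> s s01; rewrite ifF; last by apply/negbTE; rewrite -ltNge; lra.
  by rewrite (_ : 2 * 1 - 1 = 1); [exact: G1|ring].
- move=> u /andP[u0 u1]; split; apply: req_if.
  + by move=> u2; apply: (He _ _).1; apply/andP; split; lra.
  + rewrite -ltNge => u2; apply: req_trans _ (req_sym e0).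
    by apply: (Ge _ _).1; apply/andP; split; lra.
  + by move=> u2; apply: (He _ _).2; apply/andP; split; lra.
  + rewrite -ltNge => u2; apply: req_trans _ (req_sym e1).
    by apply: (Ge _ _).2; apply/andP; split; lra.
Qed.

Definition pcat f g : K -> point :=
  fun s => if s <= 2^-1 then f (2 * s) else g (2 * s - 1).
Definition pinv f : K -> point := fun s => f (1 - s).

Lemma cont_affine (a b : K) : continuous (fun s : K => a * s + b).
Proof.
move=> s; apply: cvgD; last exact: cvg_cst.
by apply: cvgM; [exact: cvg_cst|exact: cvg_id].
Qed.

Lemma pcat_path f g : ispath f -> ispath g -> req (f 1) (g 0) ->
  ispath (pcat f g).
Proof.
move=> cf cg e; apply: (rcontinuous_half (c := id)).
- by move=> x; exact: cvg_id.
- apply: (rcontinuous_comp (h := fun s : K => 2 * s) _ _ cf).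
    by move=> s; apply: cvgM; [exact: cvg_cst|exact: cvg_id].
  by move=> s [/= /andP[s0 s1] s2]; apply/andP; split; lra.
- apply: (rcontinuous_comp (h := fun s : K => 2 * s - 1) _ _ cg).
    exact: cont_affine.
  by move=> s [/= /andP[s0 s1] s2]; apply/andP; split; lra.
- by move=> s _ ->; rewrite mulfV ?pnatr_eq0 // subrr.
Qed.

Lemma pcat0 f g : pcat f g 0 = f 0.
Proof. by rewrite /pcat ifT ?mulr0 // invr_ge0 ler0n. Qed.

Lemma pcat1 f g : pcat f g 1 = g 1.
Proof.
rewrite /pcat ifF; last by apply/negbTE; rewrite -ltNge; lra.
by congr g; ring.
Qed.

Lemma pinv_path f : ispath f -> ispath (pinv f).
Proof.
move=> cf; apply: (rcontinuous_comp (h := fun s : K => 1 - s) _ _ cf).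
  by move=> s; apply: cvgB; [exact: cvg_cst|exact: cvg_id].
by move=> s /andP[s0 s1]; apply/andP; split; lra.
Qed.

Lemma pinv0 f : pinv f 0 = f 1. Proof. by rewrite /pinv subr0. Qed.
Lemma pinv1 f : pinv f 1 = f 0. Proof. by rewrite /pinv subrr. Qed.

Lemma homotopic_pcat f f' g g' : req (f 1) (g 0) ->
  f ~~ f' -> g ~~ g' -> pcat f g ~~ pcat f' g'.
Proof.
move=> e [H [cH H0 H1 He]] [G [cG G0 G1 Ge]].
exists (fun us => if us.2 <= 2^-1 then H (us.1, 2 * us.2)
                  else G (us.1, 2 * us.2 - 1)); split=> /=.
- apply: (rcontinuous_half cont_snd).
  + apply: (rcontinuous_comp (h := fun us : K * K => (us.1, 2 * us.2)) _ _ cH).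
      apply: continuous_pair; first exact: cont_fst.
      by move=> us; apply: cvgM; [exact: cvg_cst|exact: cont_snd].
    move=> [u s] [[/= s01 /andP[u0 u1]] u2]; split=> //=; apply/andP.
    by split; lra.
  + apply: (rcontinuous_comp (h := fun us : K * K => (us.1, 2 * us.2 - 1)) _ _ cG).
      apply: continuous_pair; first exact: cont_fst.
      move=> us; apply: cvgB; last exact: cvg_cst.
      by apply: cvgM; [exact: cvg_cst|exact: cont_snd].
    move=> [u s] [[/= s01 /andP[u0 u1]] u2]; split=> //=; apply/andP.
    by split; lra.
  + move=> [u s] [/= u01 _] ->; rewrite mulfV ?pnatr_eq0 // subrr.
    apply: req_trans (He _ u01).2 _; apply: req_trans e _.
    exact/req_sym/(Ge _ u01).1.
- move=> s /andP[s0 s1]; rewrite /pcat; case: ifP => [|/negbT]; rewrite -?ltNge => s2.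
    by apply: H0; apply/andP; split; lra.
  by apply: G0; apply/andP; split; lra.
- move=> s /andP[s0 s1]; rewrite /pcat; case: ifP => [|/negbT]; rewrite -?ltNge => s2.
    by apply: H1; apply/andP; split; lra.
  by apply: G1; apply/andP; split; lra.
- move=> u u01; rewrite pcat0 pcat1 ifT ?invr_ge0 ?ler0n // mulr0.
  rewrite ifF; last by apply/negbTE; rewrite -ltNge; lra.
  rewrite (_ : 2 * 1 - 1 = 1); last by ring.
  by split; [exact: (He _ u01).1|exact: (Ge _ u01).2].
Qed.

(** Interpolate linearly between [a] and [b] inside the unit interval, which is convex, and compose
    with [f]. *)
Lemma homotopic_reparam f (a b : K -> K) : ispath f ->
  continuous a -> continuous b ->
  (forall s, 0 <= s <= 1 -> 0 <= a s <= 1) ->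
  (forall s, 0 <= s <= 1 -> 0 <= b s <= 1) ->
  a 0 = b 0 -> a 1 = b 1 -> f \o a ~~ f \o b.
Proof.
move=> cf ca cb a01 b01 ab0 ab1.
pose m (us : K * K) := (1 - us.1) * a us.2 + us.1 * b us.2.
exists (f \o m); split=> /=.
- apply: (rcontinuous_comp (h := m) _ _ cf).
    have cs (c : K -> K) us : continuous c -> {for us, continuous (fun us : K * K => c us.2)}.
      by move=> cc; apply: continuous_comp; [exact: cont_snd|exact: cc].
    move=> us; apply: cvgD; apply: cvgM; [|exact: cs|exact: cont_fst|exact: cs].
    by apply: cvgB; [exact: cvg_cst|exact: cont_fst].
  move=> [u s] [/= /andP[u0 u1] s01].
  have /andP[a0 a1] := a01 s s01; have /andP[b0 b1] := b01 s s01.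
  rewrite /m /=; apply/andP; split; first by rewrite addr_ge0 // mulr_ge0 // subr_ge0.
  by rewrite /=; nra.
- by move=> s _; rewrite /m /= subr0 mul1r mul0r addr0; exact: req_refl.
- by move=> s _; rewrite /m /= subrr mul1r mul0r add0r; exact: req_refl.
- move=> u _; rewrite /m /= ab0 ab1 -!mulrDl subrK !mul1r.
  by split; exact: req_refl.
Qed.

Lemma homotopic_reparam_id f (a : K -> K) : ispath f -> continuous a ->
  (forall s, 0 <= s <= 1 -> 0 <= a s <= 1) -> a 0 = 0 -> a 1 = 1 ->
  f \o a ~~ f.
Proof.
move=> cf ca a01 a0 a1; apply: (@homotopic_reparam f a id) => //.
by move=> x; exact: cvg_id.
Qed.

Lemma cont_clamp_affine (a b : K) : continuous (fun s : K => clamp (a * s + b)).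
Proof.
move=> s; apply: (@continuous_comp _ _ _ (fun s => a * s + b)).
  exact: cont_affine.
exact: clamp_continuous.
Qed.

Lemma homotopic_catA f g h : ispath f -> ispath g -> ispath h ->
  req (f 1) (g 0) -> req (g 1) (h 0) ->
  pcat (pcat f g) h ~~ pcat f (pcat g h).
Proof.
move=> cf cg ch fg gh.
have cp : ispath (pcat f (pcat g h)).
  by rewrite /ispath; apply: pcat_path => //; [exact: pcat_path|rewrite pcat0].
(* The change of parameter between the two bracketings is concave, with slopes 2, 1, 1/2 and breaks
   at 1/4 and 1/2, hence a minimum of three affine functions. *)
pose a (s : K) := Num.min (Num.min (2 * s) (s + 4%:R^-1)) (2^-1 * s + 2^-1).
have ca : continuous a.
  apply: continuous_minr; last exact: cont_affine.
  apply: continuous_minr => s.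
    by apply: cvgM; [exact: cvg_cst|exact: cvg_id].
  by apply: cvgD; [exact: cvg_id|exact: cvg_cst].
apply: (@homotopic_trans _ (pcat f (pcat g h) \o a)).
  apply: homotopic_req => [|s /andP[s0 s1]].
    by apply: pcat_path => //; [exact: pcat_path|rewrite pcat1].
  rewrite /pcat /= /a; case: (leP s 2^-1) => s2.
    have -> : Num.min (Num.min (2 * s) (s + 4^-1)) (2^-1 * s + 2^-1) =
              Num.min (2 * s) (s + 4^-1).
      by rewrite min_l // ge_min; apply/orP; right; lra.
    case: (leP (2 * s) (s + 4^-1)) => s4.
      by rewrite !ifT; [exact: req_refl|lra|lra].
    rewrite ifF; last by apply/negbTE; rewrite -ltNge; lra.
    rewrite ifF; last by apply/negbTE; rewrite -ltNge; lra.
    rewrite ifT; last by lra.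
    rewrite (_ : 2 * (2 * (s + 4^-1) - 1) = 2 * (2 * s) - 1); last by field.
    exact: req_refl.
  rewrite min_r; last by rewrite le_min; apply/andP; split; lra.
  rewrite ifF; last by apply/negbTE; rewrite -ltNge; lra.
  rewrite ifF; last by apply/negbTE; rewrite -ltNge; lra.
  rewrite (_ : 2 * (2 * (2^-1 * s + 2^-1) - 1) - 1 = 2 * s - 1); last by field.
  exact: req_refl.
apply: homotopic_reparam_id => //.
- move=> s /andP[s0 s1]; rewrite /a !le_min !ge_min; apply/andP; split.
    by apply/andP; split; [apply/andP; split|]; lra.
  by apply/orP; right; lra.
- by rewrite /a !mulr0 !add0r !min_l //; lra.
- rewrite /a min_r; first by field.
  by rewrite le_min; apply/andP; split; lra.
Qed.

Lemma homotopic_cat1 f g : ispath f ->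
  (forall s, 0 <= s <= 1 -> req (g s) (f 1)) -> pcat f g ~~ f.
Proof.
move=> cf gc; pose a (s : K) := clamp (2 * s + 0).
have cg : ispath g.
  apply: (@rcontinuous_req _ _ _ _ (fun=> f 1)) => [|s s01]; last exact/req_sym/gc.
  exact: rcontinuous_cst.
apply: (@homotopic_trans _ (f \o a)).
  apply: homotopic_req => [|s /andP[s0 s1]].
    by apply: pcat_path => //; apply/req_sym/gc; rewrite lexx ler01.
  rewrite /a /= addr0 /pcat; case: leP => s2.
    by rewrite clamp_id; [exact: req_refl|apply/andP; split; lra].
  by rewrite clamp_ge1; [apply: gc; apply/andP; split; lra|lra].
apply: homotopic_reparam_id => //.
- exact: cont_clamp_affine.
- by move=> s _; exact: clamp_itv.
- by rewrite /a mulr0 addr0 clamp_le0.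
- by rewrite /a clamp_ge1 //; lra.
Qed.

Lemma homotopic_1cat f g : ispath g ->
  (forall s, 0 <= s <= 1 -> req (f s) (g 0)) -> pcat f g ~~ g.
Proof.
move=> cg fc; pose a (s : K) := clamp (2 * s + -1).
have cf : ispath f.
  apply: (@rcontinuous_req _ _ _ _ (fun=> g 0)) => [|s s01]; last exact/req_sym/fc.
  exact: rcontinuous_cst.
apply: (@homotopic_trans _ (g \o a)).
  apply: homotopic_req => [|s /andP[s0 s1]].
    by apply: pcat_path => //; apply/fc; rewrite lexx ler01.
  rewrite /a /= /pcat; case: leP => s2.
    by rewrite clamp_le0; [apply: fc; apply/andP; split; lra|lra].
  by rewrite clamp_id; [exact: req_refl|apply/andP; split; lra].
apply: homotopic_reparam_id => //.
- exact: cont_clamp_affine.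
- by move=> s _; exact: clamp_itv.
- by rewrite /a clamp_le0 //; lra.
- by rewrite /a clamp_ge1 //; lra.
Qed.

Lemma homotopic_catV f : ispath f -> pcat f (pinv f) ~~ (fun=> f 0).
Proof.
(* A tent function: it runs along [f] and back, and as a change of parameter it is homotopic to the
   constant 0. *)
move=> cf; pose a (s : K) := Num.min (2 * s + 0) (-2 * s + 2).
apply: (@homotopic_trans _ (f \o a)).
  apply: homotopic_req => [|s /andP[s0 s1]].
    by apply: pcat_path (pinv_path cf) _ => //; rewrite pinv0; exact: req_refl.
  rewrite /a /= /pcat /pinv; case: (leP s) => s2.
    by rewrite min_l ?addr0; [exact: req_refl|lra].
  rewrite min_r; last by lra.
  by rewrite (_ : 1 - _ = -2 * s + 2); [exact: req_refl|ring].
apply: (homotopic_reparam (b := fun _ : K => 0)) => //.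
- by apply: continuous_minr; exact: cont_affine.
- by move=> s; exact: cvg_cst.
- move=> s /andP[s0 s1]; rewrite /a le_min ge_min -andbA; apply/and3P.
  by split; [lra|lra|case: (leP s 2^-1) => s2; apply/orP; [left|right]; lra].
- by move=> s _; rewrite lexx ler01.
- by rewrite /a min_l; lra.
- by rewrite /a min_r; lra.
Qed.

Lemma homotopic_pinv f g : f ~~ g -> pinv f ~~ pinv g.
Proof.
case=> [H [cH H0 H1 He]]; exists (fun us => H (us.1, 1 - us.2)); split=> /=.
- apply: (rcontinuous_comp (h := fun us : K * K => (us.1, 1 - us.2)) _ _ cH).
    apply: continuous_pair; first exact: cont_fst.
    by move=> us; apply: cvgB; [exact: cvg_cst|exact: cont_snd].
  by move=> [u s] [/= ? /andP[u0 u1]]; split => //=; apply/andP; split; lra.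
- by move=> s /andP[s0 s1]; apply: H0; apply/andP; split; lra.
- by move=> s /andP[s0 s1]; apply: H1; apply/andP; split; lra.
- by move=> u /He; rewrite pinv0 pinv1 subrr subr0 => -[].
Qed.

Lemma pinvK f : pinv (pinv f) = f.
Proof. by apply/funext => s; rewrite /pinv opprB addrC subrK. Qed.

Lemma homotopic_simplex n (x : X n) (p q : K -> 'rV[K]_n.+1)
    (hp : forall s, std_simplex (p s)) (hq : forall s, std_simplex (q s)) :
  continuous p -> continuous q -> p 0 = q 0 -> p 1 = q 1 ->
  (fun s => RPoint x (hp s)) ~~ (fun s => RPoint x (hq s)).
Proof.
move=> cp cq e0 e1.
exists (fun us => RPoint x (convex_simplex us.1 (hp us.2) (hq us.2))); split.
- apply: rcontinuous_simplex; apply: convex_cvg; first exact: cont_fst.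
  + by move=> us; apply: continuous_comp; [exact: cont_snd|exact: cp].
  + by move=> us; apply: continuous_comp; [exact: cont_snd|exact: cq].
- move=> s _; rewrite (@rpoint_eq _ _ _ _ _ _ _ (hp s)); first exact: req_refl.
  by rewrite convex_le0.
- move=> s _; rewrite (@rpoint_eq _ _ _ _ _ _ _ (hq s)); first exact: req_refl.
  by rewrite convex_ge1.
- move=> u _; split; [rewrite (@rpoint_eq _ _ _ _ _ _ _ (hp 0))|
    rewrite (@rpoint_eq _ _ _ _ _ _ _ (hp 1))]; rewrite ?(e0, e1) ?convexxx //;
    exact: req_refl.
Qed.

Lemma seg_path n (x : X n) (t t' : 'rV[K]_n.+1) (ht : std_simplex t)
    (ht' : std_simplex t') : ispath (seg x ht ht').
Proof.
apply: rcontinuous_simplex; apply: convex_cvg => ?; [exact: cvg_id|exact: cvg_cst|exact: cvg_cst].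
Qed.

Lemma seg0 n (x : X n) (t t' : 'rV[K]_n.+1) (ht : std_simplex t)
    (ht' : std_simplex t') : seg x ht ht' 0 = RPoint x ht.
Proof. by apply: rpoint_eq; rewrite convex_le0. Qed.

Lemma seg1 n (x : X n) (t t' : 'rV[K]_n.+1) (ht : std_simplex t)
    (ht' : std_simplex t') : seg x ht ht' 1 = RPoint x ht'.
Proof. by apply: rpoint_eq; rewrite convex_ge1. Qed.

Lemma seg_cat n (x : X n) (t t' t'' : 'rV[K]_n.+1) (ht : std_simplex t)
    (ht' : std_simplex t') (ht'' : std_simplex t'') :
  pcat (seg x ht ht') (seg x ht' ht'') ~~ seg x ht ht''.
Proof.
(* Adding the two clamped segments and subtracting the corner [t'] gives the broken line by a single
   formula, visibly continuous. *)
pose p (s : K) : 'rV[K]_n.+1 := convex (2 * s + 0) t t' + convex (2 * s + -1) t' t'' - t'.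
have pE (s : K) : p s = if s <= 2^-1 then convex (2 * s) t t' else convex (2 * s - 1) t' t''.
  rewrite /p addr0; case: leP => s2.
    by rewrite [X in _ + X - _]convex_le0 ?addrK //; lra.
  by rewrite [X in X + _ - _]convex_ge1 1?addrAC ?subrr ?add0r //; lra.
have hp s : std_simplex (p s).
  by rewrite pE; case: ifP => _; exact: convex_simplex.
apply: (@homotopic_trans _ (fun s => RPoint x (hp s))).
  apply: homotopic_req.
    by apply: pcat_path; [exact: seg_path|exact: seg_path|rewrite seg0 seg1; exact: req_refl].
  move=> s _; rewrite /pcat /seg; case: ifP => s2.
    by rewrite (@rpoint_eq _ _ _ _ _ _ _ (hp s)); [exact: req_refl|rewrite pE s2].
  by rewrite (@rpoint_eq _ _ _ _ _ _ _ (hp s)); [exact: req_refl|rewrite pE s2].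
apply: homotopic_simplex.
- have c1 := convex_cst_cvg (t := t) (t' := t') (@cont_affine 2 0).
  have c2 := convex_cst_cvg (t := t') (t' := t'') (@cont_affine 2 (-1)).
  move=> s; apply: cvgB; last exact: cvg_cst.
  by apply: cvgD; [exact: c1|exact: c2].
- by apply: convex_cvg => ?; [exact: cvg_id|exact: cvg_cst|exact: cvg_cst].
- by rewrite pE ifT ?mulr0 ?convex_le0 // invr_ge0 ler0n.
- rewrite pE ifF; last by apply/negbTE; rewrite -ltNge; lra.
  by rewrite !convex_ge1 //; lra.
Qed.

End Paths.

Lemma continuous_const_row (K : realType) :
  continuous (fun s : K => const_mx s : 'rV[K]_1).
Proof.
move=> s; rewrite (_ : (fun _ => _) = (fun s => s *: (const_mx 1 : 'rV[K]_1))).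
  by apply: cvgZr_tmp; exact: cvg_id.
by apply/funext => r; apply/rowP => i; rewrite !mxE mulr1.
Qed.

Lemma sphere_path (K : realType) (X : sset) (x0 : X 0) (f : sphere K 1 x0) :
  let p (s : K) := f (const_mx s) in
  [/\ ispath p, req (p 0) (rvertex K x0) & req (p 1) (rvertex K x0)].
Proof.
move=> p; have i0 : (0 : K) <= (0 : K) <= (1 : K) by rewrite lexx ler01.
have i1 : (0 : K) <= (1 : K) <= (1 : K) by rewrite lexx ler01.
split.
- have hc (s : K) : unit_itv s -> cube (const_mx s : 'rV[K]_1).
    by move=> s01 i; rewrite mxE.
  exact: (rcontinuous_comp (@continuous_const_row K) hc (@sph_cont K X 1 x0 f)).
- by apply: sph_base; split=> [i|]; [rewrite mxE|exists ord0; left; rewrite mxE].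
- by apply: sph_base; split=> [i|]; [rewrite mxE|exists ord0; right; rewrite mxE].
Qed.

(** * Homomorphisms from the fundamental group *)

Section LoopFunctionals.
Variables (K : realType) (X : sset) (x0 : X 0) (V : zmodType).
Variable psi : sphere K 1 x0 -> V.
Hypothesis psi_homotopic : forall f g, sph_homotopic f g -> psi f = psi g.
Hypothesis psi_concat : forall f g, psi (sph_concat f g) = psi f + psi g.
Local Notation point := (rpoint K X).
Local Notation "f ~~ g" := (path_homotopic f g) (at level 70).
Implicit Types a b c p q : K -> point.

Definition isloop p :=
  [/\ ispath p, req (p 0) (rvertex K x0) & req (p 1) (rvertex K x0)].

Lemma loop_sphere_cont p : isloop p ->
  rcontinuous (@cube K 1) (fun s : 'rV[K]_1 => p (s 0 0)).
Proof.
move=> [cp _ _]; apply: (rcontinuous_comp (h := fun s : 'rV[K]_1 => s 0 0) _ _ cp).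
  by move=> s; exact: coord_continuous.
by move=> s cs; exact: cs.
Qed.

Lemma loop_sphere_base p : isloop p ->
  forall s : 'rV[K]_1, cube_boundary s -> req (p (s 0 0)) (rvertex K x0).
Proof. by move=> [_ p0 p1] s [_ [i si]]; move: si; rewrite (ord1 i) => -[->|->]. Qed.

Definition loop_sphere p (lp : isloop p) : sphere K 1 x0 :=
  Sphere (loop_sphere_cont lp) (loop_sphere_base lp).

(* Junk value 0 when p is not a loop. *)
Definition loop_val p : V :=
  if pselect (isloop p) is left lp then psi (loop_sphere lp) else 0.

Lemma loop_valE p (lp : isloop p) : loop_val p = psi (loop_sphere lp).
Proof.
by rewrite /loop_val; case: pselect => // lp'; rewrite (Prop_irrelevance lp' lp).
Qed.

Lemma sph_homotopic_loop (f g : sphere K 1 x0) p q :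
  p ~~ q -> isloop p ->
  (forall s : 'rV[K]_1, cube s -> req (f s) (p (s 0 0))) ->
  (forall s : 'rV[K]_1, cube s -> req (g s) (q (s 0 0))) ->
  sph_homotopic f g.
Proof.
move=> [H [cH H0 H1 He]] [_ p0 p1] fp gq.
exists (fun us : K * 'rV[K]_1 => H (us.1, us.2 0 0)); split.
- apply: (rcontinuous_comp (h := fun us : K * 'rV[K]_1 => (us.1, us.2 0 0)) _ _ cH).
    apply: continuous_pair; first by move=> x; exact: cvg_fst.
    move=> x; apply: (@continuous_comp _ _ _ snd (fun s : 'rV[K]_1 => s 0 0)).
      exact: cvg_snd.
    exact: coord_continuous.
  by move=> [u s] [/= u01 cs]; split=> //=; exact: cs.
- by move=> s cs /=; apply: req_trans (H0 _ (cs 0)) _; exact/req_sym/fp.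
- by move=> s cs /=; apply: req_trans (H1 _ (cs 0)) _; exact/req_sym/gq.
- move=> u s u01 [_ [i si]]; move: si; rewrite (ord1 i) /= => -[->|->].
    exact: req_trans (He _ u01).1 p0.
  exact: req_trans (He _ u01).2 p1.
Qed.

Lemma psi_loop_val (f : sphere K 1 x0) p : isloop p ->
  (forall s : 'rV[K]_1, cube s -> req (f s) (p (s 0 0))) -> psi f = loop_val p.
Proof.
move=> lp fp; rewrite (loop_valE lp); apply: psi_homotopic.
apply: (sph_homotopic_loop (homotopic_refl _) lp) => //; first by case: lp.
by move=> s _; exact: req_refl.
Qed.

Lemma loop_homotopic p q : p ~~ q -> ispath q -> isloop p -> isloop q.
Proof.
move=> /homotopic_ends[e0 e1] cq [_ p0 p1]; split=> //.
  exact: req_trans (req_sym e0) p0.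
exact: req_trans (req_sym e1) p1.
Qed.

Lemma loop_val_homotopic p q : p ~~ q -> isloop p -> isloop q ->
  loop_val p = loop_val q.
Proof.
move=> pq lp lq; rewrite (loop_valE lp) (loop_valE lq); apply: psi_homotopic.
by apply: (sph_homotopic_loop pq lp) => s _; exact: req_refl.
Qed.

Lemma loop_cat p q : isloop p -> isloop q -> isloop (pcat p q).
Proof.
move=> [cp p0 p1] [cq q0 q1]; split; rewrite ?pcat0 ?pcat1 //.
by apply: pcat_path => //; exact: req_trans p1 (req_sym q0).
Qed.

Lemma loop_val_cat p q : isloop p -> isloop q ->
  loop_val (pcat p q) = loop_val p + loop_val q.
Proof.
move=> lp lq; rewrite (loop_valE lp) (loop_valE lq) -psi_concat; apply/esym.
apply: psi_loop_val; first exact: loop_cat.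
move=> s _ /=; rewrite /sph_concat_fun /pcat /= !mxE !eqxx subr0.
case: ifP => _; exact: req_refl.
Qed.

(** A constant loop is homotopic to its concatenation with itself, so its value is its own
    double. *)
Lemma loop_val_cst p : ispath p ->
  (forall s, 0 <= s <= 1 -> req (p s) (rvertex K x0)) -> loop_val p = 0.
Proof.
move=> cp pc; have h0 : (0 : K) <= (0 : K) <= (1 : K) by apply/andP; split; lra.
have h1 : (0 : K) <= (1 : K) <= (1 : K) by apply/andP; split; lra.
have lp : isloop p by split=> //; exact: pc.
apply: (addrI (loop_val p)); rewrite addr0 -loop_val_cat //.
apply: loop_val_homotopic => //; last exact: loop_cat.
apply: homotopic_cat1 => // s s01; apply: req_trans (pc _ s01) _.
exact/req_sym/pc.
Qed.

Definition based p := ispath p /\ req (p 0) (rvertex K x0).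

(** The discrepancy, as measured by [psi], between two paths from the base point to the same end
    point. *)
Definition hol a b : V := loop_val (pcat a (pinv b)).

Lemma based_loop a b : based a -> based b -> req (a 1) (b 1) ->
  isloop (pcat a (pinv b)).
Proof.
move=> [ca a0] [cb b0] e; split; rewrite ?pcat0 ?pcat1 ?pinv1 //.
by apply: pcat_path => //; [exact: pinv_path|rewrite pinv0].
Qed.

Lemma hol_homotopic a a' b b' : based a -> based b -> ispath a' -> ispath b' ->
  req (a 1) (b 1) -> a ~~ a' -> b ~~ b' -> hol a b = hol a' b'.
Proof.
move=> ha hb ca' cb' e aa bb.
have h : pcat a (pinv b) ~~ pcat a' (pinv b').
  by apply: homotopic_pcat; [rewrite pinv0|exact: aa|exact: homotopic_pinv].
have lab := based_loop ha hb e.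
apply: loop_val_homotopic => //; apply: (loop_homotopic h) => //.
apply: pcat_path => //; first exact: pinv_path.
rewrite pinv0; have [_ a1] := homotopic_ends aa; have [_ b1] := homotopic_ends bb.
by apply: req_trans (req_sym a1) _; apply: req_trans e _.
Qed.

Lemma cancel_mid a p b : ispath a -> ispath p -> ispath b ->
  req (a 1) (p 0) -> req (p 0) (b 0) ->
  pcat (pcat a p) (pcat (pinv p) b) ~~ pcat a b.
Proof.
move=> ca cp cb ap pb; have cp' := pinv_path cp.
have ppb : req (p 1) (pcat (pinv p) b 0) by rewrite pcat0 pinv0; exact: req_refl.
have cpb : ispath (pcat (pinv p) b) by apply: pcat_path => //; rewrite pinv1.
apply: homotopic_trans; first exact: homotopic_catA.
apply: homotopic_pcat; [by rewrite pcat0|exact: homotopic_refl|].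
apply: (@homotopic_trans _ _ _ (pcat (pcat p (pinv p)) b)).
  apply/homotopic_sym/homotopic_catA => //; rewrite ?pinv0 ?pinv1 //.
  exact: req_refl.
apply: (@homotopic_trans _ _ _ (pcat (fun=> p 0) b)); last first.
  by apply: homotopic_1cat => // s _.
apply: homotopic_pcat; [by rewrite pcat1 pinv1|exact: homotopic_catV|].
exact: homotopic_refl.
Qed.

Lemma hol_add a b c : based a -> based b -> based c ->
  req (a 1) (b 1) -> req (b 1) (c 1) -> hol a b + hol b c = hol a c.
Proof.
move=> ha hb hc ab bc; have lab := based_loop ha hb ab.
have lbc := based_loop hb hc bc; have lac := based_loop ha hc (req_trans ab bc).
rewrite /hol -loop_val_cat //; apply: loop_val_homotopic => //.
- have := @cancel_mid a (pinv b) (pinv c); rewrite pinvK; apply.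
  + by case: ha.
  + by apply: pinv_path; case: hb.
  + by apply: pinv_path; case: hc.
  + by rewrite pinv0.
  + by rewrite !pinv0.
- exact: loop_cat.
Qed.

Lemma pinv_pcat a b : ispath a -> ispath b -> req (a 1) (b 0) ->
  pinv (pcat a b) ~~ pcat (pinv b) (pinv a).
Proof.
move=> ca cb e; apply: homotopic_req; first exact/pinv_path/pcat_path.
move=> s /andP[s0 s1]; rewrite /pinv /pcat.
case: (ltgtP s 2^-1) => s2.
- rewrite ifF; last by apply/negbTE; rewrite -ltNge; lra.
  rewrite (_ : 2 * (1 - s) - 1 = 1 - 2 * s); [exact: req_refl|by ring].
- rewrite ifT; last by lra.
  rewrite (_ : 1 - (2 * s - 1) = 2 * (1 - s)); [exact: req_refl|by ring].
- rewrite s2 ifT; last by lra.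
  rewrite (_ : 2 * (1 - 2^-1) = 1); last by field.
  by rewrite (_ : 1 - 2 * 2^-1 = 0); last by field.
Qed.

Lemma based_cat a p : based a -> ispath p -> req (a 1) (p 0) -> based (pcat a p).
Proof. by move=> [ca a0] cp e; split; [exact: pcat_path|rewrite pcat0]. Qed.

Lemma hol_cat a b p : based a -> based b -> ispath p ->
  req (a 1) (p 0) -> req (b 1) (p 0) -> hol (pcat a p) (pcat b p) = hol a b.
Proof.
move=> ha hb cp ap bp; have [ca a0] := ha; have [cb b0] := hb.
have e : req (a 1) (b 1) by exact: req_trans ap (req_sym bp).
have h : pcat (pcat a p) (pinv (pcat b p)) ~~ pcat a (pinv b).
  apply: (@homotopic_trans _ _ _ (pcat (pcat a p) (pcat (pinv p) (pinv b)))).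
    apply: homotopic_pcat; first by rewrite pinv0 !pcat1; exact: req_refl.
      exact/homotopic_refl/pcat_path.
    exact: pinv_pcat.
  apply: cancel_mid => //; first exact: pinv_path.
  by rewrite pinv0; exact: req_sym.
apply: (loop_val_homotopic h); last exact: based_loop.
by apply: based_loop; [exact: based_cat|exact: based_cat|rewrite !pcat1; exact: req_refl].
Qed.

Lemma holxx a : based a -> hol a a = 0.
Proof.
move=> ha; apply: (addrI (hol a a)).
by rewrite addr0 hol_add //; exact: req_refl.
Qed.

Lemma holC a b : based a -> based b -> req (a 1) (b 1) -> hol b a = - hol a b.
Proof.
move=> ha hb e; apply/eqP; rewrite -addr_eq0 hol_add ?holxx //.
exact: req_sym.
Qed.

End LoopFunctionals.

(** Identifies the 1-cube of row vectors with the interval, so that questions about pi_1 become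
    questions about path homotopies. *)
Lemma sph_homotopicP (K : realType) (X : sset) (x0 : X 0) (f g : sphere K 1 x0) :
  sph_homotopic f g <->
  path_homotopic (fun s : K => f (const_mx s)) (fun s : K => g (const_mx s)).
Proof.
split=> [[H [cH H0 H1 He]]|fg].
{ have cub (s : K) : 0 <= s <= 1 -> cube (const_mx s : 'rV[K]_1) by move=> s01 i; rewrite mxE.
  have cbd (s : K) : 0 <= s <= 1 -> s = 0 \/ s = 1 -> cube_boundary (const_mx s : 'rV[K]_1).
    by move=> s01 h; split; [exact: cub|exists ord0; rewrite mxE].
  pose h (us : K * K) : K * 'rV[K]_1 := (us.1, const_mx us.2).
  have ch : continuous h.
    apply: continuous_pair; first exact: cont_fst.
    move=> us; apply: (@continuous_comp _ _ _ snd (fun s : K => const_mx s : 'rV[K]_1)).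
      exact: cont_snd.
    exact: continuous_const_row.
  have i0 : (0 : K) <= (0 : K) <= (1 : K) by rewrite lexx ler01.
  have i1 : (0 : K) <= (1 : K) <= (1 : K) by rewrite lexx ler01.
  have [_ f0 f1] := sphere_path f.
  exists (H \o h); split.
  - by apply: (rcontinuous_comp ch _ cH) => -[u s] [/= u01 s01]; split=> //=; exact: cub.
  - by move=> s s01; exact/H0/cub.
  - by move=> s s01; exact/H1/cub.
  - move=> u u01; split.
      by apply: req_trans (req_sym f0); apply: He => //; apply: cbd => //; left.
    by apply: req_trans (req_sym f1); apply: He => //; apply: cbd => //; right.
}
have cE (s : 'rV[K]_1) : const_mx (s 0 0) = s by apply/rowP => i; rewrite mxE (ord1 i).
apply: (sph_homotopic_loop fg); first exact: sphere_path.
- by move=> s _; rewrite cE; exact: req_refl.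
- by move=> s _; rewrite cE; exact: req_refl.
Qed.

(** Real induction: the supremum of the [b] with [P 0 b] cannot stop before 1. It plays the role of
    compactness of [0, 1] when loops are subdivided, functions lifted and homotopies followed. *)
Lemma subdivision (K : realType) (P : K -> K -> Prop) :
  (forall a b c, 0 <= a -> a <= b -> b <= c -> c <= 1 ->
     P a b -> P b c -> P a c) ->
  (forall x, 0 <= x <= 1 -> exists2 e : K, 0 < e &
     forall a b, 0 <= a -> a <= b -> b <= 1 -> x - e < a -> b < x + e -> P a b) ->
  P 0 1.
Proof.
move=> Pcat Ploc; pose S : set K := [set b | 0 <= b <= 1 /\ P 0 b].
have S0 : S 0.
  have [|e e0 /(_ 0 0)] := Ploc 0; first by rewrite lexx ler01.
  rewrite sub0r add0r oppr_lt0 e0 lexx ler01 => P00.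
  by split; [rewrite lexx ler01|exact: P00].
have uS : ubound S 1 by move=> b [/andP[]].
have hS : has_sup S by split; [exists 0|exists 1].
have s0 : 0 <= sup S by apply: ub_le_sup => //; exists 1.
have s1 : sup S <= 1 by apply: ge_sup => //; exists 0.
have [|e e0 Pe] := Ploc (sup S); first by rewrite s0.
have [b [/andP[b0 b1] Pb] sb] := sup_adherent e0 hS.
have bs : b <= sup S.
  by apply: ub_le_sup; [exists 1|split=> //; rewrite b0].
(* A step beyond the supremum, capped at 1: it contradicts the supremum unless the cap is active,
   and then [P 0 1] has been reached. *)
pose b' := Num.min 1 (sup S + e / 2).
have bb' : b <= b' by rewrite /b' le_min b1 (le_trans bs) // lerDl divr_ge0 // ltW.
have b'1 : b' <= 1 by rewrite /b' ge_min lexx.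
have Pb' : P 0 b'.
  apply: (Pcat _ b) => //; apply: Pe => //.
  by rewrite /b' gt_min ltrD2l ltr_pdivrMr // ltr_pMr // ltr1n orbT.
have : b' <= sup S.
  by apply: ub_le_sup; [exists 1|split=> //; rewrite b'1 (le_trans b0)].
rewrite {1}/b' ge_min gerDl => /orP[s1'|]; last by rewrite leNgt divr_gt0.
by move: Pb'; rewrite /b' min_l // (le_trans s1') // lerDl divr_ge0 // ltW.
Qed.

(** * Vertices and edges of simplices in the realization *)

Section Vertices.
Variables (K : realType) (X : sset).
Local Notation point := (rpoint K X).

Lemma rglue_req (p q : point) : rglue p q -> req p q.
Proof. exact: rst_step. Qed.

Lemma monotone_cst m n (k : 'I_n.+1) : monotone (fun _ : 'I_m.+1 => k).
Proof. by []. Qed.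

Definition vert n (x : X n) (k : 'I_n.+1) : X 0 := sact (@monotone_cst 0 n k) x.

Lemma sact_ext m n (th th' : 'I_m.+1 -> 'I_n.+1) (h : monotone th)
    (h' : monotone th') (x : X n) : th = th' -> sact h x = sact h' x.
Proof. by move=> e; subst th'; congr sact; exact: Prop_irrelevance. Qed.

Lemma vert_sact m n (th : 'I_m.+1 -> 'I_n.+1) (hth : monotone th) (x : X n) k :
  vert (sact hth x) k = vert x (th k).
Proof. by rewrite /vert -sact_comp; exact: sact_ext. Qed.

Lemma vert0 (x : X 0) k : vert x k = x.
Proof.
rewrite -[RHS]sact_id; apply: sact_ext; apply/funext => i.
by rewrite (ord1 i) (ord1 k).
Qed.

Definition vtx n (k : 'I_n.+1) : 'rV[K]_n.+1 := delta_mx 0 k.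

Lemma vtx_simplex n (k : 'I_n.+1) : std_simplex (vtx k).
Proof.
split=> [i|]; first by rewrite mxE eqxx ler0n.
rewrite (bigD1 k) //= mxE !eqxx big1 ?addr0 // => i /negPf ik.
by rewrite mxE ik andbF.
Qed.

Lemma push_vtx m n (th : 'I_m.+1 -> 'I_n.+1) k :
  push th (vtx k) = vtx (th k) :> 'rV[K]_n.+1.
Proof.
apply/rowP => j; rewrite !mxE eqxx /= big_mkcond (bigD1 k) //= mxE !eqxx.
rewrite big1 ?addr0 => [|i /negPf ik]; last by rewrite mxE ik andbF if_same.
by rewrite [j == _]eq_sym; case: eqP.
Qed.

Lemma push_convex m n (th : 'I_m.+1 -> 'I_n.+1) (u : K) t t' :
  push th (convex u t t') = convex u (push th t) (push th t').
Proof.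
apply/rowP => j; rewrite !mxE !mulr_sumr -big_split /=.
by apply: eq_bigr => i _; rewrite !mxE.
Qed.

Lemma req_push m n (th : 'I_m.+1 -> 'I_n.+1) (hth : monotone th) (x : X n)
    (t : 'rV[K]_m.+1) (t' : 'rV[K]_n.+1) (ht : std_simplex t)
    (ht' : std_simplex t') : push th t = t' ->
  req (RPoint (sact hth x) ht) (RPoint x ht').
Proof.
move=> e; rewrite -(rpoint_eq x (push_simplex th ht) ht' e).
exact/rglue_req/RGlue.
Qed.

Lemma vtx0 (k : 'I_1) : vtx k = const_mx 1.
Proof. by apply/rowP => i; rewrite !mxE (ord1 i) (ord1 k). Qed.

Lemma rvertex_vert n (x : X n) k :
  req (RPoint x (vtx_simplex k)) (rvertex K (vert x k)).
Proof. by apply/req_sym/req_push; rewrite -(vtx0 ord0) push_vtx. Qed.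

Lemma seg_sact m n (th : 'I_m.+1 -> 'I_n.+1) (hth : monotone th) (x : X n)
    (t1 t2 : 'rV[K]_m.+1) (t1' t2' : 'rV[K]_n.+1) (ht1 : std_simplex t1)
    (ht2 : std_simplex t2) (ht1' : std_simplex t1') (ht2' : std_simplex t2') u :
  push th t1 = t1' -> push th t2 = t2' ->
  req (seg (sact hth x) ht1 ht2 u) (seg x ht1' ht2' u).
Proof. by move=> e1 e2; apply: req_push; rewrite push_convex e1 e2. Qed.

Definition face_map n (i j : 'I_n.+1) (k : 'I_2) : 'I_n.+1 :=
  if k == ord0 then i else j.

Lemma face_map_monotone n (i j : 'I_n.+1) : (i <= j)%N -> monotone (face_map i j).
Proof.
move=> ij k l kl; rewrite /face_map; case: eqP => [_|k0]; case: eqP => // l0.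
by move: kl; rewrite l0 leqn0 => /eqP k0'; case: k0; exact: val_inj.
Qed.

End Vertices.

(** * Standard paths from the base point to all points *)

Section StandardPaths.
Variables (K : realType) (X : sset) (x0 : X 0) (V : zmodType).
Variable psi : sphere K 1 x0 -> V.
Hypothesis psi_homotopic : forall f g, sph_homotopic f g -> psi f = psi g.
Hypothesis psi_concat : forall f g, psi (sph_concat f g) = psi f + psi g.
Local Notation point := (rpoint K X).
Local Notation "f ~~ g" := (path_homotopic f g) (at level 70).
Local Notation based := (@based K X x0).
Local Notation hol := (hol psi).
Implicit Types a b c p q : K -> point.

(** Homotopy of based paths as far as [psi] can see it: same end point and no discrepancy. *)
Definition heqv a b := [/\ based a, based b, req (a 1) (b 1) & hol a b = 0].

Lemma heqv_refl a : based a -> heqv a a.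
Proof. by move=> ha; split=> //; [exact: req_refl|exact: holxx]. Qed.

Lemma heqv_sym a b : heqv a b -> heqv b a.
Proof.
move=> [ha hb e h]; split=> //; first exact: req_sym.
by rewrite (holC psi_homotopic psi_concat) // h oppr0.
Qed.

Lemma heqv_trans a b c : heqv a b -> heqv b c -> heqv a c.
Proof.
move=> [ha hb e h] [_ hc e' h']; split=> //; first exact: req_trans e'.
by rewrite -(hol_add psi_homotopic psi_concat ha hb hc) // h h' addr0.
Qed.

Lemma heqv_homotopic a b : based a -> ispath b -> a ~~ b -> heqv a b.
Proof.
move=> ha cb ab; have [e0 e1] := homotopic_ends ab.
have hb : based b by split=> //; apply: req_trans (req_sym e0) _; case: ha.
split=> //; rewrite -(holxx psi_homotopic psi_concat ha); apply/esym.
apply: (hol_homotopic psi_homotopic) => //; try exact: req_refl.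
- by case: ha.
- by case: ha => ca _; exact: homotopic_refl.
Qed.

Lemma heqv_cat a b p : heqv a b -> ispath p -> req (a 1) (p 0) ->
  heqv (pcat a p) (pcat b p).
Proof.
move=> [ha hb e h] cp ap; have bp := req_trans (req_sym e) ap.
split; [exact: based_cat|exact: based_cat|rewrite !pcat1; exact: req_refl|].
by rewrite (hol_cat psi_homotopic).
Qed.

Lemma heqv_cat2 a p q : based a -> p ~~ q -> ispath p -> ispath q ->
  req (a 1) (p 0) -> heqv (pcat a p) (pcat a q).
Proof.
move=> ha pq cp cq e; have [e0 _] := homotopic_ends pq; have [ca a0] := ha.
apply: heqv_homotopic; first exact: based_cat.
  by apply: pcat_path => //; exact: req_trans e0.
by apply: homotopic_pcat => //; exact: homotopic_refl.
Qed.

Lemma heqv_catA a p q : based a -> ispath p -> ispath q ->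
  req (a 1) (p 0) -> req (p 1) (q 0) ->
  heqv (pcat (pcat a p) q) (pcat a (pcat p q)).
Proof.
move=> ha cp cq ap pq; have [ca a0] := ha.
apply: heqv_homotopic; last exact: homotopic_catA.
  by apply: based_cat => //; [exact: based_cat|rewrite pcat1].
by apply: pcat_path => //; [exact: pcat_path|rewrite pcat0].
Qed.

Lemma heqv_cancel a b p : based a -> based b -> ispath p ->
  req (a 1) (p 0) -> req (b 1) (p 0) ->
  heqv (pcat a p) (pcat b p) -> heqv a b.
Proof.
move=> ha hb cp ap bp [_ _ _ h]; split=> //.
  exact: req_trans ap (req_sym bp).
by rewrite -(hol_cat psi_homotopic ha hb cp).
Qed.

Lemma heqv_cst a p : based a -> ispath p ->
  (forall s, 0 <= s <= 1 -> req (p s) (a 1)) -> heqv (pcat a p) a.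
Proof.
move=> ha cp pc; have [ca a0] := ha; apply: heqv_homotopic => //.
  apply: based_cat => //; apply/req_sym/pc.
  by rewrite lexx ler01.
exact: homotopic_cat1.
Qed.

(* A choice of a path from the base point to each vertex. *)
Variable iv : X 0 -> K -> point.
Hypothesis iv_path : forall v, ispath (iv v).
Hypothesis iv0 : forall v, req (iv v 0) (rvertex K x0).
Hypothesis iv1 : forall v, req (iv v 1) (rvertex K v).
Hypothesis iv_base : forall s, 0 <= s <= 1 -> req (iv x0 s) (rvertex K x0).

Lemma iv_based v : based (iv v). Proof. by split. Qed.

Definition edge_path (y : X 1) : K -> point :=
  seg y (@vtx_simplex K 1 ord0) (@vtx_simplex K 1 ord_max).

(** The triangle formed by the edge and the chosen paths to its two ends is invisible to [psi]. *)
Definition good_edge (y : X 1) : Prop :=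
  heqv (pcat (iv (vert y ord0)) (edge_path y)) (iv (vert y ord_max)).

Hypothesis good_edges : forall y, good_edge y.

(** Follow the chosen path to the first vertex of the simplex, then a straight segment. This depends
    on the representative of the point; [std_req] shows that it does so only up to [heqv]. *)
Definition std (p : point) : K -> point :=
  match p with
  | RPoint n x t ht => pcat (iv (vert x ord0)) (seg x (@vtx_simplex K n ord0) ht)
  end.

Lemma iv_seg n (x : X n) k (t : 'rV[K]_n.+1) (ht : std_simplex t) :
  req (iv (vert x k) 1) (seg x (@vtx_simplex K n k) ht 0).
Proof. by rewrite seg0; apply: req_trans (iv1 _) _; exact/req_sym/rvertex_vert. Qed.

Lemma std_based (p : point) : based (std p).
Proof.
case: p => n x t ht; apply: based_cat; first exact: iv_based.
  exact: seg_path.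
exact: iv_seg.
Qed.

Lemma std1 (p : point) : std p 1 = p.
Proof. by case: p => n x t ht; rewrite /= pcat1 seg1. Qed.

(** The operator [th] may send the first vertex to another vertex [k] of [x]. The two standard paths
    then differ by the edge from vertex 0 to vertex [k], which is good, and by segments inside one
    simplex, which are homotopic. *)
Lemma std_rglue (p q : point) : rglue p q -> heqv (std p) (std q).
Proof.
case=> m n th hth x t ht /=; set v := vert (sact hth x) ord0.
pose k := th ord0; have vE : v = vert x k by exact: vert_sact.
have mk : monotone (face_map ord0 k) by exact: face_map_monotone.
have ht' := push_simplex th ht.
have hk : req (iv v 1) (seg x (@vtx_simplex K n k) ht' 0) by rewrite vE; exact: iv_seg.
have segm : ispath (seg x (@vtx_simplex K n k) ht') by exact: seg_path.
apply: (@heqv_trans _ (pcat (iv v) (seg x (@vtx_simplex K n k) ht'))).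
  apply: heqv_cat2; [exact: iv_based| |exact: seg_path|exact: seg_path|exact: iv_seg].
  apply: homotopic_req; first exact: seg_path.
  by move=> s _; apply: seg_sact; rewrite ?push_vtx.
have kE : heqv (iv v) (pcat (iv (vert x ord0)) (seg x (@vtx_simplex K n ord0) (@vtx_simplex K n k))).
  have := good_edges (sact mk x); rewrite /good_edge !vert_sact /=.
  rewrite -/k vE => /heqv_sym h; apply: (heqv_trans h).
  rewrite [face_map ord0 k ord0]/face_map eqxx.
  apply: heqv_cat2; [exact: iv_based| |exact: seg_path|exact: seg_path|].
    apply: homotopic_req; first exact: seg_path.
    by move=> s _; apply: seg_sact; rewrite push_vtx.
  have := @iv_seg 1 (sact mk x) ord0 _ (@vtx_simplex K 1 ord_max).
  by rewrite vert_sact.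
apply: (heqv_trans (heqv_cat kE segm hk)).
have hE : req (seg x (@vtx_simplex K n ord0) (@vtx_simplex K n k) 1) (seg x (@vtx_simplex K n k) ht' 0).
  by rewrite seg0 seg1; exact: req_refl.
apply: heqv_trans.
  by apply: heqv_catA => //; [exact: seg_path|exact: iv_seg].
rewrite (Prop_irrelevance (push_simplex th ht) ht').
apply: heqv_cat2; [exact: iv_based|exact: seg_cat| |exact: seg_path|rewrite pcat0; exact: iv_seg].
by apply: pcat_path => //; exact: seg_path.
Qed.

Lemma std_req (p q : point) : req p q -> heqv (std p) (std q).
Proof.
elim=> {p q} [p q /std_rglue //|p|p q _ /heqv_sym //|p q r _ pq _ qr].
  exact/heqv_refl/std_based.
exact: heqv_trans pq qr.
Qed.

(** Transport along [p] takes standard paths to standard paths, up to [heqv]. *)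
Definition good p := heqv (pcat (std (p 0)) p) (std (p 1)).

Lemma good_cat p q : ispath p -> ispath q -> req (p 1) (q 0) ->
  good p -> good q -> good (pcat p q).
Proof.
move=> cp cq e gp gq; rewrite /good pcat0 pcat1.
have sp : req (std (p 0) 1) (p 0) by rewrite std1; exact: req_refl.
apply: (@heqv_trans _ (pcat (pcat (std (p 0)) p) q)).
  by apply/heqv_sym/heqv_catA => //; exact: std_based.
apply: (@heqv_trans _ (pcat (std (p 1)) q)).
  by apply: heqv_cat => //; rewrite pcat1.
apply: heqv_trans gq; apply: heqv_cat => //; last by rewrite std1.
exact: std_req.
Qed.

Lemma good_homotopic p q : ispath p -> ispath q -> p ~~ q -> good p -> good q.
Proof.
move=> cp cq pq gp; have [e0 e1] := homotopic_ends pq.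
have sp r : req (std r 1) r by rewrite std1; exact: req_refl.
apply: (@heqv_trans _ (pcat (std (p 0)) q)).
  by apply: heqv_cat => //; apply/std_req/req_sym.
apply: (@heqv_trans _ (pcat (std (p 0)) p)).
  by apply/heqv_sym/heqv_cat2 => //; exact: std_based.
exact: heqv_trans gp (std_req e1).
Qed.

Lemma good_seg n (x : X n) (t t' : 'rV[K]_n.+1) (ht : std_simplex t)
    (ht' : std_simplex t') : good (seg x ht ht').
Proof.
rewrite /good seg0 seg1 /=; apply: heqv_trans.
  apply: heqv_catA; [exact: iv_based|exact: seg_path|exact: seg_path|exact: iv_seg|].
  by rewrite seg1 seg0; exact: req_refl.
have e : req (seg x (vtx_simplex K ord0) ht 1) (seg x ht ht' 0).
  by rewrite seg1 seg0; exact: req_refl.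
apply: heqv_cat2; [exact: iv_based|exact: seg_cat| |exact: seg_path|].
  by apply: pcat_path => //; exact: seg_path.
by rewrite pcat0; exact: iv_seg.
Qed.

Lemma good_cst p (r : point) : ispath p -> (forall s, 0 <= s <= 1 -> req (p s) r) -> good p.
Proof.
move=> cp pr; have h0 : req (p 0) r by apply: pr; rewrite lexx ler01.
have h1 : req (p 1) r by apply: pr; rewrite lexx ler01.
apply: (@heqv_trans _ (std (p 0))).
  apply: heqv_cst => //; first exact: std_based.
  by move=> s /pr sr; rewrite std1; exact: req_trans sr (req_sym h0).
apply: std_req; exact: req_trans h0 (req_sym h1).
Qed.

(** Across the square, the bottom followed by the right side is homotopic to the left side followed
    by the top. The top is constant, so three sides are good, and the right side can be
    cancelled. *)
Lemma good_square (H : K * K -> point) (c : point) : rcontinuous (@square K) H ->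
  good (fun u => H (u, 0)) -> good (fun u => H (u, 1)) ->
  (forall s, 0 <= s <= 1 -> req (H (1, s)) c) -> good (fun s => H (0, s)).
Proof.
move=> cH gl gr Hc.
have side (h : K -> K * K) : continuous h -> (forall s, 0 <= s <= 1 -> square (h s)) ->
    ispath (H \o h).
  by move=> ch hs; exact: (rcontinuous_comp ch hs cH).
have cid : continuous (id : K -> K) by move=> s; exact: cvg_id.
have ccst (r : K) : continuous (fun _ : K => r) by move=> s; exact: cvg_cst.
have cl : ispath (fun u => H (u, 0)).
  apply: (side (fun u => (u, 0))); first exact: continuous_pair.
  by move=> s s01; split=> //=; rewrite lexx ler01.
have cr : ispath (fun u => H (u, 1)).
  apply: (side (fun u => (u, 1))); first exact: continuous_pair.
  by move=> s s01; split=> //=; rewrite lexx ler01.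
have cf : ispath (fun s => H (0, s)).
  apply: (side (fun s => (0, s))); first exact: continuous_pair.
  by move=> s s01; split=> //=; rewrite lexx ler01.
have ct : ispath (fun s => H (1, s)).
  apply: (side (fun s => (1, s))); first exact: continuous_pair.
  by move=> s s01; split=> //=; rewrite lexx ler01.
set f := fun s => H (0, s) in cf *; set l := fun u => H (u, 0) in gl cl.
set r := fun u => H (u, 1) in gr cr; set t := fun s => H (1, s) in ct.
(* [al] and [be] are the two boundary routes from one corner of the square to the opposite one;
   convexity of the square allows a linear interpolation between them. *)
pose al (s : K) : K * K := (clamp (2 * s + 0), clamp (2 * s + -1)).
pose be (s : K) : K * K := (clamp (2 * s + -1), clamp (2 * s + 0)).
have cal : continuous al by apply: continuous_pair; exact: cont_clamp_affine.
have cbe : continuous be by apply: continuous_pair; exact: cont_clamp_affine.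
have ltfr : pcat l t ~~ pcat f r.
{   apply: (@homotopic_trans _ _ _ (H \o al)).
    apply: homotopic_req; first by apply: pcat_path => //; exact: req_refl.
    move=> s /andP[s0 s1]; rewrite /pcat /al /l /t /= addr0; case: ifP => s2.
      rewrite clamp_id; last by apply/andP; split; lra.
      by rewrite clamp_le0; [exact: req_refl|lra].
    move/negbT: s2; rewrite -ltNge => s2.
    rewrite clamp_ge1; last by lra.
    by rewrite clamp_id; [exact: req_refl|apply/andP; split; lra].
  apply: (@homotopic_trans _ _ _ (H \o be)); last first.
    apply/homotopic_sym/homotopic_req; first by apply: pcat_path => //; exact: req_refl.
    move=> s /andP[s0 s1]; rewrite /pcat /be /f /r /= addr0; case: ifP => s2.
      rewrite [clamp (2 * s)]clamp_id; last by apply/andP; split; lra.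
      by rewrite clamp_le0; [exact: req_refl|lra].
    move/negbT: s2; rewrite -ltNge => s2.
    rewrite [clamp (2 * s)]clamp_ge1; last by lra.
    by rewrite clamp_id; [exact: req_refl|apply/andP; split; lra].
  pose G (us : K * K) : K * K :=
    ((1 - us.1) * (al us.2).1 + us.1 * (be us.2).1,
     (1 - us.1) * (al us.2).2 + us.1 * (be us.2).2).
  have mix (u a b : K) : 0 <= u <= 1 -> 0 <= a <= 1 -> 0 <= b <= 1 ->
      0 <= (1 - u) * a + u * b <= 1.
    move=> /andP[? ?] /andP[? ?] /andP[? ?]; apply/andP; split; nra.
  exists (H \o G); split.
  - apply: (rcontinuous_comp _ _ cH) => [|[u s] [/= u01 _]]; last first.
      by split; apply: mix => //; exact: clamp_itv.
    have csn (g : K -> K) : continuous g -> continuous (fun us : K * K => g us.2).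
      by move=> cg us; apply: continuous_comp; [exact: cont_snd|exact: cg].
    have cmix (g h : K -> K) : continuous g -> continuous h ->
        continuous (fun us : K * K => (1 - us.1) * g us.2 + us.1 * h us.2).
      move=> cg ch us; apply: cvgD; apply: cvgM;
        [|exact: (csn _ cg)|exact: cont_fst|exact: (csn _ ch)].
      by apply: cvgB; [exact: cvg_cst|exact: cont_fst].
    have c0 := @cont_clamp_affine K 2 0; have c1 := @cont_clamp_affine K 2 (-1).
    by apply: continuous_pair; [exact: (cmix _ _ c0 c1)|exact: (cmix _ _ c1 c0)].
  - move=> s _; rewrite /= (_ : G (0, s) = al s); first exact: req_refl.
    by rewrite /G /al /= subr0 !mul1r !mul0r !addr0.
  - move=> s _; rewrite /= (_ : G (1, s) = be s); first exact: req_refl.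
    by rewrite /G /be /= subrr !mul1r !mul0r !add0r.
  - have GE u w : al w = be w -> G (u, w) = al w.
      by rewrite /G => <-; rewrite [in RHS](surjective_pairing (al w)) -!mulrDl subrK !mul1r.
    have e0 : al 0 = be 0.
      by rewrite /al /be mulr0 !add0r !clamp_le0 //; lra.
    have e1 : al 1 = be 1.
      by rewrite /al /be mulr1 !clamp_ge1 //; lra.
    move=> u _; rewrite /comp (GE _ _ e0) (GE _ _ e1); split; exact: req_refl.
}
have std_r (q : point) : req (std q 1) q by rewrite std1; exact: req_refl.
have e01 : req (f 1) (r 0) by exact: req_refl.
apply: (@heqv_cancel _ _ r) => //; try exact: std_based.
- by apply: based_cat => //; exact: std_based.
- by rewrite pcat1.
- apply: (@heqv_trans _ (std (r 1))); last by apply: heqv_sym.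
  apply: heqv_trans.
    by apply: heqv_catA => //; exact: std_based.
  apply: (@heqv_trans _ (pcat (std (f 0)) (pcat l t))).
    have clt : ispath (pcat l t) by apply: pcat_path => //; exact: req_refl.
    have cfr : ispath (pcat f r) by apply: pcat_path => //; exact: req_refl.
    apply/heqv_sym/heqv_cat2 => //; first exact: std_based.
    by rewrite pcat0 std1; exact: req_refl.
  have gt : good t by exact: (good_cst ct Hc).
  by have := good_cat cl ct (req_refl _) gl gt; rewrite /good pcat0 pcat1.
Qed.

(** At the base point the standard path is equivalent to a constant [c], so goodness says that [c]
    followed by [f] is equivalent to [c]. *)
Lemma loop_val_good f : isloop x0 f -> good f -> loop_val psi f = 0.
Proof.
move=> lf gf; have [cf f0 f1] := lf.
have [c [cc cx]] : exists c : K -> point, ispath c /\ forall s, req (c s) (rvertex K x0).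
  by exists (fun=> rvertex K x0); split=> [|s]; [exact: rcontinuous_cst|exact: req_refl].
have hc : based c by split.
have cstd : heqv c (std (rvertex K x0)).
  apply/heqv_sym/heqv_homotopic => //; first exact: std_based.
  have cs : ispath (std (rvertex K x0)) by have [] := std_based (rvertex K x0).
  apply: homotopic_req => // s /andP[s0 s1]; apply: req_trans (req_sym (cx s)).
  rewrite /std /= vert0 /pcat; case: ifP => s2.
    by apply: iv_base; apply/andP; split; lra.
  rewrite (_ : seg _ _ _ _ = rvertex K x0); first exact: req_refl.
  by apply: rpoint_eq; rewrite vtx0 convexxx.
have cf' : req (c 1) (f 0) by exact: req_trans (cx _) (req_sym f0).
have : heqv (pcat c f) c.
  apply: (@heqv_trans _ (pcat (std (f 0)) f)).
    apply: heqv_cat => //.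
    by apply: (heqv_trans cstd); exact/std_req/req_sym.
  apply: (heqv_trans gf); apply: heqv_sym; apply: (heqv_trans cstd).
  exact/std_req/req_sym.
case=> _ _ e; rewrite /hol => h; rewrite -[RHS]h.
have lc : isloop x0 c by split.
have lcf : isloop x0 (pcat c f) by exact: loop_cat.
have lc' : isloop x0 (pinv c) by split; [exact: pinv_path|exact: cx|exact: cx].
rewrite (loop_val_cat psi_homotopic psi_concat lcf lc').
rewrite (loop_val_cat psi_homotopic psi_concat lc lf).
rewrite (loop_val_cst psi_homotopic psi_concat cc) //.
rewrite add0r (loop_val_cst psi_homotopic psi_concat (pinv_path cc)) ?addr0 //.
by move=> s _; exact: cx.
Qed.

End StandardPaths.

(** * Deformations onto a vertex *)

Section Deformations.
Variables (K : realType) (X : sset).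
Local Notation point := (rpoint K X).

Lemma rcontinuous_near (T : topologicalType) (D : set T) (f : T -> point) :
  rcontinuous D f <->
  forall U, ropen U -> forall t, D t -> U (f t) ->
    \forall t' \near t, D t' -> U (f t').
Proof.
split=> [/rcontinuousPo h U oU t Dt Uft|h].
  have [O oO OE] := h U oU; have Ot : O t by exact/OE.
  have := open_nbhs_nbhs (conj oO Ot); apply: filterS => t' Ot' Dt'.
  exact/OE.
apply/rcontinuousPo => U oU.
exists ([set t | \forall t' \near t, D t' -> U (f t')]°); first exact: open_interior.
move=> t Dt; split=> [/interior_subset/nbhs_singleton|Ut]; first exact.
exact/nbhs_interior/h.
Qed.

Section Deform.
Variable tau : forall n, X n -> 'rV[K]_n.+1 -> 'rV[K]_n.+1.

(* tau takes values in the simplex only on the domain of a contraction; outside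
   of it the deformation is made constant. *)
Definition deform_end n (x : X n) (t : 'rV[K]_n.+1) : 'rV[K]_n.+1 :=
  if `[< std_simplex (tau x t) >] then tau x t else t.

Lemma deform_end_simplex n (x : X n) t :
  std_simplex t -> std_simplex (deform_end x t).
Proof. by move=> ht; rewrite /deform_end; case: ifP => // /asboolP. Qed.

Definition deform (u : K) (p : point) : point :=
  match p with
  | RPoint n x t ht => seg x ht (deform_end_simplex x ht) u
  end.

End Deform.

(** Local contractibility in a form that survives gluing: the target [ctr_map] is given on every
    simplex, and [ctr_nat] makes the straight deformations towards it match under all simplicial
    operators. Its continuity is asked in the ambient row space, where interiors are taken in
    [deform_open]. *)
Record vcontraction (p : point) : Type := VContraction {
  ctr_dom : point -> Prop;
  ctr_map : forall n, X n -> 'rV[K]_n.+1 -> 'rV[K]_n.+1;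
  ctr_vertex : X 0;
  ctr_open : ropen ctr_dom;
  ctr_self : ctr_dom p;
  ctr_simplex : forall n (x : X n) t (ht : std_simplex t),
    ctr_dom (RPoint x ht) -> std_simplex (ctr_map x t);
  ctr_cont : forall n (x : X n) t (ht : std_simplex t),
    ctr_dom (RPoint x ht) -> {for t, continuous (ctr_map x)};
  ctr_end : forall n (x : X n) t (ht : std_simplex t)
    (ht' : std_simplex (ctr_map x t)), ctr_dom (RPoint x ht) ->
    req (RPoint x ht') (rvertex K ctr_vertex);
  ctr_nat : forall m n (th : 'I_m.+1 -> 'I_n.+1) (hth : monotone th) (x : X n)
    t (ht : std_simplex t), ctr_dom (RPoint (sact hth x) ht) ->
    push th (ctr_map (sact hth x) t) = ctr_map x (push th t) }.

Section Contraction.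
Variables (p0 : point) (C : vcontraction p0).
Local Notation dom := (ctr_dom C).
Local Notation tau := (@ctr_map _ C).

Lemma deform_endE n (x : X n) t (ht : std_simplex t) : dom (RPoint x ht) ->
  deform_end tau x t = tau x t.
Proof. by move=> /ctr_simplex hs; rewrite /deform_end ifT //; exact/asboolP. Qed.

Lemma deform_rglue p q u : rglue p q -> dom p -> req (deform tau u p) (deform tau u q).
Proof.
case=> m n th hth x t ht dp /=; have dq : dom (RPoint x (push_simplex th ht)).
  by have [s _] := ctr_open C; apply: s dp; exact/rglue_req/RGlue.
apply: seg_sact => //.
by rewrite (deform_endE dp) (deform_endE dq) (ctr_nat dp).
Qed.

Lemma deform_req p q u : req p q -> dom p -> req (deform tau u p) (deform tau u q).
Proof.
have sat a b : req a b -> dom a -> dom b by have [s _] := ctr_open C; exact: s.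
elim=> {p q} [p q pq|p _|p q pq IH dq|p q r pq IH qr IH' dp].
- exact: deform_rglue.
- exact: req_refl.
- by apply/req_sym/IH; apply: sat dq; exact: req_sym.
- by apply: req_trans (IH dp) (IH' _); exact: sat dp.
Qed.

Lemma deform0 p : deform tau 0 p = p.
Proof. by case: p => n x t ht; rewrite /= seg0. Qed.

Lemma deform1 p : dom p -> req (deform tau 1 p) (rvertex K (ctr_vertex C)).
Proof.
case: p => n x t ht dp; rewrite /= seg1.
have h := ctr_simplex dp; rewrite (rpoint_eq x _ h (deform_endE dp)).
exact: ctr_end dp.
Qed.

(** The interval of times is compact, so the points whose whole track over it stays in [U] form an
    open set. This yields joint continuity of the deformation in time and position, despite the
    quotient topology. *)
Lemma deform_open (U : point -> Prop) (u e : K) : ropen U ->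
  ropen (fun q => dom q /\ forall v, u - e <= v <= u + e -> U (deform tau v q)).
Proof.
move=> oU; have [Us oU'] := oU; have [Ds oD] := ctr_open C; split.
  move=> p q pq [dp h]; split; first exact: Ds dp.
  by move=> v /h; apply: Us; exact: deform_req.
move=> n x; have [O oO OE] : exists2 O : set 'rV[K]_n.+1, open O &
    forall t (ht : std_simplex t), O t <-> U (RPoint x ht).
  have /open_subspaceP[O oO /seteqP[O1 O2]] := oU' n x; exists O => // t ht.
  split=> [Ot|Ut].
    by have [[ht' ?] _] := O1 t (conj Ot ht); rewrite (Prop_irrelevance ht ht').
  by have [] := O2 t (conj (ex_intro _ ht Ut) ht).
have [Q oQ QE] : exists2 O : set 'rV[K]_n.+1, open O &
    forall t (ht : std_simplex t), O t <-> dom (RPoint x ht).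
  have /open_subspaceP[Q oQ /seteqP[O1 O2]] := oD n x; exists Q => // t ht.
  split=> [Ot|Ut].
    by have [[ht' ?] _] := O1 t (conj Ot ht); rewrite (Prop_irrelevance ht ht').
  by have [] := O2 t (conj (ex_intro _ ht Ut) ht).
pose W : set 'rV[K]_n.+1 :=
  [set t | Q t /\ forall v, u - e <= v <= u + e -> O (convex v t (tau x t))].
have WE t (ht : std_simplex t) : W t <-> dom (RPoint x ht) /\
    forall v, u - e <= v <= u + e -> U (deform tau v (RPoint x ht)).
  split=> [[/(QE _ ht) dt h]|[dt h]]; split=> //; try exact/(QE _ ht).
    move=> v /h; rewrite /=; have hs := convex_simplex v ht (ctr_simplex dt).
    move/(OE _ hs); rewrite (_ : seg _ _ _ _ = RPoint x hs) //.
    by apply: rpoint_eq; rewrite (deform_endE dt).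
  move=> v /h /=; have hs := convex_simplex v ht (ctr_simplex dt).
  rewrite (_ : seg _ _ _ _ = RPoint x hs); first by move/(OE _ hs).
  by apply: rpoint_eq; rewrite (deform_endE dt).
apply/open_subspaceP; exists (W°); first exact: open_interior.
apply/seteqP; split=> t [Ht ht]; split=> //.
  by exists ht; apply/WE; exact: interior_subset Ht.
have {Ht} : W t by have [ht' H] := Ht; exact/(WE _ ht').
move=> [Qt h]; have dt : dom (RPoint x ht) by exact/QE.
have nQ : \forall t' \near t, Q t' by exact: open_nbhs_nbhs.
(* Near each time [v] a neighbourhood of [t] works; compactness of the segment makes one
   neighbourhood work for all times. *)
have nO : \forall t' \near t, `[u - e, u + e]%classic `<=` (fun v => O (convex v t' (tau x t'))).
  have /compact_near_coveringP cn := @segment_compact K (u - e) (u + e).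
  apply: (cn _ (nbhs t) (fun t' v => O (convex v t' (tau x t')))) => v /= vI.
  have cv : {for (v, t), continuous (fun z : K * 'rV[K]_n.+1 => convex z.1 z.2 (tau x z.2))}.
    have cc : {for (v, t), continuous (fun z : K * 'rV[K]_n.+1 => clamp z.1)}.
      apply: (@continuous_comp _ _ _ fst (@clamp K)); first exact: cvg_fst.
      exact: clamp_continuous.
    apply: cvgD; apply: cvgZ; [|exact: cvg_snd|exact: cc|].
      by apply: cvgB; [exact: cvg_cst|exact: cc].
    apply: (@continuous_comp _ _ _ snd (tau x)); first exact: cvg_snd.
    exact: ctr_cont dt.
  have Ov : O (convex v t (tau x t)) by apply: h; rewrite /= in_itv in vI.
  have nOv : nbhs (convex v t (tau x t)) O by exact: open_nbhs_nbhs.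
  exact: (cv _ nOv).
rewrite /interior /=; near=> t'; split; first by near: t'.
move=> v vI; have : `[u - e, u + e]%classic `<=` (fun v => O (convex v t' (tau x t'))) by near: t'.
by apply; rewrite /= in_itv.
Unshelve. all: by end_near.
Qed.

Lemma deform_rcontinuous (f : K -> point) : ispath f ->
  (forall s, 0 <= s <= 1 -> dom (f s)) ->
  rcontinuous (@square K) (fun us => deform tau us.1 (f us.2)).
Proof.
move=> cf fd; apply/rcontinuous_near => U oU [u0 s0] [/= u01 s01] Uf.
have cd : rcontinuous setT (fun u => deform tau u (f s0)).
  case: (f s0) => n x t ht; apply: rcontinuous_simplex.
  by apply: convex_cst_cvg => u; exact: cvg_id.
have /nbhs_ballP[e /= e0 eU] := (rcontinuous_near _ _).1 cd U oU u0 I Uf.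
(* Half the radius, so that the closed interval around [u0] lies in the open ball. *)
pose d := e / 2; have d0 : 0 < d by rewrite divr_gt0.
have sub v : u0 - d <= v <= u0 + d -> U (deform tau v (f s0)).
  move=> /andP[v0 v1]; apply: eU => //; rewrite /ball /= ltr_norml.
  have dE : d + d = e by rewrite -splitr.
  by apply/andP; split; lra.
have cW := (rcontinuous_near _ _).1 cf _ (deform_open u0 d oU) s0 s01
  (conj (fd _ s01) sub).
have nu : \forall u \near u0, u0 - d <= u <= u0 + d.
  near=> u; have : `|u0 - u| < d by near: u; exact: nbhsx_ballx.
  by rewrite ltr_norml => /andP[h1 h2]; apply/andP; split; lra.
exists ([set u | u0 - d <= u <= u0 + d],
        [set s | 0 <= s <= 1 -> dom (f s) /\
           forall v, u0 - d <= v <= u0 + d -> U (deform tau v (f s))]).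
  by split.
move=> [u s] [/= ud h] [/= _ s01']; exact: (h s01').2.
Unshelve. all: by end_near.
Qed.

End Contraction.
End Deformations.

(** * Vanishing of a functional for which all edges are good *)

Section Vanishing.
Variables (K : realType) (X : sset) (x0 : X 0) (V : zmodType).
Variable psi : sphere K 1 x0 -> V.
Hypothesis psi_homotopic : forall f g, sph_homotopic f g -> psi f = psi g.
Hypothesis psi_concat : forall f g, psi (sph_concat f g) = psi f + psi g.
Local Notation point := (rpoint K X).
Variable iv : X 0 -> K -> point.
Hypothesis iv_path : forall v, ispath (iv v).
Hypothesis iv0 : forall v, req (iv v 0) (rvertex K x0).
Hypothesis iv1 : forall v, req (iv v 1) (rvertex K v).
Hypothesis iv_base : forall s, 0 <= s <= 1 -> req (iv x0 s) (rvertex K x0).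
Hypothesis good_edges : forall y, good_edge psi iv y.
Hypothesis contractions : forall p : point, inhabited (vcontraction p).
Local Notation good := (good psi iv).

Definition subpath (f : K -> point) (a b : K) : K -> point :=
  fun s => f ((b - a) * s + a).

Lemma subpath_path f a b : ispath f -> 0 <= a -> a <= b -> b <= 1 ->
  ispath (subpath f a b).
Proof.
move=> cf a0 ab b1.
apply: (rcontinuous_comp (h := fun s : K => (b - a) * s + a) _ _ cf).
  exact: cont_affine.
by move=> s /andP[s0 s1]; apply/andP; split; nra.
Qed.

Lemma subpath_cat f a b c : ispath f -> 0 <= a -> a <= b -> b <= c -> c <= 1 ->
  path_homotopic (pcat (subpath f a b) (subpath f b c)) (subpath f a c).
Proof.
move=> cf a0 ab bc c1.
pose h (s : K) : K := (b - a) * clamp (2 * s + 0) + (c - b) * clamp (2 * s + -1) + a.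
have hE s : 0 <= s <= 1 -> h s = if s <= 2^-1 then (b - a) * (2 * s) + a
                                else (c - b) * (2 * s - 1) + b.
  move=> /andP[s0 s1]; rewrite /h addr0; case: leP => s2.
    rewrite [clamp (2 * s)]clamp_id; last by apply/andP; split; lra.
    by rewrite clamp_le0; [rewrite mulr0 addr0|lra].
  rewrite [clamp (2 * s)]clamp_ge1; last by lra.
  rewrite clamp_id; last by apply/andP; split; lra.
  by ring.
apply: (@homotopic_trans _ _ _ (f \o h)).
  apply: homotopic_req.
    apply: pcat_path; [exact: subpath_path (le_trans bc c1)|
      exact: subpath_path (le_trans a0 ab) bc c1|].
    by rewrite /subpath mulr1 mulr0 add0r subrK; exact: req_refl.
  move=> s s01; rewrite /= (hE _ s01) /pcat /subpath.
  by case: ifP => _; exact: req_refl.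
have ch : continuous h.
  have k0 := @cont_clamp_affine K 2 0; have k1 := @cont_clamp_affine K 2 (-1).
  move=> s; apply: cvgD; last exact: cvg_cst.
  by apply: cvgD; apply: cvgM; try exact: cvg_cst; [exact: k0|exact: k1].
apply: homotopic_reparam => //.
- exact: cont_affine.
- move=> s _; rewrite /h; have := clamp_itv (2 * s + 0); have := clamp_itv (2 * s + -1).
  by move=> /andP[? ?] /andP[? ?]; apply/andP; split; nra.
- by move=> s /andP[s0 s1]; apply/andP; split; nra.
- by rewrite /h !mulr0 !add0r !clamp_le0 ?mulr0 ?addr0 //; lra.
- by rewrite /h !mulr1 !clamp_ge1; [ring|lra|lra].
Qed.

(** The contraction sweeps out a square whose lateral sides are straight tracks, good by [good_seg],
    and whose far side is constant. *)
Lemma good_contractible (f : K -> point) p (C : vcontraction p) : ispath f ->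
  (forall s, 0 <= s <= 1 -> ctr_dom C (f s)) -> good f.
Proof.
move=> cf fd; have cH := deform_rcontinuous cf fd.
have trk q : good (fun u => deform (@ctr_map _ _ _ C) u q).
  by case: q => n x t ht; exact: good_seg.
have {1}-> : f = (fun s => deform (@ctr_map _ _ _ C) 0 (f s)).
  by apply/funext => s; rewrite deform0.
apply: (good_square psi_homotopic psi_concat iv_path iv0 iv1 good_edges cH) => /=.
- exact: trk.
- exact: trk.
- by move=> s s01 /=; apply: deform1; exact: fd.
Qed.

Lemma loop_val_eq0 f : isloop x0 f -> loop_val psi f = 0.
Proof.
move=> lf; have [cf _ _] := lf.
apply: (loop_val_good psi_homotopic psi_concat iv_path iv0 iv1 iv_base good_edges) => //.
have {1}-> : f = subpath f 0 1.
  by apply/funext => s; rewrite /subpath subr0 mul1r addr0.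
apply: (@subdivision _ (fun a b => good (subpath f a b))).
  move=> a b c a0 ab bc c1 gab gbc.
  have pab := subpath_path cf a0 ab (le_trans bc c1).
  have pbc := subpath_path cf (le_trans a0 ab) bc c1.
  have e : req (subpath f a b 1) (subpath f b c 0).
    by rewrite /subpath mulr1 mulr0 add0r subrK; exact: req_refl.
  apply: (good_homotopic psi_homotopic psi_concat iv_path iv0 iv1 good_edges _ _ (subpath_cat cf a0 ab bc c1)).
    exact: pcat_path.
    exact: subpath_path (le_trans ab bc) c1.
  exact: (good_cat psi_homotopic psi_concat iv_path iv0 iv1 good_edges).
move=> x x01; have [C] := contractions (f x).
have /nbhs_ballP[e /= e0 eC] := (rcontinuous_near _ _).1 cf _ (ctr_open C) x x01 (ctr_self C).
exists e => // a b a0 ab b1 xa bx.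
apply: (good_contractible (C := C)); first exact: subpath_path.
move=> s /andP[s0 s1]; apply: eC.
  by rewrite /ball /= ltr_norml; apply/andP; split; nra.
by apply/andP; split; nra.
Qed.

End Vanishing.

(** * Natural redistribution of barycentric coordinates *)

Section Reparametrization.
Variables (K : realType) (h : K -> K).

Definition psum n (t : 'rV[K]_n.+1) (k : nat) : K :=
  \sum_(j < n.+1 | (j < k)%N) t 0 j.

(** A point of the simplex cuts [0, 1] into consecutive intervals of lengths [t 0 i]; these are the
    lengths after the cut points have been moved by [h]. A monotone operator merges consecutive
    intervals, hence the naturality [incr_push]. *)
Definition incr n (t : 'rV[K]_n.+1) (i : 'I_n.+1) : K :=
  h (psum t i.+1) - h (psum t i).

Lemma sum_prefixS n (F : 'I_n.+1 -> K) (k : 'I_n.+1) :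
  \sum_(j < n.+1 | (j < k.+1)%N) F j = \sum_(j < n.+1 | (j < k)%N) F j + F k.
Proof.
rewrite (bigD1 k) //= addrC; congr (_ + _); apply: eq_bigl => i.
by rewrite ltnS [in RHS]ltn_neqAle andbC.
Qed.

Lemma sum_prefix_ge n (F : 'I_n.+1 -> K) k : (n < k)%N ->
  \sum_(j < n.+1 | (j < k)%N) F j = \sum_j F j.
Proof.
by move=> nk; apply: eq_bigl => i; apply: (leq_trans (ltn_ord i)).
Qed.

Lemma psum0 n (t : 'rV[K]_n.+1) : psum t 0 = 0.
Proof. by rewrite /psum big_pred0. Qed.

Lemma psumS n (t : 'rV[K]_n.+1) (i : 'I_n.+1) :
  psum t i.+1 = psum t i + t 0 i.
Proof. exact: (sum_prefixS (fun j => t 0 j)). Qed.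

Lemma psum_ge n (t : 'rV[K]_n.+1) k : (n < k)%N ->
  psum t k = \sum_i t 0 i.
Proof. by move=> nk; exact: (sum_prefix_ge (fun j => t 0 j)). Qed.

Lemma sum_incr n (t : 'rV[K]_n.+1) (k : nat) : (k <= n.+1)%N ->
  \sum_(j < n.+1 | (j < k)%N) incr t j = h (psum t k) - h 0.
Proof.
elim: k => [|k IH] kn; first by rewrite psum0 subrr big_pred0.
rewrite (sum_prefixS _ (Ordinal kn)) IH; last exact: ltnW.
by rewrite /incr /= addrC addrA subrK.
Qed.

(** Locates the cut points: it turns a partial sum of [push th t] into a partial sum of [t], as in
    [psum_push]. *)
Lemma monotone_initial m n (th : 'I_m.+1 -> 'I_n.+1) k : monotone th ->
  exists2 c : nat, (c <= m.+1)%N & forall i, (th i < k)%N = (i < c)%N.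
Proof.
move=> mth; pose P c := (c <= m.+1)%N && [forall i : 'I_m.+1, (c <= i)%N ==> ~~ (th i < k)%N].
have exP : exists c, P c.
  exists m.+1; rewrite /P leqnn; apply/forallP => i; apply/implyP => mi.
  by have := leq_trans (ltn_ord i) mi; rewrite ltnn.
case: (ex_minnP exP) => c /andP[cm /forallP cP] cmin; exists c => // i.
case: (ltnP i c) => [ic|ci]; last by apply/negbTE; have /implyP/(_ ci) := cP i.
apply/negPn/negP => nP; move: ic; apply/negP; rewrite -leqNgt; apply: cmin.
apply/andP; split; first exact/ltnW/ltn_ord.
apply/forallP => i'; apply/implyP => ii'; apply: contra nP.
by apply: leq_ltn_trans; exact: mth.
Qed.

Lemma sum_fiber m n (th : 'I_m.+1 -> 'I_n.+1) (F : 'I_m.+1 -> K) (P : pred 'I_n.+1) :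
  \sum_(j | P j) \sum_(i | th i == j) F i = \sum_(i | P (th i)) F i.
Proof.
rewrite [RHS](partition_big th P) //=; apply: eq_bigr => j Pj.
by apply: eq_bigl => i; case: eqP => [->|]; rewrite ?andbF // Pj.
Qed.

Lemma psum_push m n (th : 'I_m.+1 -> 'I_n.+1) (t : 'rV[K]_m.+1) k c :
  (forall i, (th i < k)%N = (i < c)%N) -> psum (push th t) k = psum t c.
Proof.
move=> kc; rewrite /psum; under eq_bigr => j _ do rewrite mxE.
by rewrite (sum_fiber _ (fun i => t 0 i)); apply: eq_bigl.
Qed.

Lemma incr_push m n (th : 'I_m.+1 -> 'I_n.+1) (t : 'rV[K]_m.+1) j : monotone th ->
  incr (push th t) j = \sum_(i | th i == j) incr t i.
Proof.
move=> mth; have [c cm cP] := monotone_initial j mth.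
have [c' cm' cP'] := monotone_initial j.+1 mth.
have e : \sum_(i < m.+1 | (i < c')%N) incr t i =
    \sum_(i < m.+1 | (i < c)%N) incr t i + \sum_(i | th i == j) incr t i.
  rewrite (bigID (fun i : 'I_m.+1 => (i < c)%N)) /=; congr (_ + _).
    by apply: eq_bigl => i; rewrite -cP -cP' andbC ltnS; case: ltngtP.
  apply: eq_bigl => i; rewrite -cP -cP' ltnS -leqNgt -eqn_leq.
  by rewrite -(inj_eq val_inj).
move: e; rewrite !sum_incr // -(psum_push t cP) -(psum_push t cP').
by rewrite /incr => e; lra.
Qed.

End Reparametrization.

(** * Contractible neighbourhoods in the nerve of QA *)

Section QSimplices.
Variable A : pzRingType.
Implicit Types M N : fgmod A.

Local Notation qrel x ij := (@qarr A _ x _ _ ij).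

(** Two labels of a simplex may be provably equal without being convertible; elements are carried
    across the equality. *)
Definition cast_mod M N (e : M = N) : M -> N :=
  match e in _ = N' return M -> N' with erefl => id end.

Lemma cast_mod_surj M N (e : M = N) y : exists m, y = cast_mod e m.
Proof. by case: N / e y => y; exists y. Qed.

Lemma qsimplex_extP n (x y : qsimplex A n) (e : forall i, qobj y i = qobj x i) :
  (forall (i j : 'I_n.+1) (ij : (i <= j)%N) a b,
     qrel y ij a b <-> qrel x ij (cast_mod (e i) a) (cast_mod (e j) b)) -> x = y.
Proof.
case: x e => ox ax h1 h2 h3; case: y => oy ay h1' h2' h3' /= e ea.
have eo : oy = ox by apply: functional_extensionality_dep.
subst oy; apply: qsimplex_eq => i j ij.
apply/funext => a; apply/funext => b; apply/propext; apply: iff_sym.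
by rewrite ea (Prop_irrelevance (e i) erefl) (Prop_irrelevance (e j) erefl).
Qed.

Section Links.
Variables (M : fgmod A) (n : nat) (x : qsimplex A n).

(* Vertices i and j of x carry the label M and are joined by an identity. *)
Definition linked (i j : 'I_n.+1) : Prop :=
  exists (ei : M = qobj x i) (ej : M = qobj x j),
    (forall (ij : (i <= j)%N) m m',
       qrel x ij (cast_mod ei m) (cast_mod ej m') <-> m = m') /\
    (forall (ji : (j <= i)%N) m m',
       qrel x ji (cast_mod ej m) (cast_mod ei m') <-> m = m').

Lemma linked_sym i j : linked i j -> linked j i.
Proof. by move=> [ei [ej [h h']]]; exists ej, ei. Qed.

Lemma linked_refl i : M = qobj x i -> linked i i.
Proof.
move=> e; exists e, e; split=> ii m m'.
  rewrite qarr_id; case: _ / e => //.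
by rewrite qarr_id; case: _ / e.
Qed.

Lemma linked_le i j (ei : M = qobj x i) (ej : M = qobj x j) (ij : (i <= j)%N) :
  (forall m m', qrel x ij (cast_mod ei m) (cast_mod ej m') <-> m = m') ->
  linked i j.
Proof.
move=> h; exists ei, ej; split=> [ij'|ji]; first by rewrite (bool_irrelevance ij' ij).
have e : i = j by apply/val_inj/anti_leq; rewrite ij.
subst j; rewrite (bool_irrelevance ji ij) (Prop_irrelevance ej ei) => m m'.
by rewrite qarr_id; case: _ / ei {h ej}.
Qed.

(** Two out of three: by [qarr_comp], an identity on one side of a triangle identifies the relations
    on the other two sides. *)
Lemma linked_trans_le (i j k : 'I_n.+1) : (i <= j)%N -> (j <= k)%N ->
  [/\ linked i j -> linked j k -> linked i k,
      linked i j -> linked i k -> linked j k &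
      linked j k -> linked i k -> linked i j].
Proof.
move=> ij jk; have ik := leq_trans ij jk; split.
- move=> [ei [ej [/(_ ij) h _]]] [ej' [ek [/(_ jk) h' _]]].
  rewrite (Prop_irrelevance ej' ej) in h'.
  apply: (@linked_le _ _ ei ek ik) => m m'; rewrite (qarr_comp ij jk ik).
  split=> [[y]|<-]; last by exists (cast_mod ej m); rewrite h h'.
  by have [m'' ->] := cast_mod_surj ej y; rewrite h h' => -[-> ->].
- move=> [ei [ej [/(_ ij) h _]]] [ei' [ek [/(_ ik) h' _]]].
  rewrite (Prop_irrelevance ei' ei) in h'.
  apply: (@linked_le _ _ ej ek jk) => m m'; split=> [hm|<-].
    by apply/h'; rewrite (qarr_comp ij jk ik); exists (cast_mod ej m); rewrite h.
  have /(qarr_comp ij jk ik)[y] := (h' m m).2 erefl.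
  by have [m'' ->] := cast_mod_surj ej y; rewrite h => -[->].
- move=> [ej [ek [/(_ jk) h _]]] [ei [ek' [/(_ ik) h' _]]].
  rewrite (Prop_irrelevance ek' ek) in h'.
  apply: (@linked_le _ _ ei ej ij) => m m'; split=> [hm|<-].
    by apply/h'; rewrite (qarr_comp ij jk ik); exists (cast_mod ej m'); rewrite h.
  have /(qarr_comp ij jk ik)[y] := (h' m m).2 erefl.
  by have [m'' ->] := cast_mod_surj ej y; rewrite h => -[hm e]; rewrite e in hm.
Qed.

Lemma linked_trans i j k : linked i j -> linked j k -> linked i k.
Proof.
move=> lij ljk; have lji := linked_sym lij; have lkj := linked_sym ljk.
case: (leqP i j) => [ij|/ltnW ji]; case: (leqP j k) => [jk|/ltnW kj];
  case: (leqP i k) => [ik|/ltnW ki].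
- by have [H _ _] := linked_trans_le ij jk; exact: H.
- by have [H _ _] := linked_trans_le ij jk; exact: H.
- by have [_ _ H] := linked_trans_le ik kj; apply: H.
- by have [_ _ H] := linked_trans_le ki ij; apply/linked_sym/H.
- by have [_ H _] := linked_trans_le ji ik; apply: H.
- by have [_ H _] := linked_trans_le jk ki; apply/linked_sym/H.
- by have [H _ _] := linked_trans_le kj ji; apply/linked_sym/H.
- by have [H _ _] := linked_trans_le kj ji; apply/linked_sym/H.
Qed.

End Links.

Lemma linked_act M m n (th : 'I_m.+1 -> 'I_n.+1) (hth : monotone th)
    (x : qsimplex A n) i j :
  linked M (qsimplex_act hth x) i j <-> linked M x (th i) (th j).
Proof.
wlog ij : i j / (i <= j)%N => [H|].
  case: (leqP i j) => [|/ltnW ji]; first exact: H.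
  by split=> /linked_sym/H h; apply/linked_sym/h.
split=> [[ei [ej [/(_ ij) h _]]]|[ei [ej [/(_ (hth _ _ ij)) h _]]]].
  exact: (@linked_le _ _ x _ _ ei ej (hth _ _ ij)).
exact: (@linked_le _ _ (qsimplex_act hth x) _ _ ei ej ij).
Qed.

(** Linked vertices carry equal modules, not merely isomorphic ones, so the simplex really is a
    degeneracy in the nerve. *)
Lemma all_linked_degenerate M n (x : qsimplex A n) : (forall i j, linked M x i j) ->
  x = qsimplex_act (@monotone_cst n 0 ord0) (qvertex M).
Proof.
move=> lx; have e i : M = qobj x i by have [] := lx i i.
apply: (@qsimplex_extP _ _ (qsimplex_act (@monotone_cst n 0 ord0) (qvertex M)) e).
move=> i j ij a b /=; have [ei [ej [/(_ ij) h _]]] := lx i j.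
by rewrite (Prop_irrelevance (e i) ei) (Prop_irrelevance (e j) ej) h.
Qed.

Lemma qvertexE (y : qsimplex A 0) : y = qvertex (qobj y ord0).
Proof.
rewrite {1}(@all_linked_degenerate (qobj y ord0) _ y); last first.
  by move=> i j; rewrite (ord1 i) (ord1 j); exact: linked_refl.
apply: (@qsimplex_extP _ _ (qvertex _) (fun=> erefl)) => i j ij a b /=; by [].
Qed.

Lemma vert_qvertex n (x : qnerve A n) k : vert x k = qvertex (qobj x k).
Proof. by rewrite [LHS]qvertexE. Qed.

End QSimplices.

Section Concentration.
Variables (K : realType) (A : pzRingType) (M : fgmod A) (h : K -> K).
Hypothesis h_cont : continuous h.
Hypothesis h_mono : {homo h : s s' / s <= s'}.
Hypothesis h0 : h 0 = 0.
Hypothesis h1 : h 1 = 1.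
Local Notation X := (qnerve A).

(* h sends [0, 1] to itself, and incr h t redistributes the barycentric
   coordinates t. At most one class of linked vertices has weight above 1/2, and
   the points with such a class are moved to its face, which is degenerate. *)
Definition cluster n (x : X n) (t : 'rV[K]_n.+1) (i : 'I_n.+1) : K :=
  \sum_(j | `[< linked M x i j >]) incr h t j.

(** Truncating at 1/2 keeps the weight continuous in [t] while making it zero outside the dominant
    class. *)
Definition excess n (x : X n) (t : 'rV[K]_n.+1) (i : 'I_n.+1) : K :=
  Num.max 0 (cluster x t i - 2^-1) * incr h t i.

Definition total_excess n (x : X n) (t : 'rV[K]_n.+1) : K :=
  \sum_i excess x t i.

Definition concentrate n (x : X n) (t : 'rV[K]_n.+1) : 'rV[K]_n.+1 :=
  \row_i (excess x t i / total_excess x t).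

Definition concentrated (p : rpoint K X) : Prop :=
  match p with RPoint n x t _ => 0 < total_excess x t end.

Lemma incr_ge0 n (t : 'rV[K]_n.+1) i : std_simplex t -> 0 <= incr h t i.
Proof.
move=> [t0 _]; rewrite subr_ge0; apply: h_mono.
by rewrite psumS lerDl.
Qed.

Lemma sum_incr1 n (t : 'rV[K]_n.+1) : std_simplex t -> \sum_i incr h t i = 1.
Proof.
move=> [_ t1]; rewrite -(@sum_prefix_ge K n _ n.+1) // sum_incr //.
by rewrite psum_ge // t1 h0 h1 subr0.
Qed.

Lemma cluster_push m n (th : 'I_m.+1 -> 'I_n.+1) (hth : monotone th) (x : X n)
    (t : 'rV[K]_m.+1) i :
  cluster x (push th t) (th i) = cluster (sact hth x : X m) t i.
Proof.
rewrite /cluster; under eq_bigr => j _ do rewrite incr_push //.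
rewrite sum_fiber; apply: eq_bigl => j.
by have lE := linked_act M hth x i j; apply/asboolP/asboolP => /lE.
Qed.

Lemma excess_push m n (th : 'I_m.+1 -> 'I_n.+1) (hth : monotone th) (x : X n)
    (t : 'rV[K]_m.+1) j :
  excess x (push th t) j = \sum_(i | th i == j) excess (sact hth x : X m) t i.
Proof.
rewrite /excess incr_push // mulr_sumr; apply: eq_bigr => i /eqP <-.
by rewrite -cluster_push.
Qed.

Lemma total_excess_push m n (th : 'I_m.+1 -> 'I_n.+1) (hth : monotone th)
    (x : X n) (t : 'rV[K]_m.+1) :
  total_excess x (push th t) = total_excess (sact hth x : X m) t.
Proof.
rewrite /total_excess; under eq_bigr => j _ do rewrite (excess_push hth).
by rewrite (sum_fiber th _ xpredT).
Qed.

Lemma cont_sum (I : Type) (r : seq I) (P : pred I) (T : topologicalType)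
    (F : I -> T -> K) : (forall i, continuous (F i)) ->
  continuous (fun t => \sum_(i <- r | P i) F i t).
Proof.
move=> cF; elim: r => [|i r IH] t.
  rewrite (_ : (fun _ => _) = fun=> 0); first exact: cvg_cst.
  by apply/funext => s; rewrite big_nil.
rewrite (_ : (fun _ => _) = (fun s => (if P i then F i s else 0) +
    \sum_(i <- r | P i) F i s)).
  by apply: cvgD; [case: ifP => _; [exact: cF|exact: cvg_cst]|exact: IH].
by apply/funext => s; rewrite big_cons; case: ifP => // _; rewrite add0r.
Qed.

Lemma incr_cont n i : continuous (fun t : 'rV[K]_n.+1 => incr h t i).
Proof.
have cp k : continuous (fun t : 'rV[K]_n.+1 => psum t k).
  by apply: cont_sum => j t; exact: coord_continuous.
have ch k : continuous (fun t : 'rV[K]_n.+1 => h (psum t k)).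
  by move=> t; apply: continuous_comp; [exact: cp|exact: h_cont].
by move=> t; exact: (cvgB (ch i.+1 t) (ch i t)).
Qed.

Lemma excess_cont n (x : X n) i :
  continuous (fun t : 'rV[K]_n.+1 => excess x t i).
Proof.
apply: continuous_mulr; last exact: incr_cont.
apply: continuous_maxr; first exact: cst_continuous.
apply: continuous_subr; last exact: cst_continuous.
by apply: cont_sum => j; exact: incr_cont.
Qed.

Lemma total_excess_cont n (x : X n) : continuous (total_excess x).
Proof. by apply: cont_sum => i; exact: excess_cont. Qed.

Lemma concentrate_cont n (x : X n) t : 0 < total_excess x t ->
  {for t, continuous (concentrate x)}.
Proof.
move=> S0; have cS : {for t, continuous (fun t : 'rV[K]_n.+1 => (total_excess x t)^-1)}.
  have nz : total_excess x t != 0 by rewrite gt_eqF.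
  exact: (cvgV nz (@total_excess_cont _ x t)).
have -> : concentrate x = (fun t => \sum_i ((total_excess x t)^-1 * excess x t i) *: delta_mx 0 i).
  apply/funext => s; rewrite [LHS]row_sum_delta; apply: eq_bigr => i _.
  by rewrite mxE mulrC.
elim: (index_enum _) => [|i r IH].
  rewrite (_ : (fun _ => _) = fun=> 0); first exact: cst_continuous.
  by apply/funext => s; rewrite big_nil.
rewrite (_ : (fun _ => _) = (fun s => ((total_excess x s)^-1 * excess x s i) *: delta_mx 0 i +
    \sum_(i <- r) ((total_excess x s)^-1 * excess x s i) *: delta_mx 0 i)); last first.
  by apply/funext => s; rewrite big_cons.
have cSi : {for t, continuous (fun t => (total_excess x t)^-1 * excess x t i)}.
  exact: (cvgM cS (@excess_cont _ x i t)).
exact: (cvgD (cvgZr_tmp (cSi : _ --> _)) IH).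
Qed.

Lemma concentrated_rglue p q : rglue p q -> (concentrated p <-> concentrated q).
Proof. by case=> m n th hth x t ht /=; rewrite -total_excess_push. Qed.

Lemma concentrated_open : ropen concentrated.
Proof.
split=> [p q|n x].
  have H a b : req a b -> (concentrated a <-> concentrated b).
    elim=> {a b} [a b /concentrated_rglue //|a //|a b _ IH|a b c _ IH _ IH'].
      exact: iff_sym.
    exact: iff_trans IH IH'.
  by move=> /H [].
apply/open_subspaceP; exists [set t | 0 < total_excess x t].
  apply: (open_comp (D := [set s : K | 0 < s])); last exact: open_gt.
  by move=> t _; exact: total_excess_cont.
by apply/seteqP; split=> t [/= Ht ht]; split=> //; first [by exists ht|by case: Ht].
Qed.

Lemma excess_ge0 n (x : X n) t i : std_simplex t -> 0 <= excess x t i.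
Proof. by move=> ht; rewrite mulr_ge0 ?le_max ?lexx // incr_ge0. Qed.

Lemma concentrate_simplex n (x : X n) t : std_simplex t ->
  0 < total_excess x t -> std_simplex (concentrate x t).
Proof.
move=> ht S0; split=> [i|].
  by rewrite mxE divr_ge0 ?excess_ge0 // ltW.
under eq_bigr => i _ do rewrite mxE.
by rewrite -mulr_suml mulfV // gt_eqF.
Qed.

Lemma concentrate_push m n (th : 'I_m.+1 -> 'I_n.+1) (hth : monotone th)
    (x : X n) (t : 'rV[K]_m.+1) :
  push th (concentrate (sact hth x : X m) t) = concentrate x (push th t).
Proof.
apply/rowP => j; rewrite !mxE (excess_push hth) total_excess_push mulr_suml.
by apply: eq_bigr => i _; rewrite mxE.
Qed.

Lemma excess_linked n (x : X n) t i j : std_simplex t ->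
  0 < excess x t i -> 0 < excess x t j -> linked M x i j.
Proof.
move=> ht ei ej.
have big (k : 'I_n.+1) : 0 < excess x t k -> 2^-1 < cluster x t k.
  rewrite /excess => ek; rewrite ltNge; apply/negP => ck.
  by move: ek; rewrite max_l ?mul0r ?ltxx // subr_le0.
apply: contrapT => nij.
have : cluster x t i + cluster x t j <= \sum_k incr h t k.
  rewrite [leRHS](bigID (fun k => `[< linked M x i k >])) /=.
  apply: lerD => //; rewrite /cluster [leLHS]big_mkcond [leRHS]big_mkcond /=.
  apply: ler_sum => k _.
  case: asboolP => jk; last by case: ifP => // _; exact: incr_ge0.
  case: asboolP => //= ik; exfalso; apply: nij.
  exact: linked_trans ik (linked_sym jk).
rewrite sum_incr1 //; have := big _ ei; have := big _ ej; lra.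
Qed.

(* A monotone retraction onto B, so that a face with linked vertices can be
   recognized as a degeneracy. *)
Definition retract_map n (B : pred 'I_n.+1) (b0 : 'I_n.+1) (j : 'I_n.+1) : 'I_n.+1 :=
  let bmin := [arg min_(b < b0 | B b) (b : nat)]%N in
  [arg max_(b > bmin | B b && (b <= maxn j bmin)%N) (b : nat)]%N.

Lemma retract_mapP n (B : pred 'I_n.+1) (b0 : 'I_n.+1) : B b0 ->
  [/\ forall j, B (retract_map B b0 j), forall b, B b -> retract_map B b0 b = b &
      monotone (retract_map B b0)].
Proof.
move=> Bb0; rewrite /retract_map; case: arg_minnP => // bmin Bm bminP.
have P0 j : B bmin && (bmin <= maxn j bmin)%N by rewrite Bm leq_maxr.
have arg j := @arg_maxnP _ bmin (fun b => B b && (b <= maxn j bmin)%N) (fun b => b : nat) (P0 j).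
split=> [j|b Bb|j j' jj'].
- by case: (arg j) => b /andP[].
- case: (arg b) => c /andP[Bc]; rewrite (maxn_idPl _) ?bminP // => cb /(_ b).
  by rewrite Bb leqnn => /(_ isT) bc; apply/val_inj/anti_leq; rewrite cb.
- case: (arg j) => b /andP[Bb bj] _.
  case: (arg j') => b' _; apply; rewrite Bb /=.
  by apply: leq_trans bj _; rewrite geq_max !leq_max jj' leqnn orbT.
Qed.

(** The retraction onto the support of [concentrate x t] fixes that point, which is therefore
    carried by [sact rmono x]. All vertices of this simplex are linked, so it is a degeneracy of the
    vertex [M]. *)
Lemma concentrate_vertex n (x : X n) t (ht : std_simplex t)
    (ht' : std_simplex (concentrate x t)) : 0 < total_excess x t ->
  req (RPoint x ht') (rvertex K (qvertex M : X 0)).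
Proof.
move=> S0; pose B i := 0 < excess x t i.
have [b0 Bb0] : exists b0, B b0.
  apply: contrapT => nB; move: S0; rewrite /total_excess big1 ?ltxx // => i _.
  apply/eqP; rewrite eq_le excess_ge0 // andbT leNgt; apply/negP => Bi.
  by apply: nB; exists i.
have [rB rid rmono] := retract_mapP Bb0; set r := retract_map B b0 in rB rid rmono.
have rE : push r (concentrate x t) = concentrate x t.
  apply/rowP => j; rewrite mxE; have Bc i : ~~ B i -> concentrate x t 0 i = 0.
    rewrite mxE /B -leNgt => e; rewrite (_ : excess x t i = 0) ?mul0r //.
    by apply/eqP; rewrite eq_le e excess_ge0.
  rewrite (bigID B) /= [X in _ + X]big1 ?addr0; last by move=> i /andP[_ /Bc].
  case Bj: (B j).
    rewrite (big_pred1 j) // => i /=; case Bi: (B i); first by rewrite rid // andbT.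
    by rewrite andbF; apply/esym/negbTE/eqP => e; rewrite e Bj in Bi.
  rewrite big1 ?Bc ?Bj // => i /andP[/eqP ri Bi].
  by move: Bj; rewrite -ri rB.
have e1 : req (RPoint (sact rmono x) ht') (RPoint x ht') by exact: req_push.
apply: req_trans (req_sym e1) _.
have -> : sact rmono x = sact (@monotone_cst n 0 ord0) (qvertex M : X 0).
  apply: all_linked_degenerate => i j; apply/(linked_act M rmono).
  by apply: (excess_linked ht); exact: rB.
apply: req_push; apply/rowP => j; rewrite !mxE -[RHS](proj2 ht').
by apply: eq_bigl => i; rewrite (ord1 j) eqxx.
Qed.

End Concentration.

Section Contractions.
Variables (K : realType) (A : pzRingType).

Definition stretch (a b s : K) : K := clamp ((b - a)^-1 * s - (b - a)^-1 * a).

Lemma stretch_mono a b : a < b -> {homo stretch a b : s s' / s <= s'}.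
Proof.
move=> ab s s' ss'; have d0 : 0 <= (b - a)^-1 by rewrite invr_ge0 subr_ge0 ltW.
have h : (b - a)^-1 * s - (b - a)^-1 * a <= (b - a)^-1 * s' - (b - a)^-1 * a.
  by rewrite lerB // ler_wpM2l.
rewrite /stretch /clamp ge_max !le_max lexx /=; apply/orP; right.
by rewrite le_min !ge_min lexx h orbT.
Qed.

Lemma stretch_le a b s : a < b -> s <= a -> stretch a b s = 0.
Proof.
move=> ab sa; rewrite /stretch clamp_le0 // -mulrBr mulr_ge0_le0 ?subr_le0 //.
by rewrite invr_ge0 subr_ge0 ltW.
Qed.

Lemma stretch_ge a b s : a < b -> b <= s -> stretch a b s = 1.
Proof.
move=> ab sb; have d0 : 0 < b - a by rewrite subr_gt0.
by rewrite /stretch clamp_ge1 // -mulrBr mulrC ler_pdivlMr // mul1r lerB.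
Qed.

Lemma stretch_cont a b : continuous (stretch a b).
Proof. exact: cont_clamp_affine. Qed.

(** Pick a vertex [i] of positive weight. Its position in [x] is not preserved by simplicial
    operators, but its label [M] and its interval [a, b] in [0, 1] make sense in every simplex.
    Stretching [a, b] onto [0, 1] puts the whole weight of the given point at [i], which places it
    in the domain of the concentration. *)
Lemma qnerve_contraction (p : rpoint K (qnerve A)) : inhabited (vcontraction p).
Proof.
case: p => n x t ht; have [t0 t1] := ht.
have [i ti] : exists i, 0 < t 0 i.
  apply: contrapT => nt; move: (oner_neq0 K); rewrite -t1 big1 ?eqxx // => i _.
  by apply/eqP; rewrite eq_le t0 andbT leNgt; apply/negP => ti; apply: nt; exists i.
pose a := psum t i; pose b := psum t i.+1.
have bE : b = a + t 0 i by rewrite /b psumS.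
have ab : a < b by rewrite bE ltrDl.
have a0 : 0 <= a by rewrite sumr_ge0.
have b1 : b <= 1.
  rewrite -t1 /b /psum [leRHS](bigID (fun j : 'I_n.+1 => (j < i.+1)%N)) /=.
  by rewrite lerDl sumr_ge0.
pose h := stretch a b; pose M := qobj x i.
have ch := @stretch_cont a b; have mh := stretch_mono ab.
have h0 : h 0 = 0 by exact: stretch_le.
have h1 : h 1 = 1 by exact: stretch_ge.
have self : concentrated M h (RPoint x ht).
  have di : incr h t i = 1.
    by rewrite /incr -/a -/b {1}/h stretch_ge // /h stretch_le // subr0.
  have ci : 1 <= cluster M h x t i.
    rewrite -di /cluster (bigD1 i) /=; last exact/asboolP/linked_refl.
    by rewrite lerDl sumr_ge0 // => j _; exact: incr_ge0.
  rewrite /= /total_excess (bigD1 i) //= ltr_pwDl //.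
    rewrite /excess di mulr1 lt_max; apply/orP; right; lra.
  by rewrite sumr_ge0 // => j _; exact: excess_ge0.
constructor; apply: (@VContraction K (qnerve A) _ (concentrated M h)
  (fun n x => concentrate M h x) (qvertex M : qnerve A 0)) => //.
- exact: concentrated_open.
- by move=> m y s hs; exact: concentrate_simplex.
- by move=> m y s hs; exact: concentrate_cont.
- by move=> m y s hs hs' S0; exact: (concentrate_vertex mh h0 h1 hs).
- by move=> m k th hth y s hs _; exact: concentrate_push.
Qed.

End Contractions.

(** * Generation by the loop of the free module of rank one *)

Section Triangles.
Variables (K : realType) (X : sset) (x0 : X 0) (V : zmodType).
Variable psi : sphere K 1 x0 -> V.
Hypothesis psi_homotopic : forall f g, sph_homotopic f g -> psi f = psi g.
Hypothesis psi_concat : forall f g, psi (sph_concat f g) = psi f + psi g.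
Local Notation point := (rpoint K X).
Variable iv : X 0 -> K -> point.
Hypothesis iv_path : forall v, ispath (iv v).
Hypothesis iv0 : forall v, req (iv v 0) (rvertex K x0).
Hypothesis iv1 : forall v, req (iv v 1) (rvertex K v).
Local Notation good_edge := (good_edge psi iv).
Local Notation epath := (@edge_path K X).

Definition face n (x : X n) (i j : 'I_n.+1) (ij : (i <= j)%N) : X 1 :=
  sact (face_map_monotone ij) x.

Lemma edge_path_path y : ispath (epath y).
Proof. exact: seg_path. Qed.

Lemma edge_path0 (y : X 1) : req (epath y 0) (rvertex K (vert y ord0)).
Proof. by rewrite /edge_path seg0; exact: rvertex_vert. Qed.

Lemma edge_path1 (y : X 1) : req (epath y 1) (rvertex K (vert y ord_max)).
Proof. by rewrite /edge_path seg1; exact: rvertex_vert. Qed.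

Lemma face_path (n : nat) (x : X n) (i j : 'I_n.+1) (ij : (i <= j)%N) s :
  req (epath (face x ij) s) (seg x (vtx_simplex K i) (vtx_simplex K j) s).
Proof. by apply: seg_sact; rewrite push_vtx /face_map. Qed.

Section Triangle.
Variables (n : nat) (x : X n) (i j k : 'I_n.+1).
Hypotheses (ij : (i <= j)%N) (jk : (j <= k)%N) (ik : (i <= k)%N).

Lemma triangle_homotopic :
  path_homotopic (pcat (epath (face x ij)) (epath (face x jk)))
    (epath (face x ik)).
Proof.
have seg_face (l m : 'I_n.+1) (lm : (l <= m)%N) :
    path_homotopic (epath (face x lm)) (seg x (vtx_simplex K l) (vtx_simplex K m)).
  apply: homotopic_req; first exact: edge_path_path.
  by move=> s _; exact: face_path.
apply: (@homotopic_trans _ _ _ (pcat (seg x (vtx_simplex K i) (vtx_simplex K j))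
  (seg x (vtx_simplex K j) (vtx_simplex K k)))).
  apply: homotopic_pcat; [|exact: seg_face|exact: seg_face].
  apply: req_trans (face_path _ _ _) _; apply: req_trans (req_sym (face_path _ _ _)).
  by rewrite seg0 seg1; exact: req_refl.
by apply: homotopic_trans; [exact: seg_cat|exact/homotopic_sym/seg_face].
Qed.

Let a := pcat (pcat (iv (vert x i)) (epath (face x ij))) (epath (face x jk)).
Let b := pcat (iv (vert x i)) (epath (face x ik)).

Lemma face_edge_path1 (l m : 'I_n.+1) (lm : (l <= m)%N) :
  req (epath (face x lm) 1) (rvertex K (vert x m)).
Proof. by apply: req_trans (edge_path1 _) _; rewrite vert_sact; exact: req_refl. Qed.

Lemma face_edge_path0 (l m : 'I_n.+1) (lm : (l <= m)%N) :
  req (epath (face x lm) 0) (rvertex K (vert x l)).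
Proof. by apply: req_trans (edge_path0 _) _; rewrite vert_sact; exact: req_refl. Qed.

Lemma iv_face (l m : 'I_n.+1) (lm : (l <= m)%N) :
  req (iv (vert x l) 1) (epath (face x lm) 0).
Proof. by apply: req_trans (iv1 _) _; exact/req_sym/face_edge_path0. Qed.

Lemma triangle_heqv : heqv psi a b.
Proof.
have ei (l m : 'I_n.+1) (lm : (l <= m)%N) := iv_face lm.
have e : req (epath (face x ij) 1) (epath (face x jk) 0).
  by apply: req_trans (face_edge_path1 _) _; exact/req_sym/face_edge_path0.
have hb : based x0 (iv (vert x i)) by split.
apply: (heqv_trans psi_homotopic psi_concat).
  by apply: (heqv_catA psi_homotopic psi_concat hb) => //; exact: edge_path_path.
apply: (heqv_cat2 psi_homotopic psi_concat hb triangle_homotopic) => //.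
- by apply: pcat_path => //; exact: edge_path_path.
- exact: edge_path_path.
- by rewrite pcat0.
Qed.

Lemma good_edge_face (l m : 'I_n.+1) (lm : (l <= m)%N) :
  good_edge (face x lm) <-> heqv psi (pcat (iv (vert x l)) (epath (face x lm))) (iv (vert x m)).
Proof.
by rewrite -[good_edge _]/(heqv psi (pcat (iv (vert (face x lm) ord0))
  (epath (face x lm))) (iv (vert (face x lm) ord_max))) !vert_sact.
Qed.

(** The two routes around a triangle are equivalent; since the first edge is good, its route may be
    replaced by the chosen path to the middle vertex. *)
Lemma good_right : good_edge (face x ij) -> good_edge (face x ik) -> good_edge (face x jk).
Proof.
rewrite !good_edge_face => gij gik.
apply: (heqv_trans psi_homotopic psi_concat (b := a)).
  apply: (heqv_cat psi_homotopic); last exact: iv_face.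
    exact: (heqv_sym psi_homotopic psi_concat gij).
  exact: edge_path_path.
exact: (heqv_trans psi_homotopic psi_concat triangle_heqv gik).
Qed.

Lemma good_comp : good_edge (face x ij) -> good_edge (face x jk) -> good_edge (face x ik).
Proof.
rewrite !good_edge_face => gij gjk.
apply: (heqv_trans psi_homotopic psi_concat (b := a)).
  exact: (heqv_sym psi_homotopic psi_concat triangle_heqv).
apply: (heqv_trans psi_homotopic psi_concat _ gjk).
apply: (heqv_cat psi_homotopic) => //; first exact: edge_path_path.
by rewrite pcat1; apply: req_trans (face_edge_path1 _) _; exact/req_sym/face_edge_path0.
Qed.

End Triangle.
End Triangles.

(** * Edges and triangles of the nerve built from spans *)

Section SmallSimplices.
Variable A : pzRingType.
Implicit Types M N P : fgmod A.

(** Indexed by bare naturals so that matching computes; indices beyond 2 repeat [P]. *)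
Definition ob3 M N P (k : nat) : fgmod A :=
  match k with 0%N => M | 1%N => N | _ => P end.

Section Triangle.
Variables (M N P : fgmod A) (s1 : span M N) (s2 : span N P) (s3 : span M P).

Definition rel3 (a b : nat) : ob3 M N P a -> ob3 M N P b -> Prop :=
  match a, b return ob3 M N P a -> ob3 M N P b -> Prop with
  | 0%N, 0%N => eq
  | 0%N, 1%N => span_rel s1
  | 0%N, _.+2 => span_rel s3
  | 1%N, 1%N => eq
  | 1%N, _.+2 => span_rel s2
  | _.+2, _.+2 => eq
  | _, _ => fun _ _ => False
  end.

Hypothesis s123 : forall x z, span_rel s3 x z <->
  exists y, span_rel s1 x y /\ span_rel s2 y z.

Lemma rel3_span (i j : 'I_3) (ij : (i <= j)%N) :
  exists s : span (ob3 M N P i) (ob3 M N P j), @rel3 i j = span_rel s.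
Proof.
case: i j ij => [[|[|[|i]]] hi] [[|[|[|j]]] hj] //= ij; try exact: id_span_subproof.
- by exists s1.
- by exists s3.
- by exists s2.
Qed.

Lemma rel3_id (i : 'I_3) (ii : (i <= i)%N) x y : @rel3 i i x y <-> x = y.
Proof. by case: i ii x y => [[|[|[|i]]] hi] //=. Qed.

Lemma rel3_comp (i j k : 'I_3) (ij : (i <= j)%N) (jk : (j <= k)%N) (ik : (i <= k)%N) x z :
  @rel3 i k x z <-> exists y, @rel3 i j x y /\ @rel3 j k y z.
Proof.
case: i j k ij jk ik x z => [[|[|[|i]]] hi] [[|[|[|j]]] hj] [[|[|[|k]]] hk] //= ij jk ik x z;
  first [exact: s123 | by split=> [h|[y [-> h]]] //; exists x |
         by split=> [h|[y [h <-]]] //; exists z].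
Qed.

Definition qtriangle : qnerve A 2 :=
  @QSimplex A 2 (fun i => ob3 M N P i) (fun i j _ => @rel3 i j)
    rel3_span rel3_id rel3_comp.

End Triangle.

Section Edge.
Variables (M N : fgmod A) (s : span M N).

Definition id_span : span N N :=
  @Span A N N N idfun idfun (fun x => ex_intro _ x erefl) (fun _ _ => id).

Lemma id_spanE x y : span_rel id_span x y <-> x = y.
Proof. by split=> [[p [<- <-]]|->] //; exists y. Qed.

Lemma edge_comp x z : span_rel s x z <->
  exists y, span_rel s x y /\ span_rel id_span y z.
Proof.
by split=> [h|[y [h /id_spanE <-]]] //; exists z; split=> //; exact/id_spanE.
Qed.

(** An edge is taken as a face of a triangle with an identity side, so that the laws of a simplex
    are checked only once. *)
Definition qedge : qnerve A 1 :=
  @face (qnerve A) 2 (qtriangle edge_comp) ord0 (Ordinal (isT : (1 < 3)%N)) isT.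

End Edge.

Lemma ord2E (i : 'I_2) : i = ord0 \/ i = ord_max.
Proof. by case: i => [[|[|i]] hi] //; [left|right]; exact: val_inj. Qed.

Lemma qedge_eta (y : qnerve A 1) (s : span (qobj y ord0) (qobj y ord_max)) :
  (forall a b, @qarr A 1 y ord0 ord_max isT a b <-> span_rel s a b) -> y = qedge s.
Proof.
move=> hs; apply/esym.
have e (i : 'I_2) : qobj y i = qobj (qedge s) i by have [->|->] := ord2E i.
apply: (@qsimplex_extP A 1 (qedge s) y e) => i j ij a b.
have [i0|i1] := ord2E i; have [j0|j1] := ord2E j; subst i j => //.
- by rewrite (Prop_irrelevance (e ord0) erefl) /= qarr_id.
- rewrite (Prop_irrelevance (e ord0) erefl) (Prop_irrelevance (e ord_max) erefl) /=.
  by rewrite -hs (bool_irrelevance ij isT).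
- by rewrite (Prop_irrelevance (e ord_max) erefl) /= qarr_id.
Qed.

Lemma qedge_eq M N (s t : span M N) :
  (forall a b, span_rel s a b <-> span_rel t a b) -> qedge s = qedge t.
Proof. by move=> st; apply: (@qedge_eta (qedge s) t). Qed.

Lemma face_qtriangle M N P (s1 : span M N) (s2 : span N P) (s3 : span M P) h :
  let T := @qtriangle M N P s1 s2 s3 h in
  let o1 : 'I_3 := Ordinal (isT : (1 < 3)%N) in
  let o2 : 'I_3 := Ordinal (isT : (2 < 3)%N) in
  [/\ @face (qnerve A) 2 T ord0 o1 isT = qedge s1,
      @face (qnerve A) 2 T o1 o2 isT = qedge s2 &
      @face (qnerve A) 2 T ord0 o2 isT = qedge s3].
Proof.
move=> T o1 o2; split.
- by apply: (@qedge_eta (@face (qnerve A) 2 T ord0 o1 isT) s1).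
- by apply: (@qedge_eta (@face (qnerve A) 2 T o1 o2 isT) s2).
- by apply: (@qedge_eta (@face (qnerve A) 2 T ord0 o2 isT) s3).
Qed.

Definition monos M N (f : {linear M -> N}) (fi : injective f) : span M N :=
  @Span A M N M idfun f (fun x => ex_intro _ x erefl) fi.

Definition epis M P (q : {linear P -> M}) (qs : forall x, exists p, q p = x) : span M P :=
  @Span A M P P q idfun qs (fun _ _ => id).

Lemma monosE M N (f : {linear M -> N}) fi x y : span_rel (@monos M N f fi) x y <-> y = f x.
Proof. by split=> [[p [<- <-]]|->] //; exists x. Qed.

Lemma episE M P (q : {linear P -> M}) qs x y : span_rel (@epis M P q qs) x y <-> x = q y.
Proof. by split=> [[p [<- <-]]|->] //; exists y. Qed.

Lemma zero_fgmod_eq (x y : zero_fgmod A) : x = y.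
Proof. by apply/matrixP => i []. Qed.

Definition null_map M N : {linear M -> N} := \0%R.

Lemma null_inj M : injective (null_map (zero_fgmod A) M).
Proof. by move=> x y _; exact: zero_fgmod_eq. Qed.

Lemma null_surj M (x : zero_fgmod A) : exists p, null_map M (zero_fgmod A) p = x.
Proof. by exists 0; exact: zero_fgmod_eq. Qed.

(** As a relation this morphism from 0 to [M] contains only (0, 0), whereas [zero_epi] relates 0 to
    every element of [M]. *)
Definition zero_mono M : span (zero_fgmod A) M := monos (@null_inj M).
Definition zero_epi M : span (zero_fgmod A) M := epis (@null_surj M).

Lemma zero_monoE M x y : span_rel (zero_mono M) x y <-> y = 0.
Proof. by rewrite monosE. Qed.

Lemma zero_epiE M x y : span_rel (zero_epi M) x y.
Proof. by rewrite episE; exact: zero_fgmod_eq. Qed.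

End SmallSimplices.

Section Generation.
Variables (K : realType) (A : pzRingType) (V : zmodType).
Local Notation X := (qnerve A).
Local Notation base := (qvertex (zero_fgmod A) : X 0).
Variable psi : sphere K 1 base -> V.
Hypothesis psi_homotopic : forall f g, sph_homotopic f g -> psi f = psi g.
Hypothesis psi_concat : forall f g, psi (sph_concat f g) = psi f + psi g.
Local Notation point := (rpoint K X).
Local Notation epath := (@edge_path K X).

Implicit Types M N P : fgmod A.

(** One edge from 0 to each vertex; the edge at 0 itself is degenerate, so its path is constant
    there. *)
Definition tree (v : X 0) : K -> point := epath (qedge (zero_mono (qobj v ord0))).

(** Quillen's loop representing the class of [M] in pi_1 of the nerve. *)
Definition mod_loop (M : fgmod A) : K -> point :=
  pcat (epath (qedge (zero_epi M))) (pinv (epath (qedge (zero_mono M)))).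

Lemma tree_path v : ispath (tree v).
Proof. exact: edge_path_path. Qed.

Lemma zero_edge0 N (s : span (zero_fgmod A) N) : req (epath (qedge s) 0) (rvertex K base).
Proof. by apply: req_trans (edge_path0 _ _) _; rewrite vert_qvertex; exact: req_refl. Qed.

Lemma zero_edge1 N (s : span (zero_fgmod A) N) :
  req (epath (qedge s) 1) (rvertex K (qvertex N : X 0)).
Proof. by apply: req_trans (edge_path1 _ _) _; rewrite vert_qvertex; exact: req_refl. Qed.

Lemma tree0 v : req (tree v 0) (rvertex K base).
Proof. exact: zero_edge0. Qed.

Lemma tree1 v : req (tree v 1) (rvertex K v).
Proof. rewrite [v in X in req _ X]qvertexE; exact: zero_edge1. Qed.

Lemma zero_edge_degenerate :
  qedge (zero_mono (zero_fgmod A)) = sact (@monotone_cst 1 0 ord0) base.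
Proof.
apply: all_linked_degenerate => i j.
wlog ij : i j / (i <= j)%N => [H|].
  by case: (leqP i j) => [|/ltnW ji]; [exact: H|exact/linked_sym/H].
have e (k : 'I_2) : zero_fgmod A = qobj (qedge (zero_mono (zero_fgmod A))) k.
  by have [->|->] := ord2E k.
apply: (linked_le (ei := e i) (ej := e j) (ij := ij)) => m m'.
rewrite (zero_fgmod_eq m m'); split=> // _.
have [i0|i1] := ord2E i; have [j0|j1] := ord2E j; subst i j => //.
rewrite (Prop_irrelevance (e ord0) erefl) (Prop_irrelevance (e ord_max) erefl) /=.
  by apply/zero_monoE; exact: zero_fgmod_eq.
Qed.

Lemma tree_base s : req (tree base s) (rvertex K base).
Proof.
rewrite /tree /= zero_edge_degenerate /edge_path /seg.
have [_ c1] := convex_simplex s (@vtx_simplex K 1 ord0) (@vtx_simplex K 1 ord_max).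
by apply: req_push; apply/rowP => j; rewrite [RHS]mxE mxE (ord1 j) -[RHS]c1; apply: eq_bigl.
Qed.

Definition good_span (M N : fgmod A) (s : span M N) : Prop :=
  good_edge psi tree (qedge s).

Lemma good_spanE M N (s : span M N) : good_span s <->
  heqv psi (pcat (tree (qvertex M)) (epath (qedge s))) (tree (qvertex N)).
Proof. by rewrite /good_span /good_edge !vert_qvertex. Qed.

Section Composition.
Variables (M N P : fgmod A) (s : span M N) (t : span N P) (u : span M P).
Hypothesis stu : forall x z, span_rel u x z <->
  exists y, span_rel s x y /\ span_rel t y z.

Let tri := face_qtriangle stu.

Lemma good_span_comp : good_span s -> good_span t -> good_span u.
Proof.
case: tri => e1 e2 e3; rewrite /good_span -e1 -e2 -e3.
exact: (good_comp psi_homotopic psi_concat tree_path tree0 tree1).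
Qed.

Lemma good_span_right : good_span s -> good_span u -> good_span t.
Proof.
case: tri => e1 e2 e3; rewrite /good_span -e1 -e2 -e3.
exact: (good_right psi_homotopic psi_concat tree_path tree0 tree1).
Qed.

End Composition.

Lemma good_span_eq M N (s t : span M N) :
  (forall a b, span_rel s a b <-> span_rel t a b) -> good_span s -> good_span t.
Proof. by move=> /qedge_eq st; rewrite /good_span st. Qed.

Lemma good_zero_mono M : good_span (zero_mono M).
Proof.
apply/good_spanE; set p := epath _.
have cp : ispath p by exact: edge_path_path.
have bp : req (p 0) (rvertex K base) by exact: zero_edge0.
have hb : based base (tree base) by split; [exact: tree_path|exact: tree0].
apply: (heqv_homotopic psi_homotopic psi_concat).
- apply: based_cat => //; exact: req_trans (tree_base _) (req_sym bp).
- exact: tree_path.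
- apply: homotopic_1cat => // s _; exact: req_trans (tree_base _) (req_sym bp).
Qed.

(** 0 >-> M >-> N composes to 0 >-> N, and the tree edges are good. *)
Lemma good_monos M N (f : {linear M -> N}) (fi : injective f) : good_span (monos fi).
Proof.
apply: (@good_span_right _ _ _ (zero_mono M) (monos fi) (zero_mono N));
  [|exact: good_zero_mono|exact: good_zero_mono].
move=> x z; split=> [/zero_monoE ->|[y [/zero_monoE -> /monosE ->]]].
  by exists 0; split; [exact/zero_monoE|apply/monosE; rewrite linear0].
by rewrite linear0; exact/zero_monoE.
Qed.

(** A span is its epimorphic part followed by its monomorphic part, and the latter is always
    good. *)
Lemma good_span_epi M N (s : span M N) : good_span (epis (@span_epiP _ _ _ s)) -> good_span s.
Proof.
move=> gq; apply: (good_span_comp _ gq (good_monos (@span_monoP _ _ _ s))) => x z.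
split=> [[p [<- <-]]|[p [/episE -> /monosE ->]]]; last by exists p.
by exists p; split; [exact/episE|exact/monosE].
Qed.

Lemma good_epis M P (q : {linear P -> M}) (qs : forall x, exists p, q p = x) :
  good_span (zero_epi M) -> good_span (zero_epi P) -> good_span (epis qs).
Proof.
apply: good_span_right => x z; split=> _; last exact: zero_epiE.
by exists (q z); split; [exact: zero_epiE|exact/episE].
Qed.

(** The span 0 <<- N >-> P factors in two ways: through N, which shows that it is good, and as 0 >->
    M followed by M <<- P, which then shows that the epimorphism is good. Precomposing the latter
    with the arrow 0 <<- M gives 0 <<- P. *)
Lemma good_zero_epi_exact N P M (k : {linear N -> P}) (q : {linear P -> M}) :
  injective k -> (forall x, exists p, q p = x) ->
  (forall p, q p = 0 <-> exists n, p = k n) ->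
  good_span (zero_epi N) -> good_span (zero_epi M) -> good_span (zero_epi P).
Proof.
move=> ki qs kq gN gM.
(* As a relation, [u] relates 0 exactly to the kernel of [q]. *)
pose u : span (zero_fgmod A) P := @Span A (zero_fgmod A) P N _ k (@null_surj _ N) ki.
have uE x z : span_rel u x z <-> q z = 0.
  rewrite kq; split=> [[n [_ <-]]|[n ->]]; first by exists n.
  by exists n; split=> //; exact: zero_fgmod_eq.
have gu : good_span u.
  apply: (good_span_comp _ gN (good_monos ki)) => x z; rewrite uE kq.
  split=> [[n ->]|[n [_ /monosE ->]]]; last by exists n.
  by exists n; split; [exact: zero_epiE|exact/monosE].
have gq : good_span (epis qs).
  apply: (good_span_right _ (good_zero_mono M) gu) => x z; rewrite uE.
  split=> [qz|[y [/zero_monoE -> /episE ->]]] //.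
  by exists 0; split; [exact/zero_monoE|exact/episE].
apply: (good_span_comp _ gM gq) => x z; split=> _; last exact: zero_epiE.
by exists (q z); split; [exact: zero_epiE|exact/episE].
Qed.

Lemma good_zero_epi0 : good_span (zero_epi (zero_fgmod A)).
Proof.
apply: good_span_eq (good_zero_mono _) => a b; rewrite zero_monoE.
by split=> _; [exact: zero_epiE|exact: zero_fgmod_eq].
Qed.

Lemma good_zero_epi_iso M N (f : {linear M -> N}) : injective f ->
  (forall y, exists x, f x = y) -> good_span (zero_epi M) -> good_span (zero_epi N).
Proof.
move=> fi fs gM; apply: (good_zero_epi_exact (k := f) (q := null_map N (zero_fgmod A))) => //.
- exact: null_surj.
- move=> p; split=> _; last exact: zero_fgmod_eq.
  by have [x <-] := fs p; exists x.
- exact: good_zero_epi0.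
Qed.

Lemma row_fgmodP n : @fin_gen A 'rV[A]_n (fun=> True).
Proof.
exists n, (fun i => delta_mx 0 i); split=> // x _; exists (fun i => x 0 i).
exact: row_sum_delta.
Qed.

Definition row_fgmod n : fgmod A := FGMod (row_fgmodP n).

(** Induction along the exact sequences from A^n to A^(1+n) to A. *)
Lemma good_row_fgmod n : good_span (zero_epi (row_fgmod 1)) ->
  good_span (zero_epi (row_fgmod n)).
Proof.
move=> g1; elim: n => [|n IH].
  rewrite (_ : row_fgmod 0 = zero_fgmod A); first exact: good_zero_epi0.
  by congr FGMod; exact: Prop_irrelevance.
have kl : linear (row_mx (0 : 'rV[A]_1) : 'rV[A]_n -> 'rV[A]_(1 + n)).
  by move=> a v w; rewrite scale_row_mx add_row_mx scaler0 addr0.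
pose kL := GRing.isLinear.Build A 'rV[A]_n 'rV[A]_(1 + n) *:%R _ kl.
pose k0 : {linear 'rV[A]_n -> 'rV[A]_(1 + n)} :=
  HB.pack (row_mx (0 : 'rV[A]_1) : 'rV[A]_n -> 'rV[A]_(1 + n)) kL.
pose k : {linear row_fgmod n -> row_fgmod n.+1} := k0.
have ki : injective k.
  by move=> v w /(congr1 (fun x : 'rV[A]_(1 + n) => rsubmx x)); rewrite /= !row_mxKr.
have ql : linear (@lsubmx A 1 1 n).
  by move=> a v w; apply/rowP => i; rewrite !mxE.
pose qL := GRing.isLinear.Build A 'rV[A]_(1 + n) 'rV[A]_1 *:%R _ ql.
pose q0 : {linear 'rV[A]_(1 + n) -> 'rV[A]_1} := HB.pack (@lsubmx A 1 1 n) qL.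
pose q : {linear row_fgmod n.+1 -> row_fgmod 1} := q0.
apply: (good_zero_epi_exact (k := k) (q := q)) => //.
- by move=> x; exists (row_mx x 0); exact: row_mxKl.
- move=> p; split=> [qp|[v ->]]; last exact: row_mxKl.
  by exists (rsubmx (p : 'rV[A]_(1 + n))); rewrite -[LHS](hsubmxK (p : 'rV[A]_(1 + n))) [lsubmx _]qp.
Qed.

Hypothesis A_div : forall a : A, a != 0 -> exists b, b * a = 1.

(* A generating family of minimal size is independent, since a nonzero
   coefficient in a relation is left invertible. *)
Lemma free_generators (M : fgmod A) : exists (n : nat) (f : {linear row_fgmod n -> M}),
  injective f /\ forall y, exists x, f x = y.
Proof.
pose gen n := exists v : 'I_n -> M, forall x, exists c : 'I_n -> A, x = \sum_(i < n) c i *: v i.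
have ex_gen : exists n, `[< gen n >].
  have [n [v [_ vP]]] := fgmodP M; exists n; apply/asboolP; exists v => x; exact: vP.
case: (ex_minnP ex_gen) => n /asboolP[v vP] nmin.
have fl : linear (fun x : 'rV[A]_n => \sum_(i < n) x 0 i *: v i).
  move=> a x y; rewrite scaler_sumr -big_split; apply: eq_bigr => i _.
  by rewrite !mxE scalerDl scalerA.
pose fL := GRing.isLinear.Build A 'rV[A]_n M *:%R _ fl.
pose f0 : {linear 'rV[A]_n -> M} := HB.pack (fun x : 'rV[A]_n => \sum_(i < n) x 0 i *: v i) fL.
pose f : {linear row_fgmod n -> M} := f0.
exists n, f; split; last first.
  move=> y; have [c ->] := vP y; exists (\row_i c i).
  by apply: eq_bigr => i _; rewrite mxE.
suff ker0 (x : 'rV[A]_n) : f x = 0 -> x = 0.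
  by move=> x y fxy; apply/subr0_eq/ker0; rewrite linearB fxy subrr.
move=> fx; apply/rowP => i0; rewrite mxE; apply/eqP/negPn/negP => /A_div[b bx].
have [m nE] : exists m, n = m.+1 by exists n.-1; case: n i0 {v vP nmin fl fL f0 f x fx bx} => // -[].
subst n; suff /asboolP/nmin : gen m by rewrite ltnn.
exists (fun j => v (lift i0 j)) => y; have [c ->] := vP y.
have v0 : v i0 = \sum_(j < m) (- (b * x 0 (lift i0 j))) *: v (lift i0 j).
  have : b *: f x = 0 by rewrite fx scaler0.
  rewrite /f /= (bigD1_ord i0) //= scalerDr scalerA bx scale1r scaler_sumr.
  move/eqP; rewrite addr_eq0 => /eqP ->; rewrite -sumrN; apply: eq_bigr => j _.
  by rewrite scalerA scaleNr.
exists (fun j => c (lift i0 j) - c i0 * (b * x 0 (lift i0 j))).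
rewrite (bigD1_ord i0) //= v0 scaler_sumr -big_split /=; apply: eq_bigr => j _.
by rewrite scalerA -scalerDl mulrN addrC.
Qed.

Lemma good_all_edges : good_span (zero_epi (row_fgmod 1)) -> forall y, good_edge psi tree y.
Proof.
move=> g1; have gz M : good_span (zero_epi M).
  have [n [f [fi fs]]] := free_generators M.
  exact: (good_zero_epi_iso fi fs (good_row_fgmod n g1)).
move=> y; have [s ys] := @qarr_span A 1 y ord0 ord_max isT.
rewrite (@qedge_eta A y s); last by move=> a b; rewrite ys.
by apply: good_span_epi; exact: good_epis.
Qed.

Lemma mod_loop_loop M : isloop base (mod_loop M).
Proof.
split; rewrite /mod_loop ?pcat0 ?pcat1 ?pinv1; try exact: zero_edge0.
apply: pcat_path; [exact: edge_path_path|exact/pinv_path/edge_path_path|].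
by rewrite pinv0; exact: req_trans (zero_edge1 _) (req_sym (zero_edge1 _)).
Qed.

Lemma loop_functional_good : good_span (zero_epi (row_fgmod 1)) ->
  forall f : sphere K 1 base, psi f = 0.
Proof.
move=> g1; have gall := good_all_edges g1.
move=> f; pose p (s : K) := f (const_mx s).
have fp (s : 'rV[K]_1) : f s = p (s 0 0).
  by congr (f _); apply/rowP => i; rewrite mxE (ord1 i).
have lp : isloop base p by exact: sphere_path.
rewrite (psi_loop_val psi_homotopic lp); last by move=> s _; rewrite fp; exact: req_refl.
apply: (loop_val_eq0 psi_homotopic psi_concat tree_path tree0 tree1) => //.
- by move=> s _; exact: tree_base.
- exact: qnerve_contraction.
Qed.

(** The loop is bounded by the tree edge and the other edge from 0 to the free module of rank one,
    so its vanishing says that this other edge is good; exact sequences and freeness spread this to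
    all edges. *)
Lemma loop_functional_eq0 : loop_val psi (mod_loop (row_fgmod 1)) = 0 ->
  forall f : sphere K 1 base, psi f = 0.
Proof.
move=> h; apply: loop_functional_good.
apply/good_spanE.
apply: (heqv_trans psi_homotopic psi_concat (b := epath (qedge (zero_epi (row_fgmod 1))))).
{ have e : req (tree base 1) (epath (qedge (zero_epi (row_fgmod 1))) 0).
    exact: req_trans (tree_base _) (req_sym (zero_edge0 _)).
  apply: (heqv_homotopic psi_homotopic psi_concat).
  - apply: based_cat; [by split; [exact: tree_path|exact: tree0]|exact: edge_path_path|exact: e].
  - exact: edge_path_path.
  - apply: homotopic_1cat; first exact: edge_path_path.
    by move=> s _; exact: req_trans (tree_base _) (req_sym (zero_edge0 _)). }
split; last exact: h.
- by split; [exact: edge_path_path|exact: zero_edge0].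
- by split; [exact: tree_path|exact: tree0].
- exact: req_trans (zero_edge1 _) (req_sym (zero_edge1 _)).
Qed.

End Generation.

(** Over the zero ring the free module of rank one is isomorphic to 0, and the edge in question is
    good there. *)
Lemma loop_functional_trivial (K : realType) (A : pzRingType) (V : zmodType)
    (psi : sphere K 1 (qvertex (zero_fgmod A)) -> V) :
  (forall f g, sph_homotopic f g -> psi f = psi g) ->
  (forall f g, psi (sph_concat f g) = psi f + psi g) ->
  (1 : A) = 0 -> forall f, psi f = 0.
Proof.
move=> ph pc A0; have a0 (a : A) : a = 0 by rewrite -[a]mulr1 A0 mulr0.
apply: (loop_functional_good ph pc); first by move=> a; rewrite (a0 a) eqxx.
apply: (good_zero_epi_iso ph pc (f := null_map (zero_fgmod A) (row_fgmod A 1))).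
- by move=> x y _; exact: zero_fgmod_eq.
- by move=> y; exists 0; apply/rowP => i; rewrite [LHS]a0 [RHS]a0.
- exact: good_zero_epi0.
Qed.

(** * Winding numbers *)

Section Winding.
Variable K : realType.
Implicit Types (phi F : K -> K) (a b c s : K).

(* Continuity modulo the integers. *)
Definition cmod (T : topologicalType) (D : set T) (phi : T -> K) : Prop :=
  forall x, D x -> forall e, 0 < e ->
    \forall y \near x, D y -> exists z : int, `|phi y - phi x - z%:~R| < e.

Definition ccont a b F : Prop :=
  forall x, a <= x <= b -> forall e, 0 < e ->
    \forall y \near x, a <= y <= b -> `|F y - F x| < e.

Definition lift phi a b F : Prop :=
  ccont a b F /\ forall s, a <= s <= b -> exists z : int, F s = phi s + z%:~R.

Definition winding phi (w : K) : Prop := exists2 F, lift phi 0 1 F & w = F 1 - F 0.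

Lemma int_small (z : int) : `|z%:~R : K| < 1 -> z = 0.
Proof. by rewrite -intr_norm -[1]/(1%:~R) ltr_int; lia. Qed.

Lemma ccontD a b F G : ccont a b F -> ccont a b G -> ccont a b (fun s => F s + G s).
Proof.
move=> cF cG x xab e e0; have e2 : 0 < e / 2 by rewrite divr_gt0.
have h1 := cF x xab _ e2; have h2 := cG x xab _ e2.
apply: filterS2 h1 h2 => y h1 h2 yab; have := h1 yab; have := h2 yab.
rewrite (_ : F y + G y - _ = (F y - F x) + (G y - G x)); last by ring.
by move=> ? ?; rewrite (le_lt_trans (ler_normD _ _)) // [e]splitr ltrD.
Qed.

Lemma ccontN a b F : ccont a b F -> ccont a b (fun s => - F s).
Proof.
move=> cF x xab e e0; apply: filterS (cF x xab e e0) => y h /h.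
by rewrite -opprD normrN.
Qed.

(** Where [F] varies by less than 1/4, two integers within 1/4 of its values differ by less than
    3/4, hence coincide; real induction propagates this along [0, 1]. *)
Lemma ccont_locally_int F : ccont 0 1 F ->
  (forall s, 0 <= s <= 1 -> exists z : int, `|F s - z%:~R| < 4^-1) ->
  exists z : int, forall s, 0 <= s <= 1 -> `|F s - z%:~R| < 4^-1.
Proof.
move=> cF Fz; have i0 : (0 : K) <= (0 : K) <= (1 : K) by rewrite lexx ler01.
pose near_int a b := forall z : int, `|F a - z%:~R| < 4^-1 -> `|F b - z%:~R| < 4^-1.
have step x : 0 <= x <= 1 -> exists2 e, 0 < e & forall a b, 0 <= a -> a <= b -> b <= 1 ->
    x - e < a -> b < x + e -> near_int a b.
  move=> x01; have [z hz] := Fz x x01.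
  have e4 : (0 : K) < 4^-1 by rewrite invr_gt0.
  have /nbhs_ballP[e /= e0 he] := cF x x01 _ e4.
  exists e => // a b a0 ab b1 xa bx; rewrite /near_int.
  have key y : 0 <= y <= 1 -> x - e < y -> y < x + e -> forall z' : int,
      `|F y - z'%:~R| < 4^-1 -> z' = z.
    move=> y01 h1 h2 z' hz'; have hy : `|F y - F x| < 4^-1.
      by apply: he => //; rewrite /ball /= ltr_norml; apply/andP; split; lra.
    apply/subr0_eq/int_small; rewrite intrB.
    move: hz hz' hy; rewrite !ltr_norml => /andP[? ?] /andP[? ?] /andP[? ?].
    by apply/andP; split; lra.
  move=> z' /key za; have [zb hb] := Fz b (introT andP (conj (le_trans a0 ab) b1)).
  rewrite za //; [|by apply/andP; split; lra|by lra].
  by rewrite -(key b _ _ _ zb) //; [apply/andP; split; lra|lra].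
have P c : 0 <= c <= 1 -> near_int 0 c.
  move=> /andP[c0 c1]; pose G s := F (c * s).
  have := @subdivision K (fun a b => near_int (c * a) (c * b)); rewrite mulr0 mulr1.
  apply=> [a b d _ _ _ _ h h' z /h /h' //|x /andP[x0 x1]].
  have [|e e0 he] := step (c * x); first by apply/andP; split; nra.
  exists e => // a b a0 ab b1 xa bx; apply: he; try nra.
have [z hz] := Fz 0 i0; exists z => s s01; exact: P.
Qed.

(** Two lifts differ by a continuous function with integer values, hence by a constant. *)
Lemma winding_unique phi w w' : winding phi w -> winding phi w' -> w = w'.
Proof.
move=> [F [cF Fz] ->] [G [cG Gz] ->].
have i0 : (0 : K) <= (0 : K) <= (1 : K) by rewrite lexx ler01.
have i1 : (0 : K) <= (1 : K) <= (1 : K) by rewrite lexx ler01.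
have FG s : 0 <= s <= 1 -> exists z : int, F s - G s = z%:~R.
  move=> s01; have [z ->] := Fz s s01; have [z' ->] := Gz s s01.
  by exists (z - z'); rewrite intrB; ring.
have [|s s01|z hz] := @ccont_locally_int (fun s => F s - G s).
  by apply: ccontD => //; exact: ccontN.
  by have [z ->] := FG s s01; exists z; rewrite subrr normr0 invr_gt0.
have E s : 0 <= s <= 1 -> F s - G s = z%:~R.
  move=> s01; have := hz s s01; have [z' ->] := FG s s01; rewrite -intrB => h.
  congr (_%:~R); apply/subr0_eq/int_small/(lt_trans h).
  by rewrite invf_lt1 ?ltr1n.
by have := E 0 i0; have := E 1 i1; lra.
Qed.

Lemma lift_glue phi a b c F G : a <= b -> b <= c -> lift phi a b F -> lift phi b c G ->
  exists H, lift phi a c H.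
Proof.
move=> ab bc [cF Fz] [cG Gz].
have [z zE] : exists z : int, F b = G b + z%:~R.
  have [|z ->] := Fz b; first by rewrite ab lexx.
  have [|z' ->] := Gz b; first by rewrite bc lexx.
  by exists (z - z'); rewrite intrB; ring.
exists (fun s => if s <= b then F s else G s + z%:~R); split; last first.
  move=> s /andP[sa sc]; case: leP => sb; first by apply: Fz; rewrite sa.
  by have [|z' ->] := Gz s; [rewrite sc ltW|exists (z' + z); rewrite intrD addrA].
move=> x /andP[xa xc] e e0.
have nF : x <= b -> \forall y \near x, a <= y <= b -> `|F y - F x| < e.
  by move=> xb; apply: cF => //; rewrite xa.
have nG : b <= x -> \forall y \near x, b <= y <= c -> `|G y - G x| < e.
  by move=> bx; apply: cG => //; rewrite bx.
case: (ltgtP x b) => xb.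
- have nlt : \forall y \near x, y < b by exact: lt_nbhsl.
  apply: filterS2 nlt (nF (ltW xb)) => y yb h /andP[ya yc].
  by rewrite ltW //; apply: h; rewrite ya ltW.
- have nlt : \forall y \near x, b < y by exact: lt_nbhsr.
  apply: filterS2 nlt (nG (ltW xb)) => y yb h /andP[ya yc].
  rewrite leNgt yb /= opprD addrACA subrr addr0; apply: h.
  by rewrite yc ltW.
- subst x; apply: filterS2 (nF (lexx _)) (nG (lexx _)) => y hF hG /andP[ya yc].
  rewrite ?lexx; case: (leP y _) => yb; first by apply: hF; rewrite ya.
  by rewrite zE opprD addrACA subrr addr0; apply: hG; rewrite yc ltW.
Qed.

(** Near [x], subtract from [phi] the integer that brings it within 1/4 of [phi x]; the local lifts
    are glued by real induction. *)
Lemma winding_exists phi : cmod (@unit_itv K) phi -> exists w, winding phi w.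
Proof.
move=> cphi; suff [F lF] : exists F, lift phi 0 1 F by exists (F 1 - F 0), F.
apply: (@subdivision K (fun a b => exists F, lift phi a b F)).
  by move=> a b c _ ab bc _ [F lF] [G lG]; exact: lift_glue lF lG.
move=> x x01; have e4 : (0 : K) < 4^-1 by rewrite invr_gt0.
have /nbhs_ballP[e /= e0 he] := cphi x x01 _ e4.
exists e => // a b a0 ab b1 xa bx.
have hz s : exists z : int, a <= s <= b -> `|phi s - phi x - z%:~R| < 4^-1.
  have [sab|nsab] := boolP (a <= s <= b); last by exists 0.
  have /andP[sa sb] := sab.
  have [||z hz] := he s; last by exists z.
    by rewrite /ball /= ltr_norml; apply/andP; split; lra.
  by apply/andP; split; lra.
pose z s := sval (cid (hz s)); have zP s : a <= s <= b -> `|phi s - phi x - (z s)%:~R| < 4^-1.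
  exact: svalP (cid (hz s)).
exists (fun s => phi s - (z s)%:~R); split; last by move=> s _; exists (- z s); rewrite intrN.
move=> y yab d d0; have /andP[ya yb] := yab.
have m0 : 0 < Num.min d 4^-1 by rewrite lt_min d0.
have y01 : 0 <= y <= 1 by apply/andP; split; lra.
apply: filterS (cphi y y01 _ m0) => r hr rab; have /andP[ra rb] := rab.
have [|k] := hr; first by apply/andP; split; lra.
rewrite lt_min => /andP[hd h4]; have hy := zP y yab; have hr' := zP r rab.
(* The integer absorbing the jump of [phi] from [y] to [r] is the difference of the chosen
   corrections: three errors below 1/4 leave an integer of absolute value below 1. *)
suff kE : k = z r - z y.
  by move: hd; rewrite kE intrB; congr (`| _ | < _); ring.
apply/subr0_eq/int_small; rewrite !intrB.
move: h4 hy hr'; rewrite !ltr_norml => /andP[? ?] /andP[? ?] /andP[? ?].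
by apply/andP; split; lra.
Qed.

(** The difference of the two lifts stays within 1/4 of one fixed integer, and at both ends it is an
    integer, hence that one. *)
Lemma winding_close phi phi' w w' : winding phi w -> winding phi' w' ->
  (forall s, 0 <= s <= 1 -> exists z : int, `|phi s - phi' s - z%:~R| < 4^-1) ->
  (exists z : int, phi 0 - phi' 0 = z%:~R) ->
  (exists z : int, phi 1 - phi' 1 = z%:~R) -> w = w'.
Proof.
move=> [F [cF Fz] ->] [G [cG Gz] ->] hz [z0 e0] [z1 e1].
have i0 : (0 : K) <= (0 : K) <= (1 : K) by rewrite lexx ler01.
have i1 : (0 : K) <= (1 : K) <= (1 : K) by rewrite lexx ler01.
have [|s s01|z h] := @ccont_locally_int (fun s => F s - G s).
  by apply: ccontD => //; exact: ccontN.
  have [k kE] := hz s s01; have [m ->] := Fz s s01; have [m' ->] := Gz s s01.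
  exists (k + m - m'); rewrite intrB intrD.
  by move: kE; congr (`| _ | < _); ring.
have E s (k : int) : 0 <= s <= 1 -> phi s - phi' s = k%:~R -> F s - G s = z%:~R.
  move=> s01 kE; have := h s s01; have [m ->] := Fz s s01; have [m' ->] := Gz s s01.
  rewrite (_ : phi s + m%:~R - (phi' s + m'%:~R) = (k + m - m')%:~R); last first.
    by rewrite intrB intrD -kE; ring.
  rewrite -intrB => h'; congr (_%:~R); apply/subr0_eq/int_small/(lt_trans h').
  by rewrite invf_lt1 ?ltr1n.
by have := E 0 _ i0 e0; have := E 1 _ i1 e1; lra.
Qed.

(** Neighbouring slices of the homotopy are uniformly close mod 1, so [winding_close] makes the
    winding number locally constant in [u]. *)
Lemma winding_homotopic (Phi : K * K -> K) w w' :
  cmod (@square K) Phi ->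
  (forall u, 0 <= u <= 1 -> exists z : int, Phi (u, 0) - Phi (0, 0) = z%:~R) ->
  (forall u, 0 <= u <= 1 -> exists z : int, Phi (u, 1) - Phi (0, 1) = z%:~R) ->
  winding (fun s => Phi (0, s)) w -> winding (fun s => Phi (1, s)) w' -> w = w'.
Proof.
move=> cPhi P0 P1; pose same a b := forall w w',
  winding (fun s => Phi (a, s)) w -> winding (fun s => Phi (b, s)) w' -> w = w'.
have wex (u : K) : 0 <= u <= 1 -> exists w, winding (fun s => Phi (u, s)) w.
  move=> u01; apply: winding_exists => s s01 e e0.
  have cs : continuous (fun s : K => (u, s)).
    by apply: continuous_pair => ?; [exact: cvg_cst|exact: cvg_id].
  have H : \forall y \near s, square (u, y) ->
      exists z : int, `|Phi (u, y) - Phi (u, s) - z%:~R| < e.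
    exact: (cs s _ (cPhi (u, s) (conj u01 s01) e e0)).
  by apply: filterS H => y h y01; apply: h.
apply: (@subdivision K same).
  move=> a b c a0 ab bc c1 hab hbc v v' wa wc.
  have [|vb wb] := wex b; first by rewrite (le_trans a0) ?(le_trans bc).
  by rewrite (hab _ _ wa wb) (hbc _ _ wb wc).
move=> x x01; have e4 : (0 : K) < 4^-1 by rewrite invr_gt0.
have e8 : (0 : K) < 8^-1 by rewrite invr_gt0.
(* Compactness in [s] gives the uniformity. Both (a, s') and (x, s') are compared with (x, s),
   whence 1/8 twice. *)
have near_x : \forall a \near x, `[0, 1]%classic `<=`
    (fun s => 0 <= s <= 1 -> 0 <= a <= 1 -> exists z : int, `|Phi (a, s) - Phi (x, s) - z%:~R| < 4^-1).
  have /compact_near_coveringP cn := @segment_compact K 0 1.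
  apply: (cn _ (nbhs x) (fun a s => 0 <= s <= 1 -> 0 <= a <= 1 ->
    exists z : int, `|Phi (a, s) - Phi (x, s) - z%:~R| < 4^-1)) => s /=.
  rewrite in_itv /= => s01.
  have [[N M] /= [nN nM] NM] := cPhi (x, s) (conj x01 s01) _ e8.
  exists (M, N) => // -[s' a] /= [Ms' Na].
  have Nx := nbhs_singleton nN.
  move=> /= s'01 a01; have [|z1 h1] := NM (a, s') (conj Na Ms'); first by split.
  have [|z2 h2] := NM (x, s') (conj Nx Ms'); first by split.
  exists (z1 - z2); rewrite intrB; move: h1 h2; rewrite !ltr_norml.
  by move=> /andP[? ?] /andP[? ?]; apply/andP; split; lra.
have /nbhs_ballP[e /= e0 he] := near_x.
exists e => // a b a0 ab b1 xa bx v v' va vb.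
have [vx wx] := wex x x01.
have cl c y : 0 <= c <= 1 -> x - e < c -> c < x + e -> winding (fun s => Phi (c, s)) y -> y = vx.
{ move=> c01 xc cx wy; apply: (winding_close wy wx).
  - move=> s s01; have bc : ball x e c by rewrite /ball /= ltr_norml; apply/andP; split; lra.
    by apply: (he c bc) => //=; rewrite in_itv.
  - have [z1 h1] := P0 c c01; have [z2 h2] := P0 x x01.
    by exists (z1 - z2); rewrite intrB -h1 -h2; ring.
  - have [z1 h1] := P1 c c01; have [z2 h2] := P1 x x01.
    by exists (z1 - z2); rewrite intrB -h1 -h2; ring.
}
have a01 : 0 <= a <= 1 by rewrite a0 (le_trans ab).
have b01 : 0 <= b <= 1 by rewrite b1 (le_trans a0).
have xb : x - e < b by exact: lt_le_trans xa ab.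
have ax : a < x + e by exact: le_lt_trans ab bx.
by rewrite (cl a v a01 xa ax va) (cl b v' b01 xb bx vb).
Qed.

(** A lift of the concatenation gives lifts of both parts, by rescaling its two halves. *)
Lemma winding_cat phi phi' chi w w' v : winding phi w -> winding phi' w' ->
  winding chi v ->
  (forall s, 0 <= s <= 1 -> s <= 2^-1 -> exists z : int, chi s - phi (2 * s) = z%:~R) ->
  (forall s, 0 <= s <= 1 -> 2^-1 <= s -> exists z : int, chi s - phi' (2 * s - 1) = z%:~R) ->
  v = w + w'.
Proof.
move=> wphi wphi' [H [cH Hz] ->] h1 h2.
have aff (a b : K) : (forall s, 0 <= s <= 1 -> 0 <= a * s + b <= 1) ->
    ccont 0 1 (fun s => H (a * s + b)).
  move=> ab x x01 e e0.
  have ca : {for x, continuous (fun s : K => a * s + b)} by exact: cont_affine.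
  have h : \forall y \near x, 0 <= a * y + b <= 1 -> `|H (a * y + b) - H (a * x + b)| < e.
    exact: (ca _ (cH _ (ab x x01) e e0)).
  by apply: filterS h => y h y01; apply: h; exact: ab.
have ->: w = H (2^-1) - H 0.
  apply: (winding_unique wphi); exists (fun s => H (2^-1 * s + 0)); last first.
    by rewrite mulr1 mulr0 !addr0.
  have i01 s : 0 <= s <= 1 -> 0 <= 2^-1 * s + 0 <= 1.
    by move=> /andP[? ?]; apply/andP; split; lra.
  split=> [|s s01]; first exact: aff.
  have [z hz] := Hz _ (i01 s s01); have [|z' hz'] := h1 _ (i01 s s01).
    by move: s01 => /andP[? ?]; lra.
  exists (z + z'); rewrite hz intrD -hz'.
  rewrite (_ : 2 * (2^-1 * s + 0) = s); first by ring.
  by field.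
have ->: w' = H 1 - H (2^-1).
  apply: (winding_unique wphi'); exists (fun s => H (2^-1 * s + 2^-1)); last first.
    by congr (H _ - H _); field.
  have i01 s : 0 <= s <= 1 -> 0 <= 2^-1 * s + 2^-1 <= 1.
    by move=> /andP[? ?]; apply/andP; split; lra.
  split=> [|s s01]; first exact: aff.
  have [z hz] := Hz _ (i01 s s01); have [|z' hz'] := h2 _ (i01 s s01).
    by move: s01 => /andP[? ?]; lra.
  exists (z + z'); rewrite hz intrD -hz'.
  rewrite (_ : 2 * (2^-1 * s + 2^-1) - 1 = s); first by ring.
  by field.
by ring.
Qed.

Lemma winding_mod phi phi' w : winding phi w ->
  (forall s, 0 <= s <= 1 -> exists z : int, phi s - phi' s = z%:~R) ->
  winding phi' w.
Proof.
move=> [F [cF Fz] ->] h; exists F => //; split=> // s s01.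
have [z ->] := Fz s s01; have [z' hz'] := h s s01.
by exists (z + z'); rewrite intrD -hz'; ring.
Qed.

Lemma winding_cont phi : continuous phi -> winding phi (phi 1 - phi 0).
Proof.
move=> cphi; exists phi => //; split=> [x _ e e0|s _]; last by exists 0; rewrite addr0.
have /cvgrPdist_lt/(_ e e0) := cphi x.
by apply: filterS => y h _; rewrite distrC.
Qed.

End Winding.

(** * Maps from the realization to the circle and their winding numbers *)

Section CircleFunctions.
Variables (K : realType) (X : sset) (x0 : X 0).
Local Notation point := (rpoint K X).
Variable theta : point -> K.
Hypothesis theta_req : forall p q, req p q -> exists z : int, theta p - theta q = z%:~R.
Hypothesis theta_cont : forall n (x : X n), exists2 g : 'rV[K]_n.+1 -> K,
  continuous g & forall t (ht : std_simplex t), theta (RPoint x ht) = g t.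

Lemma theta_open (c e : K) : ropen (fun p => exists z : int, `|theta p - c - z%:~R| < e).
Proof.
split=> [p q /theta_req[z hz] [k hk]|n x].
  exists (k - z); rewrite intrB -hz; move: hk; congr (`|_| < _); ring.
have [g cg gE] := theta_cont x.
apply/open_subspaceP.
exists (\bigcup_(z in [set: int]) [set t | `|g t - c - z%:~R| < e]).
  apply: bigcup_open => z _.
  have cz : continuous (fun t => `|g t - c - z%:~R|).
    have c1 : continuous (fun t => g t - c - z%:~R).
      apply: continuous_subr; last exact: cst_continuous.
      by apply: continuous_subr; [exact: cg|exact: cst_continuous].
    by move=> t; exact: (cvg_norm (c1 t)).
  apply: (open_comp (D := [set s : K | s < e])); last exact: open_lt.
  by move=> t _; exact: cz.
apply/seteqP; split=> t [Ht ht]; split=> //.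
  by have [z _ hz] := Ht; exists ht; exists z; rewrite gE.
by have [ht' [z hz]] := Ht; exists z => //=; rewrite -gE.
Qed.

Lemma theta_cmod (T : topologicalType) (D : set T) (f : T -> point) :
  rcontinuous D f -> cmod D (theta \o f).
Proof.
move=> /rcontinuous_near cf x Dx e e0.
have := cf _ (theta_open (theta (f x)) e) x Dx; apply.
by exists 0; rewrite !subrr normr0.
Qed.

(** The default 0 is never met, since [loop_windingP] provides a winding number. *)
Definition loop_winding (f : sphere K 1 x0) : K :=
  xget 0 [set w | winding (fun s => theta (f (const_mx s))) w].

Lemma loop_windingP (f : sphere K 1 x0) :
  winding (fun s => theta (f (const_mx s))) (loop_winding f).
Proof.
have [cp _ _] := sphere_path f.
by apply: xgetPex; apply: winding_exists; exact: theta_cmod cp.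
Qed.

Lemma loop_winding_homotopic (f g : sphere K 1 x0) : sph_homotopic f g ->
  loop_winding f = loop_winding g.
Proof.
move=> /sph_homotopicP[H [cH H0 H1 He]].
have i0 : (0 : K) <= (0 : K) <= (1 : K) by rewrite lexx ler01.
apply: (winding_homotopic (theta_cmod cH)).
- move=> u u01; apply: theta_req.
  exact: req_trans (He u u01).1 (req_sym (He 0 i0).1).
- move=> u u01; apply: theta_req.
  exact: req_trans (He u u01).2 (req_sym (He 0 i0).2).
- apply: winding_mod (loop_windingP f) _ => s s01; apply/theta_req/req_sym; exact: H0.
- apply: winding_mod (loop_windingP g) _ => s s01; apply/theta_req/req_sym; exact: H1.
Qed.

Lemma loop_winding_concat (f g : sphere K 1 x0) :
  loop_winding (sph_concat f g) = loop_winding f + loop_winding g.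
Proof.
have dE (c s : K) : dilate c (const_mx s) = const_mx (2 * s - c) :> 'rV[K]_1.
  by apply/rowP => i; rewrite !mxE (ord1 i) eqxx.
apply: (winding_cat (loop_windingP f) (loop_windingP g) (loop_windingP _)) => s s01 s2.
  apply: theta_req; rewrite /= /sph_concat_fun mxE s2 dE subr0; exact: req_refl.
apply: theta_req; rewrite /= /sph_concat_fun mxE !dE; case: ifP => s2'; last exact: req_refl.
have sE : s = 2^-1 by apply/le_anti/andP.
have [_ _ f1] := sphere_path f; have [_ g0 _] := sphere_path g.
rewrite sE subr0 mulfV ?pnatr_eq0 // subrr.
exact: req_trans f1 (req_sym g0).
Qed.

End CircleFunctions.

(** * Additive invariants of finite modules *)

(** Cardinality for subsets of a mere [choiceType]; infinite subsets get 0. *)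
Definition card_pred (T : choiceType) (P : T -> Prop) : nat :=
  xget 0%N [set n | exists s : seq T, [/\ uniq s, size s = n & forall x, x \in s <-> P x]].

Lemma card_predE (T : choiceType) (P : T -> Prop) (s : seq T) : uniq s ->
  (forall x, x \in s <-> P x) -> card_pred P = size s.
Proof.
move=> us sP; rewrite /card_pred; case: xgetP => [n _ [s' [us' <- s'P]]|/(_ (size s))[]].
  apply/perm_size/uniq_perm => // x; apply/idP/idP => [/s'P/sP|/sP/s'P] //.
by exists s.
Qed.

Definition finite_pred (T : choiceType) (P : T -> Prop) : Prop :=
  exists s : seq T, forall x, P x -> x \in s.

Lemma finite_predE (T : choiceType) (P : T -> Prop) : finite_pred P ->
  exists s : seq T, uniq s /\ forall x, x \in s <-> P x.
Proof.
move=> [s sP]; exists (undup [seq x <- s | `[< P x >]]); split; first exact: undup_uniq.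
move=> x; rewrite mem_undup mem_filter; split=> [/andP[/asboolP]|Px] //.
by rewrite sP // andbT; exact/asboolP.
Qed.

Lemma card_pred_gt0 (T : choiceType) (P : T -> Prop) x : finite_pred P -> P x ->
  (0 < card_pred P)%N.
Proof.
move=> /finite_predE[s [us sP]] /sP xs; rewrite (card_predE us sP).
by case: s xs {us sP}.
Qed.

Lemma card_pred_mul (T U W : choiceType) (P : T -> Prop) (Q : U -> Prop)
    (R : W -> Prop) (f : T -> U -> W) : finite_pred P -> finite_pred Q ->
  (forall t t' u u', P t -> P t' -> Q u -> Q u' -> f t u = f t' u' -> t = t' /\ u = u') ->
  (forall w, R w <-> exists t u, [/\ P t, Q u & w = f t u]) ->
  card_pred R = (card_pred P * card_pred Q)%N.
Proof.
move=> /finite_predE[s [us sP]] /finite_predE[s' [us' sQ]] fi RE.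
rewrite (card_predE us sP) (card_predE us' sQ) -(size_allpairs f s s').
apply: card_predE.
  apply: allpairs_uniq => // -[t u] [t' u'] /=.
  case/allpairsP => -[a b] [/= /sP Pa /sQ Qb [-> ->]].
  case/allpairsP => -[c d] [/= /sP Pc /sQ Qd [-> ->]] e.
  by have [-> ->] := fi _ _ _ _ Pa Pc Qb Qd e.
move=> w; rewrite RE; split=> [/allpairsP[[a b] [/= /sP ? /sQ ? ->]]|[t [u [/sP ? /sQ ? ->]]]].
  by exists a, b.
by apply/allpairsP; exists (t, u).
Qed.

Section EulerFunction.
Variables (A : pzRingType) (enumA : seq A).
Hypothesis enumAP : forall a : A, a \in enumA.
Variable e : A.
Hypothesis ee : e * e = e.
Implicit Types M N P : fgmod A.

Lemma fgmod_finite M (P : M -> Prop) : finite_pred P.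
Proof.
have [n [v [_ vP]]] := fgmodP M.
pose J := seq_sub enumA; pose g (c : {ffun 'I_n -> J}) : M := \sum_(i < n) ssval (c i) *: v i.
exists [seq g c | c <- enum {ffun 'I_n -> J}] => x _.
have [c ->] := vP x I; apply/mapP.
exists [ffun i => SeqSub (enumAP (c i))]; first by rewrite mem_enum.
by apply: eq_bigr => i _; rewrite ffunE.
Qed.

(** [logn 3] is a valuation, so it turns the product formula for the counts into a sum. *)
Definition euler M N (r : M -> N -> Prop) : nat :=
  logn 3 (card_pred (fun y : N => e *: y = y /\ r 0 y)).

Section SpanRelations.
Variables (M N : fgmod A) (s : span M N).

Lemma span_relP a x y x' y' : span_rel s x y -> span_rel s x' y' ->
  span_rel s (a *: x + x') (a *: y + y').
Proof. by move=> [p [<- <-]] [q [<- <-]]; exists (a *: p + q); rewrite !linearP. Qed.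

Lemma span_relZ a x y : span_rel s x y -> span_rel s (a *: x) (a *: y).
Proof. by move=> [p [<- <-]]; exists (a *: p); rewrite !linearZ. Qed.

Lemma span_rel_fun x x' y : span_rel s x y -> span_rel s x' y -> x = x'.
Proof. by move=> [p [<- <-]] [q [<- /span_monoP ->]]. Qed.

Lemma span_rel_total x : exists y, span_rel s x y.
Proof. by have [p <-] := span_epiP s x; exists (span_mono s p), p. Qed.

Lemma span_rel0 : span_rel s 0 0.
Proof. by exists 0; rewrite !linear0. Qed.

End SpanRelations.

(** An element [z] determines the middle element [y] to which it is related under [t], and the fixed
    [z] over a given fixed [y] form a coset of the fixed elements related to 0 under [t]. So the
    count for the composite is a product. *)
Lemma euler_comp M N P (s : span M N) (t : span N P) (u : M -> P -> Prop) :
  (forall x z, u x z <-> exists y, span_rel s x y /\ span_rel t y z) ->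
  euler u = (euler (span_rel s) + euler (span_rel t))%N.
Proof.
have pos (L L' : fgmod A) (v : span L L') :
    (0 < card_pred (fun y : L' => e *: y = y /\ span_rel v 0 y))%N.
  apply: (card_pred_gt0 (x := 0)); first exact: fgmod_finite.
  by split; [exact: scaler0|exact: span_rel0].
move=> uE; rewrite /euler -lognM //.
congr (logn 3 _).
(* Multiplying an arbitrary element related to [y] by [e] makes it fixed, and keeps it related to
   [y] when [y] is fixed. *)
pose l y : P := e *: sval (cid (span_rel_total t y)).
have lP y : e *: y = y -> span_rel t y (l y).
  by move=> ey; rewrite /l -{1}ey; apply: span_relZ; exact: svalP (cid (span_rel_total t y)).
have el y : e *: l y = l y by rewrite /l scalerA ee.
have lk y k : e *: y = y -> span_rel t 0 k -> span_rel t y (l y + k).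
  by move=> ey hk; have := span_relP 1 (lP y ey) hk; rewrite !scale1r addr0.
apply: (@card_pred_mul _ _ _ _ _ _ (fun y k => l y + k)); try exact: fgmod_finite.
  move=> y y' k k' [ey sy] [ey' sy'] [ek tk] [ek' tk'] E.
  have yy : y = y' by apply: (span_rel_fun (lk y k ey tk)); rewrite E; exact: lk.
  by split=> //; move: E; rewrite yy => /addrI.
move=> z; split=> [[ez /uE[y [sy tz]]]|[y [k [[ey sy] [ek tk] ->]]]].
  have ey : e *: y = y.
    by apply: (span_rel_fun _ tz); rewrite -[z]ez; exact: span_relZ.
  have tk : span_rel t 0 (z - l y).
    by have := span_relP (-1) (lP y ey) tz; rewrite !scaleN1r addNr addrC.
  by exists y, (z - l y); split=> //; [split=> //; rewrite scalerBr ez el|rewrite addrC subrK].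
split; first by rewrite scalerDr el ek.
by apply/uE; exists y; split=> //; exact: lk.
Qed.

Lemma euler_id M (r : M -> M -> Prop) : (forall x y, r x y <-> x = y) -> euler r = 0%N.
Proof.
move=> rE; rewrite /euler (@card_predE _ _ [:: 0 : M]) //= => x.
rewrite inE; split=> [/eqP ->|[_ /rE <-]] //; split; [exact: scaler0|exact/rE].
Qed.

Definition euler_mod M : nat := logn 3 (card_pred (fun y : M => e *: y = y)).

Lemma euler_zero_epi M : euler (span_rel (zero_epi M)) = euler_mod M.
Proof.
congr (logn 3 (card_pred _)); apply/funext => y; apply/propext.
by split=> [[]|h] //; split=> //; exact: zero_epiE.
Qed.

Lemma euler_zero_mono M : euler (span_rel (zero_mono M)) = 0%N.
Proof.
rewrite /euler (@card_predE _ _ [:: 0 : M]) //= => x.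
rewrite inE; split=> [/eqP ->|[_ /zero_monoE ->]] //.
by split; [exact: scaler0|exact/zero_monoE].
Qed.

Section Theta.
Variable K : realType.
Local Notation X := (qnerve A).

Definition arrow_euler n (x : X n) (i j : 'I_n.+1) (ij : (i <= j)%N) : nat :=
  euler (@qarr A n x i j ij).

Lemma arrow_euler_comp n (x : X n) (i j k : 'I_n.+1) (ij : (i <= j)%N)
    (jk : (j <= k)%N) (ik : (i <= k)%N) :
  arrow_euler x ik = (arrow_euler x ij + arrow_euler x jk)%N.
Proof.
have [s se] := @qarr_span A n x i j ij; have [t te] := @qarr_span A n x j k jk.
rewrite /arrow_euler se te; apply: euler_comp => a c.
by rewrite (qarr_comp ij jk ik) se te.
Qed.

Definition arrow_euler0 n (x : X n) (i : 'I_n.+1) : nat :=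
  @arrow_euler n x ord0 i (leq0n i).

Lemma arrow_euler0_le n (x : X n) (i j : 'I_n.+1) (ij : (i <= j)%N) :
  arrow_euler0 x j = (arrow_euler0 x i + arrow_euler x ij)%N.
Proof. exact: arrow_euler_comp. Qed.

(** Affine interpolation of the additive invariant, normalized to vanish at the first vertex of the
    simplex. *)
Definition theta (p : rpoint K X) : K :=
  match p with
  | RPoint n x t _ => \sum_i t 0 i * (arrow_euler0 x i)%:R
  end.

(** Changing the first vertex changes the normalization by the integer [c], the invariant of the
    arrow between the two first vertices. *)
Lemma theta_rglue p q : rglue p q -> exists z : int, theta p - theta q = z%:~R.
Proof.
case=> m n th hth x t [t0 t1] /=; set c := arrow_euler0 x (th ord0).
exists (- c%:Z); have E i : arrow_euler0 x (th i) = (c + arrow_euler0 (sact hth x : X m) i)%N.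
  exact: (arrow_euler0_le x (hth ord0 i (leq0n i))).
have -> : \sum_j push th t 0 j * (arrow_euler0 x j)%:R =
    \sum_i t 0 i * (arrow_euler0 x (th i))%:R.
  rewrite [RHS](partition_big th xpredT) //=; apply: eq_bigr => j _.
  by rewrite mxE mulr_suml; apply: eq_bigr => i /eqP <-.
rewrite -sumrB (eq_bigr (fun i => - (t 0 i * c%:R))); last first.
  by move=> i _; rewrite E natrD; ring.
by rewrite sumrN -mulr_suml t1 mul1r intrN.
Qed.

Lemma theta_req p q : req p q -> exists z : int, theta p - theta q = z%:~R.
Proof.
elim=> {p q} [p q /theta_rglue //|p|p q _ [z zE]|p q r _ [z zE] _ [z' zE']].
- by exists 0; rewrite subrr.
- by exists (- z); rewrite intrN -zE opprB.
- by exists (z + z'); rewrite intrD -zE -zE'; ring.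
Qed.

Lemma theta_cont n (x : X n) : exists2 g : 'rV[K]_n.+1 -> K,
  continuous g & forall t (ht : std_simplex t), theta (RPoint x ht) = g t.
Proof.
exists (fun t => \sum_i t 0 i * (arrow_euler0 x i)%:R) => //.
apply: cont_sum => i; apply: continuous_mulr; last exact: cst_continuous.
by move=> t; exact: coord_continuous.
Qed.

Lemma theta_edge_path M N (s : span M N) (u : K) : 0 <= u <= 1 ->
  theta (edge_path (qedge s) u) = u * (euler (span_rel s))%:R.
Proof.
move=> u01; rewrite /edge_path /seg /= !big_ord_recl big_ord0 addr0 !mxE /= clamp_id //.
rewrite !mulr0 !mulr1 add0r addr0 (_ : arrow_euler0 _ ord0 = 0%N); last first.
  by apply: euler_id => x y; rewrite qarr_id.
rewrite mulr0 add0r; congr (_ * _%:R).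
Qed.

Definition chi_winding (f : sphere K 1 (qvertex (zero_fgmod A) : X 0)) : K :=
  loop_winding theta f.

Lemma chi_winding_homotopic f g : sph_homotopic f g -> chi_winding f = chi_winding g.
Proof. exact: loop_winding_homotopic theta_req theta_cont _ _. Qed.

Lemma chi_winding_concat f g : chi_winding (sph_concat f g) = chi_winding f + chi_winding g.
Proof. exact: loop_winding_concat theta_req theta_cont _ _. Qed.

(** Along the first edge [theta] climbs linearly from 0 to [euler_mod]; along the second, traversed
    backwards, it is 0. *)
Lemma chi_winding_mod_loop M (lp : isloop (qvertex (zero_fgmod A) : X 0) (@mod_loop K A M)) :
  chi_winding (loop_sphere lp) = (euler_mod M)%:R.
Proof.
have wl := loop_windingP theta_req theta_cont (loop_sphere lp).
have w1 : winding (fun s : K => s * (euler_mod M)%:R) (euler_mod M)%:R.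
  have cw : continuous (fun s : K => s * (euler_mod M)%:R).
    by apply: continuous_mulr => ?; [exact: cvg_id|exact: cvg_cst].
  by have := winding_cont cw; rewrite mul1r mul0r subr0.
have w2 : winding (fun _ : K => 0) 0.
  have cw : continuous (fun _ : K => 0 : K) by move=> ?; exact: cvg_cst.
  by have := winding_cont cw; rewrite subrr.
rewrite /chi_winding (winding_cat w1 w2 wl) ?addr0 // => s /andP[s0 s1] s2.
  exists 0; rewrite /loop_sphere /= mxE /mod_loop /pcat s2 theta_edge_path.
    by rewrite euler_zero_epi subrr.
  by apply/andP; split; lra.
rewrite /loop_sphere /= mxE /mod_loop /pcat; case: ifP => s2'.
  have sE : s = 2^-1 by apply/le_anti; rewrite s2' s2.
  exists (euler_mod M)%:Z; rewrite sE mulfV ?pnatr_eq0 // theta_edge_path.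
    by rewrite euler_zero_epi mul1r subr0.
  by rewrite ler01 lexx.
exists 0; rewrite /pinv theta_edge_path; first by rewrite euler_zero_mono mulr0 subrr.
by apply/andP; split; lra.
Qed.

End Theta.
End EulerFunction.

(** * Loops in a product *)

Section SphereGroup.
Variables (K : realType) (X : sset) (x0 : X 0).
Implicit Types f g h : sphere K 1 x0.

Lemma sph_homotopic_refl f : sph_homotopic f f.
Proof. by apply/sph_homotopicP/homotopic_refl; have [] := sphere_path f. Qed.

Lemma sph_homotopic_sym f g : sph_homotopic f g -> sph_homotopic g f.
Proof. by move=> /sph_homotopicP h; apply/sph_homotopicP/homotopic_sym. Qed.

Lemma sph_homotopic_trans f g h :
  sph_homotopic f g -> sph_homotopic g h -> sph_homotopic f h.
Proof.
move=> /sph_homotopicP fg /sph_homotopicP gh; apply/sph_homotopicP.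
exact: homotopic_trans fg gh.
Qed.

Lemma sph_concat_path f g (s : K) : sph_concat f g (const_mx s) =
  pcat (fun s : K => f (const_mx s)) (fun s : K => g (const_mx s)) s.
Proof.
have dE (c : K) : dilate c (const_mx s) = const_mx (2 * s - c) :> 'rV[K]_1.
  by apply/rowP => i; rewrite !mxE (ord1 i) eqxx.
by rewrite /= /sph_concat_fun mxE !dE subr0.
Qed.

Lemma sph_homotopic_concat f f' g g' : sph_homotopic f f' -> sph_homotopic g g' ->
  sph_homotopic (sph_concat f g) (sph_concat f' g').
Proof.
move=> /sph_homotopicP ff /sph_homotopicP gg; apply/sph_homotopicP.
have E a b : (fun s : K => sph_concat a b (const_mx s)) = _ := funext (sph_concat_path a b).
rewrite !E; apply: homotopic_pcat => //.
have [_ _ f1] := sphere_path f; have [_ g0 _] := sphere_path g.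
exact: req_trans f1 (req_sym g0).
Qed.

Lemma cst_loop : isloop x0 (fun _ : K => rvertex K x0).
Proof. by split; [exact: rcontinuous_cst|exact: req_refl|exact: req_refl]. Qed.

Definition cst_sphere : sphere K 1 x0 := loop_sphere cst_loop.

Lemma sph_concat_cst f : sph_homotopic (sph_concat f cst_sphere) f.
Proof.
apply/sph_homotopicP; rewrite (funext (sph_concat_path f cst_sphere)).
have [cf _ f1] := sphere_path f.
by apply: homotopic_cat1 => // s _; exact: req_sym.
Qed.

Lemma sph_cst_concat f : sph_homotopic (sph_concat cst_sphere f) f.
Proof.
apply/sph_homotopicP; rewrite (funext (sph_concat_path cst_sphere f)).
have [cf f0 _] := sphere_path f.
by apply: homotopic_1cat => // s _; exact: req_sym.
Qed.

End SphereGroup.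

Section ProductFunctional.
Variables (K : realType) (X : sset) (x0 : X 0) (I : finType).
Variables (Y : I -> sset) (y0 : forall i, Y i 0) (V : zmodType).
Local Notation G := (homotopy_group K 0 x0).
Local Notation H := (fun i => homotopy_group K 0 (y0 i)).
Variable phi : G -> pgroup_dsum H.
Hypothesis phi_eq : forall x y : G, peq x y <-> peq (phi x) (phi y).
Hypothesis phi_op : forall x y : G, peq (phi (pop x y)) (pop (phi x) (phi y)).
Hypothesis phi_surj : forall z : pgroup_dsum H, exists x : G, peq (phi x) z.
Variable psi : G -> V.
Hypothesis psi_eq : forall x y : G, peq x y -> psi x = psi y.
Hypothesis psi_op : forall x y : G, psi (pop x y) = psi x + psi y.

(** [psi] carried through the inverse of [phi]; [transportedE] shows that the chosen preimage does
    not matter. *)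
Definition transported (z : pgroup_dsum H) : V := psi (sval (cid (phi_surj z))).

Lemma transportedE x z : peq (phi x) z -> transported z = psi x.
Proof.
move=> xz; apply: psi_eq; apply/phi_eq => i.
apply: sph_homotopic_trans (svalP (cid (phi_surj z)) i) _.
exact/sph_homotopic_sym/xz.
Qed.

Lemma transported_eq z z' : peq z z' -> transported z = transported z'.
Proof.
move=> zz; have [x xz] := phi_surj z; rewrite (transportedE xz).
apply/esym/transportedE => i; exact: sph_homotopic_trans (xz i) (zz i).
Qed.

Lemma transported_op z z' : transported (pop z z') = transported z + transported z'.
Proof.
have [x xz] := phi_surj z; have [x' xz'] := phi_surj z'.
rewrite (transportedE xz) (transportedE xz') -psi_op; apply: transportedE => i.
apply: sph_homotopic_trans (phi_op x x' i) _.
exact: sph_homotopic_concat (xz i) (xz' i).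
Qed.

Let unit_family : pgroup_dsum H := fun i => cst_sphere K (y0 i).

Definition component (i : I) (l : sphere K 1 (y0 i)) : V :=
  transported (dfwith unit_family l).

Lemma component_homotopic i (l l' : sphere K 1 (y0 i)) : sph_homotopic l l' ->
  component l = component l'.
Proof.
move=> ll; apply: transported_eq => j; case: (eqVneq i j) => [e|ij].
  by case: j / e; rewrite !dfwith_in.
by rewrite !dfwith_out //; exact: sph_homotopic_refl.
Qed.

Lemma component_concat i (l l' : sphere K 1 (y0 i)) :
  component (sph_concat l l') = component l + component l'.
Proof.
rewrite -transported_op; apply: transported_eq => j.
case: (eqVneq i j) => [e|ij].
  by case: j / e; rewrite /= !dfwith_in; exact: sph_homotopic_refl.
rewrite /= !dfwith_out //; exact/sph_homotopic_sym/sph_concat_cst.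
Qed.

(** Over a finite index set every family is a product of families concentrated in one factor; the
    factors are switched on one at a time along the enumeration. *)
Lemma transported_eq0 : (forall i (l : sphere K 1 (y0 i)), component l = 0) ->
  forall x : G, psi x = 0.
Proof.
move=> c0 x; rewrite -(transportedE (fun i => sph_homotopic_refl _ : peq (phi x i) (phi x i))).
set z := phi x; pose part (s : seq I) : pgroup_dsum H := fun i => if i \in s then z i else unit_family i.
have -> : transported z = transported (part (enum I)).
  by apply: transported_eq => i; rewrite /part mem_enum; exact: sph_homotopic_refl.
elim: (enum I) => [|i s IH].
  have u2 : transported unit_family = transported unit_family + transported unit_family.
    rewrite -transported_op; apply: transported_eq => i.
    exact/sph_homotopic_sym/sph_concat_cst.
  by rewrite -[part [::]]/unit_family; apply: (addrI (transported unit_family)); rewrite -u2 addr0.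
have [is_|is_] := boolP (i \in s).
  rewrite -IH; apply: transported_eq => j; rewrite /part inE.
  by case: eqP => [->|_]; rewrite ?is_; exact: sph_homotopic_refl.
rewrite -[RHS](c0 i (z i)) -[RHS]add0r -IH -transported_op; apply: transported_eq => j.
rewrite /part /= inE eq_sym; case: (eqVneq i j) => [e|ij].
  by case: j / e; rewrite (negPf is_) dfwith_in; exact/sph_homotopic_sym/sph_cst_concat.
by rewrite dfwith_out //; exact/sph_homotopic_sym/sph_concat_cst.
Qed.

End ProductFunctional.

(** * Modules over the group ring of SL(2,3) over F_3 *)

Section GroupModules.
Variables (F : comNzRingType) (gT : finGroupType).
Local Notation A := (grpring F gT).

Definition basis_elt (g : gT) : A := [ffun x => (x == g)%:R].

Lemma basis_eltM g h : basis_elt g * basis_elt h = basis_elt (g * h)%g.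
Proof.
apply/ffunP => x; rewrite [LHS]ffunE (bigD1 g) //= !ffunE eqxx mul1r.
rewrite big1 => [|y /negPf yg]; last by rewrite ffunE yg mul0r.
rewrite addr0 (_ : (g^-1 * x == h)%g = (x == g * h)%g) //.
by apply/eqP/eqP => [<-|->]; rewrite ?mulKVg ?mulKg.
Qed.

Lemma basis_elt1 : basis_elt 1%g = 1.
Proof. by []. Qed.

Record linear_action (V : lmodType F) : Type := LinearAction {
  lact :> gT -> V -> V;
  lact1 : forall v, lact 1%g v = v;
  lactM : forall g h v, lact (g * h)%g v = lact g (lact h v);
  lact_linear : forall g, linear (lact g) }.

Section Module.
Variables (V : lmodType F) (act : linear_action V).

Definition gscale (a : A) (v : V) : V := \sum_g a g *: act g v.

Lemma lactD g v w : act g (v + w) = act g v + act g w.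
Proof. by have := lact_linear act g 1 v w; rewrite !scale1r. Qed.

Lemma lact0 g : act g 0 = 0.
Proof. by apply: (addrI (act g 0)); rewrite -lactD !addr0. Qed.

Lemma lactZ g a v : act g (a *: v) = a *: act g v.
Proof. by have := lact_linear act g a v 0; rewrite lact0 !addr0. Qed.

Lemma lact_sum g (I : Type) (r : seq I) (f : I -> V) :
  act g (\sum_(i <- r) f i) = \sum_(i <- r) act g (f i).
Proof. exact: (big_morph _ (lactD g) (lact0 g)). Qed.

Lemma gscaleA a b v : gscale a (gscale b v) = gscale (a * b) v.
Proof.
transitivity (\sum_y \sum_z (a y * b z) *: act (y * z)%g v).
  apply: eq_bigr => y _; rewrite /gscale lact_sum scaler_sumr.
  by apply: eq_bigr => z _; rewrite lactZ scalerA -lactM.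
transitivity (\sum_y \sum_x (a y * b (y^-1 * x)%g) *: act x v).
  apply: eq_bigr => y _; rewrite (reindex_inj (mulgI y^-1%g)) /=.
  by apply: eq_bigr => z _; rewrite mulKVg.
rewrite exchange_big /=; apply: eq_bigr => x _.
by rewrite [(a * b) x]ffunE scaler_suml.
Qed.

Lemma gscale_basis g v : gscale (basis_elt g) v = act g v.
Proof.
rewrite /gscale (bigD1 g) //= ffunE eqxx scale1r big1 ?addr0 // => h /negPf hg.
by rewrite ffunE hg scale0r.
Qed.

Lemma gscale1 v : gscale 1 v = v.
Proof. by rewrite -basis_elt1 gscale_basis lact1. Qed.

Lemma gscaleDr : right_distributive gscale +%R.
Proof.
move=> a v w; rewrite /gscale -big_split; apply: eq_bigr => g _.
by rewrite lactD scalerDr.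
Qed.

Lemma gscaleDl v : {morph gscale^~ v : a b / a + b}.
Proof.
move=> a b; rewrite /gscale -big_split; apply: eq_bigr => g _.
by rewrite ffunE scalerDl.
Qed.

End Module.
End GroupModules.

Section GroupModuleStructure.
Variables (F : comNzRingType) (gT : finGroupType) (V : lmodType F).
Variable act : linear_action gT V.
Local Notation A := (grpring F gT).

(** The action is a phantom argument: one [V] carries several module structures, and the type must
    tell them apart. *)
Definition group_module of linear_action gT V : Type := V.
HB.instance Definition _ := GRing.Zmodule.on (group_module act).
HB.instance Definition _ := GRing.Zmodule_isLmodule.Build A (group_module act)
  (@gscaleA F gT V act) (@gscale1 F gT V act) (@gscaleDr F gT V act) (@gscaleDl F gT V act).

Lemma group_module_scale (a : A) (v : group_module act) : a *: v = gscale act a v.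
Proof. by []. Qed.

Lemma group_module_fin_gen : @fin_gen F V (fun=> True) ->
  @fin_gen A (group_module act) (fun=> True).
Proof.
move=> [n [v [_ vP]]]; exists n, v; split=> // x _; have [c ->] := vP x I.
exists (fun i => [ffun g => if g == 1%g then c i else 0]); apply: eq_bigr => i _.
rewrite group_module_scale /gscale (bigD1 1%g) //= ffunE eqxx lact1 big1 ?addr0 //.
by move=> g /negPf g1; rewrite ffunE g1 scale0r.
Qed.

End GroupModuleStructure.

Section SL2.
Local Notation F3 := 'F_3.
Local Notation M2 := 'M[F3]_2.

(* Locked, lest conversion compute in the finite group. *)
Fact gl2_key : unit. Proof. by []. Qed.
Definition gl2 : M2 -> {'GL_2(3)} :=
  locked_with gl2_key (fun M => insubd (1%g : {'GL_2(3)}) M).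

Lemma gl2K (M : M2) : \det M = 1 -> GLval (gl2 M) = M.
Proof.
move=> dM; rewrite /gl2 unlock; apply: (@insubdK _ _ {'GL_2(3)}).
by rewrite unfold_in /= unitmxE dM unitr1.
Qed.

Lemma gl2_SL (M : M2) : \det M = 1 -> gl2 M \in SL2F3.
Proof. by move=> dM; rewrite inE gl2K // dM. Qed.

Lemma gl2M (M N : M2) : \det M = 1 -> \det N = 1 -> (gl2 M * gl2 N)%g = gl2 (M *m N).
Proof.
move=> dM dN; apply: val_inj; rewrite /= [RHS]gl2K ?det_mulmx ?dM ?dN ?mulr1 //.
by rewrite -[LHS]/(GLval (gl2 M) *m GLval (gl2 N)) !gl2K.
Qed.

Definition mat2 (a b c d : F3) : M2 :=
  \matrix_(i, j) if i == ord0 then (if j == ord0 then a else b)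
                 else (if j == ord0 then c else d).

Lemma mat2E (M : M2) : M = mat2 (M ord0 ord0) (M ord0 ord_max) (M ord_max ord0) (M ord_max ord_max).
Proof.
apply/matrixP => i j; rewrite mxE.
by have [->|->] := ord2E i; have [->|->] := ord2E j.
Qed.

Lemma mat2M a b c d a' b' c' d' : mat2 a b c d *m mat2 a' b' c' d' =
  mat2 (a * a' + b * c') (a * b' + b * d') (c * a' + d * c') (c * b' + d * d').
Proof.
apply/matrixP => i j; rewrite !mxE !big_ord_recl big_ord0 !mxE /= addr0.
by have [->|->] := ord2E i; have [->|->] := ord2E j.
Qed.

Lemma det_mat2 a b c d : \det (mat2 a b c d) = a * d - b * c.
Proof.
rewrite (expand_det_row _ ord0) !big_ord_recl big_ord0 addr0 /cofactor !det_mx11 !mxE /=.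
by rewrite expr0 expr1 mul1r mulN1r mulrN.
Qed.

End SL2.

Section CyclicIdempotents.
Variables (A : pzRingType) (y : A).
Hypothesis y4 : y * y * y * y = 1.
Hypothesis char3 : forall a : A, a + a + a = 0.

(* The projections onto the y- and y^2-invariants: 1/4 = 1 and 1/2 = -1. *)
Definition idem4 : A := 1 + y + y * y + y * y * y.
Definition idem2 : A := - (1 + y * y).

Lemma idem4_idem : idem4 * idem4 = idem4.
Proof.
have s1 : idem4 * y = idem4.
  by rewrite /idem4 !mulrDl y4 mul1r addrC !addrA.
by rewrite {2}/idem4 !mulrDr mulr1 !mulrA !s1 char3 add0r.
Qed.

Lemma idem2_idem : idem2 * idem2 = idem2.
Proof.
rewrite /idem2 mulrNN mulrDl !mulrDr !mulr1 !mul1r !mulrA y4 [y * y + 1]addrC.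
by apply/eqP; rewrite -addr_eq0; apply/eqP; exact: char3.
Qed.

End CyclicIdempotents.

Section CyclicIdempotentAction.
Variables (F : comNzRingType) (gT : finGroupType) (V : lmodType F).
Variables (act : linear_action gT V) (x : gT).
Implicit Types v : group_module act.

Lemma basis_elt_scale v : basis_elt F x *: v = act x v :> V.
Proof. exact: gscale_basis. Qed.

Lemma idem4_scale v : idem4 (basis_elt F x) *: v =
  v + act x v + act x (act x v) + act x (act x (act x v)) :> V.
Proof.
by rewrite /idem4 !scalerDl scale1r -!scalerA; have E := basis_elt_scale; rewrite !E.
Qed.

Lemma idem2_scale v : idem2 (basis_elt F x) *: v = - (v + act x (act x v)) :> V.
Proof.
by rewrite /idem2 scaleNr scalerDl scale1r -scalerA; have E := basis_elt_scale; rewrite !E.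
Qed.

End CyclicIdempotentAction.

(** * The two nontrivial idempotents and the three test modules *)

Section SL2F3Modules.
Local Notation F3 := 'F_3.
Local Notation gT := (subg_of SL2F3).
Local Notation A := (grpring F3 gT).

Lemma F3_three : (3%:R : F3) = 0.
Proof. exact: val_inj. Qed.

Lemma F3_add3 (V : lmodType F3) (v : V) : v + v + v = 0.
Proof.
have <- : (3%:R : F3) *: v = v + v + v by rewrite scaler_nat !mulrS mulr0n addr0 addrA.
by rewrite F3_three scale0r.
Qed.

Definition quarter_mx : 'M[F3]_2 := mat2 0 (-1) 1 0.

Lemma det_quarter : \det quarter_mx = 1.
Proof. by rewrite det_mat2 mulr0 mulr1 sub0r opprK. Qed.

Lemma quarter_sqr : quarter_mx *m quarter_mx = - 1%:M.
Proof.
apply/matrixP => i j; rewrite mat2M !mxE.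
by have [->|->] := ord2E i; have [->|->] := ord2E j; apply: val_inj.
Qed.

Definition quarter : gT := subg SL2F3 (gl2 quarter_mx).

Definition sl2_mx (g : gT) : 'M[F3]_2 := GLval (sgval g).

Lemma sl2_mx1 : sl2_mx 1%g = 1%:M. Proof. by []. Qed.
Lemma sl2_mxM g h : sl2_mx (g * h)%g = sl2_mx g *m sl2_mx h. Proof. by []. Qed.

Lemma sl2_quarter : sl2_mx quarter = quarter_mx.
Proof. by rewrite /sl2_mx subgK ?gl2_SL ?gl2K ?det_quarter. Qed.

Lemma sl2_mx_inj : injective sl2_mx.
Proof. by move=> g h e; apply: subg_inj; exact: val_inj. Qed.

Lemma quarter4 : (quarter ^+ 4)%g = 1%g.
Proof.
rewrite !expgS expg0 mulg1; apply: sl2_mx_inj; rewrite !sl2_mxM sl2_quarter quarter_sqr mulmxA quarter_sqr.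
by rewrite mulNmx mul1mx opprK.
Qed.

Lemma grpring_finite : exists s : seq A, forall a : A, a \in s.
Proof. by exists (enum {ffun gT -> F3}) => a; rewrite mem_enum. Qed.

Definition quarter_elt : A := basis_elt F3 quarter.
Definition idem_quarter : A := idem4 quarter_elt.
Definition idem_half : A := idem2 quarter_elt.

Lemma quarter_elt4 : quarter_elt * quarter_elt * quarter_elt * quarter_elt = 1.
Proof.
rewrite /quarter_elt !basis_eltM -basis_elt1; congr basis_elt.
by rewrite -!mulgA -quarter4 !expgS expg0 mulg1.
Qed.

Lemma grpring_add3 (a : A) : a + a + a = 0.
Proof. by apply/ffunP => g; rewrite !ffunE; exact: (@F3_add3 F3^o). Qed.

Lemma idem_quarter_idem : idem_quarter * idem_quarter = idem_quarter.
Proof. exact: idem4_idem quarter_elt4 grpring_add3. Qed.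

Lemma idem_half_idem : idem_half * idem_half = idem_half.
Proof. exact: idem2_idem quarter_elt4 grpring_add3. Qed.

Definition triv_action : linear_action gT F3^o :=
  @LinearAction F3 gT F3^o (fun _ v => v) (fun _ => erefl) (fun _ _ _ => erefl)
    (fun _ _ _ _ => erefl).

Definition nat_action : linear_action gT 'cV[F3]_2.
Proof.
refine (@LinearAction F3 gT _ (fun g v => sl2_mx g *m v) _ _ _).
- by move=> v; rewrite sl2_mx1 mul1mx.
- by move=> g h v; rewrite sl2_mxM mulmxA.
- by move=> g a v w; rewrite linearP.
Defined.

(** Stands in for the third simple module: 2 by 2 matrices are the sum of the scalars and of the
    traceless matrices, a simple module of dimension 3. *)
Definition conj_action : linear_action gT 'M[F3]_2.
Proof.
refine (@LinearAction F3 gT _ (fun g v => sl2_mx g *m v *m sl2_mx g^-1%g) _ _ _).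
- by move=> v; rewrite invg1 sl2_mx1 mul1mx mulmx1.
- by move=> g h v; rewrite invMg !sl2_mxM !mulmxA.
- by move=> g a v w; rewrite linearP /= mulmxDl -scalemxAl.
Defined.

Lemma mx_fin_gen m n : @fin_gen F3 'M[F3]_(m, n) (fun=> True).
Proof.
exists #|{: 'M[F3]_(m, n)}|, enum_val; split=> // x _.
exists (fun i => (i == enum_rank x)%:R); rewrite (bigD1 (enum_rank x)) //= eqxx scale1r.
rewrite enum_rankK big1 ?addr0 // => i /negPf ix; by rewrite ix scale0r.
Qed.

Lemma regular_fin_gen : @fin_gen F3 F3^o (fun=> True).
Proof.
exists 1%N, (fun=> 1); split=> // x _; exists (fun=> x).
by rewrite big_ord1; exact/esym/mulr1.
Qed.

Definition triv_mod : fgmod A := FGMod (group_module_fin_gen triv_action regular_fin_gen).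
Definition nat_mod : fgmod A := FGMod (group_module_fin_gen nat_action (mx_fin_gen 2 1)).
Definition conj_mod : fgmod A := FGMod (group_module_fin_gen conj_action (mx_fin_gen 2 2)).

Lemma card_pred_fin (T : finType) (P : T -> Prop) (Q : pred T) :
  (forall x, P x <-> Q x) -> card_pred P = #|Q|.
Proof.
move=> PQ; rewrite cardE; apply: card_predE; first exact: enum_uniq.
by move=> x; rewrite mem_enum PQ.
Qed.

Lemma card_all (T : finType) (P : T -> Prop) : (forall x, P x) -> card_pred P = #|T|.
Proof. by move=> hP; apply: card_pred_fin => x; split. Qed.

Lemma triv_quarter v : idem_quarter *: v = v :> triv_mod.
Proof. by rewrite [LHS](@idem4_scale F3 gT _ triv_action quarter) F3_add3 add0r. Qed.

Lemma triv_half v : idem_half *: v = v :> triv_mod.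
Proof.
rewrite [LHS](@idem2_scale F3 gT _ triv_action quarter); apply/eqP; rewrite eq_sym -addr_eq0 addrC.
exact/eqP/(@F3_add3 F3^o).
Qed.

Lemma nat_sqr (v : 'cV[F3]_2) : nat_action quarter (nat_action quarter v) = - v.
Proof. by rewrite /= mulmxA sl2_quarter quarter_sqr mulNmx mul1mx. Qed.

Lemma sl2_quarterV : sl2_mx quarter^-1%g = - quarter_mx.
Proof.
have : sl2_mx (quarter * quarter^-1)%g = 1%:M by rewrite mulgV.
rewrite sl2_mxM sl2_quarter => /(congr1 (mulmx quarter_mx)).
by rewrite mulmxA quarter_sqr mulmx1 mulNmx mul1mx => /eqP; rewrite eqr_oppLR => /eqP.
Qed.

Lemma conj_sqr (v : 'M[F3]_2) : conj_action quarter (conj_action quarter v) = v.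
Proof.
rewrite /= sl2_quarterV sl2_quarter !mulmxA quarter_sqr -!mulmxA mulNmx mul1mx.
by rewrite mulmxN mulNmx !mulmxN quarter_sqr !mulmxN mulmx1 !opprK.
Qed.

(** The fixed matrices are the centralizer of an element with square -1, that is a copy of the field
    with nine elements. *)
Lemma conj_fixed (v : 'M[F3]_2) : conj_action quarter v = v <->
  exists a b : F3, v = a%:M + b *: quarter_mx.
Proof.
have -> : conj_action quarter v = - (quarter_mx *m v *m quarter_mx).
  by rewrite /= sl2_quarterV sl2_quarter mulmxN.
have sqE : forall w : 'M[F3]_2, w *m quarter_mx *m quarter_mx = - w.
  by move=> w; rewrite -mulmxA quarter_sqr mulmxN mulmx1.
split=> [h|[a [b ->]]]; last first.
  rewrite mulmxDr -scalemxAr quarter_sqr mul_mx_scalar mulmxDl -!scalemxAl quarter_sqr.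
  by rewrite mulNmx mul1mx !scalerN scalemx1 opprD !opprK.
have {h} : quarter_mx *m v = v *m quarter_mx.
  by rewrite -{2}h mulNmx sqE opprK.
rewrite (mat2E v); move: (v ord0 ord0) (v ord0 ord_max) (v ord_max ord0) (v ord_max ord_max).
move=> a b c d; rewrite !mat2M => /matrixP h.
have := h ord0 ord0; have := h ord0 ord_max; rewrite !mxE /= => h1 h2.
exists a, c; apply/matrixP => i j; rewrite !mxE.
have {}h1 : d = a by move: h1; rewrite !(mul0r, mulr0, mulN1r, mulrN1, add0r, addr0) => /oppr_inj.
have {}h2 : b = - c by move: h2; rewrite !(mul0r, mulr0, mulN1r, mulr1, add0r, addr0).
by have [->|->] := ord2E i; have [->|->] := ord2E j; rewrite ?h1 ?h2 /= ?mulr0 ?mulr1 ?mulrN1 ?addr0 ?add0r.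
Qed.

Lemma card_F3 : #|{: F3}| = 3%N.
Proof. by rewrite card_ord. Qed.

Lemma card_conj_fixed : card_pred (fun v : conj_mod => idem_quarter *: v = v) = 9%N.
Proof.
have fixE (v : conj_mod) : idem_quarter *: v = v <-> conj_action quarter v = v.
  rewrite [idem_quarter *: v](@idem4_scale F3 gT _ conj_action quarter) !conj_sqr -[X in X + conj_action _ _]addrA.
  set w := conj_action quarter v; have v3 := F3_add3 (v : 'M[F3]_2).
  have w3 := F3_add3 w; split=> [h|e].
    have : v + w + w = 0 :> 'M[F3]_2.
      by apply: (addrI (v : 'M[F3]_2)); rewrite addr0 -[RHS]h; rewrite !addrA; rewrite addrAC.
    by move=> h'; apply: (addIr (w + w)); rewrite !addrA w3 h'.
  by rewrite e !addrA v3 add0r.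
have tot : forall x : F3, True by [].
have -> : 9%N = (card_pred (fun _ : F3 => True) * card_pred (fun _ : F3 => True))%N.
  by rewrite (card_all tot) card_F3.
apply: (@card_pred_mul _ _ _ _ _ _ (fun a b : F3 => (a%:M + b *: quarter_mx : 'M[F3]_2) : conj_mod)).
- by exists (enum F3) => x _; rewrite mem_enum.
- by exists (enum F3) => x _; rewrite mem_enum.
- move=> a a' b b' _ _ _ _ /matrixP h; have := h ord0 ord0; have := h ord_max ord0.
  by rewrite !mxE /= !mulr0n !mulr1n !mulr0 !mulr1 !addr0 !add0r.
- move=> v; rewrite fixE conj_fixed; split=> [[a [b ->]]|[a [b [_ _ ->]]]]; by exists a, b.
Qed.

Lemma euler_triv : [/\ euler_mod idem_quarter triv_mod = 1%N,
  euler_mod idem_half triv_mod = 1%N & euler_mod 1 triv_mod = 1%N].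
Proof.
by split; rewrite /euler_mod (@card_all F3) ?card_F3 // => v;
  [exact: triv_quarter|exact: triv_half|exact: scale1r].
Qed.

Lemma euler_nat : [/\ euler_mod idem_quarter nat_mod = 0%N,
  euler_mod idem_half nat_mod = 0%N & euler_mod 1 nat_mod = 2%N].
Proof.
have z (e : A) : (forall v : nat_mod, e *: v = 0) -> euler_mod e nat_mod = 0%N.
  move=> ev; rewrite /euler_mod (@card_predE _ _ [:: 0 : nat_mod]) //= => x.
  by rewrite inE ev; split=> [/eqP ->|<-].
split.
- apply: z => v; rewrite [LHS](@idem4_scale F3 gT _ nat_action quarter) !nat_sqr.
  have cancel (U : zmodType) (a b : U) : a + b - a - b = 0 by rewrite addrAC addrK subrr.
  have qN (w : 'cV[F3]_2) : nat_action quarter (- w) = - nat_action quarter w by exact: mulmxN.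
  by rewrite qN; exact: (cancel 'cV[F3]_2).
- by apply: z => v; rewrite [LHS](@idem2_scale F3 gT _ nat_action quarter) nat_sqr subrr oppr0.
- rewrite /euler_mod (@card_all 'cV[F3]_2); last by move=> v; exact: scale1r.
  by rewrite card_mx card_F3.
Qed.

Lemma euler_conj : [/\ euler_mod idem_quarter conj_mod = 2%N,
  euler_mod idem_half conj_mod = 4%N & euler_mod 1 conj_mod = 4%N].
Proof.
have c : #|{: 'M[F3]_2}| = 81%N by rewrite card_mx card_F3.
split; first by rewrite /euler_mod card_conj_fixed.
- rewrite /euler_mod (@card_all 'M[F3]_2) ?c // => v.
  rewrite [LHS](@idem2_scale F3 gT _ conj_action quarter) conj_sqr; apply/eqP.
  by rewrite eq_sym -addr_eq0 addrA F3_add3.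
- by rewrite /euler_mod (@card_all 'M[F3]_2) ?c // => v; exact: scale1r.
Qed.

End SL2F3Modules.

(** * Tensor products with F_3 *)

Section TensorF3.
Variables (n : nat) (L : subring 'M[rat]_n).
Local Notation B := (subring_type L).
Local Notation T := (tensor 'F_3 B).
Local Notation pt := (@pure_tensor 'F_3 B).

Lemma pt_addl a a' b : pt (a + a') b = pt a b + pt a' b.
Proof. exact: (pure_tensor_biadditive 'F_3 B).1. Qed.

Lemma pt_addr a b b' : pt a (b + b') = pt a b + pt a b'.
Proof. exact: (pure_tensor_biadditive 'F_3 B).2. Qed.

Lemma pt_0l b : pt 0 b = 0.
Proof. by apply: (addrI (pt 0 b)); rewrite -pt_addl !addr0. Qed.

Lemma pt_0r a : pt a 0 = 0.
Proof. by apply: (addrI (pt a 0)); rewrite -pt_addr !addr0. Qed.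

Lemma pt_natl m a b : pt (a *+ m) b = pt a b *+ m.
Proof. by elim: m => [|m IH]; rewrite ?mulr0n ?pt_0l // !mulrS pt_addl IH. Qed.

Lemma pt_natr m a b : pt a (b *+ m) = pt a b *+ m.
Proof. by elim: m => [|m IH]; rewrite ?mulr0n ?pt_0r // !mulrS pt_addr IH. Qed.

Lemma pt_intr (k : int) a b : pt a (b *~ k) = pt a b *~ k.
Proof.
case: k => m; first exact: pt_natr.
rewrite !NegzE !mulrNz; apply/eqP; rewrite -addr_eq0.
have <- : pt a (b *~ m.+1%:Z) = pt a b *~ m.+1%:Z by exact: pt_natr.
by rewrite -pt_addr addNr pt_0r.
Qed.

Lemma pt_three b : pt 1 (b *+ 3) = 0.
Proof.
rewrite pt_natr -pt_natl (_ : 1 *+ 3 = 0 :> 'F_3) ?pt_0l //.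
exact: val_inj.
Qed.

Lemma tensor_three : (3%:R : T) = 0.
Proof. exact: (etrans (esym (pt_natr 3 1 1)) (pt_three 1)). Qed.

(** 1 tensor 1 = 1 tensor 3y = 3 tensor y = 0. *)
Lemma tensor_trivial : (exists2 y, y \in L & y *+ 3 = 1) -> (1 : T) = 0.
Proof.
move=> [y yL y3]; have y3' : (exist _ y yL : B) *+ 3 = 1.
  by apply: val_inj; rewrite raddfMn.
by rewrite -[LHS]/(pt 1 1) -y3' pt_three.
Qed.

Hypothesis L3 : forall x, x \in L -> exists (k : int) y, y \in L /\ x = k%:~R + y *+ 3.

(** Additively the ring is generated by the 1 tensor b, and b is an integer modulo 3L, which dies in
    the tensor product. *)
Lemma tensor_int (x : T) : exists k : int, x = k%:~R.
Proof.
have [s ->] := tensorE x; rewrite pi_pure.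
elim: s => [|[a b] s [k kE]]; first by exists 0; rewrite big_nil.
rewrite big_cons /= kE.
have [l lE] : exists l : int, pt 1 b = l%:~R.
  have [l [y [yL bE]]] := L3 (valP b).
  exists l; have -> : b = 1 *~ l + (exist _ y yL : B) *+ 3.
    apply: val_inj; rewrite [RHS]raddfD [X in _ = X + _]raddfMz [X in _ = _ + X]raddfMn.
    by rewrite bE.
  by rewrite pt_addr pt_three addr0 pt_intr.
have [m aE] : exists m : nat, a = 1 *+ m.
  exists (nat_of_ord a); apply: val_inj.
  by rewrite Zp_mulrn /= mul1n modn_small //; have := ltn_ord a.
exists (l * m%:Z + k); rewrite mulrzDr; congr (_ + _).
by rewrite aE pt_natl lE mulrzA.
Qed.

(** The ring is an image of Z killed by 3, so a nonzero element is 1 or 2, and 2 is its own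
    inverse. *)
Lemma tensor_div (x : T) : x != 0 -> exists y, y * x = 1.
Proof.
have [k ->] := tensor_int x; rewrite (divz_eq k 3) mulrzDr.
have -> : (1 : T) *~ ((k %/ 3)%Z * 3) = 0.
  by rewrite mulrC mulrzA; have := tensor_three; rewrite -[3%:R]/(1 *~ 3) => ->; rewrite mul0rz.
rewrite add0r; have := modz_ge0 k (isT : (3 : int) != 0); have := ltz_pmod k (isT : (0 < 3 :> int)).
case: (k %% 3)%Z => [[|[|[|r]]]|r] //= _ _.
- by rewrite mulr0z eqxx.
- by exists 1; rewrite mul1r.
- exists (1 *~ 2); rewrite -intrM -[2 * 2]/(3 + 1 : int) mulrzDr.
  by have := tensor_three; rewrite -[3%:R]/(1 *~ 3) => ->; rewrite add0r.
Qed.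

End TensorF3.

Lemma left_noetherian_finite (A : pzRingType) : (exists s : seq A, forall a : A, a \in s) ->
  left_noetherian A.
Proof.
move=> [s sP] S _; pose s' := [seq a <- s | `[< S a >]].
exists (size s'), (fun i => tnth (in_tuple s') i); split.
  by move=> i; have := mem_tnth i (in_tuple s'); rewrite mem_filter => /andP[/asboolP].
move=> x Sx; have xs : x \in s' by rewrite mem_filter sP andbT; exact/asboolP.
have hi : (index x s' < size s')%N by rewrite index_mem.
exists (fun i => (i == Ordinal hi)%:R); rewrite (bigD1 (Ordinal hi)) //= eqxx scale1r.
rewrite big1 => [|i /negPf ->]; last by rewrite scale0r.
by rewrite addr0 (tnth_nth x) /= nth_index.
Qed.

Lemma noetherian_F3 : noetherian 'F_3.
Proof.
split; apply: left_noetherian_finite; exists (enum 'F_3) => a; by rewrite mem_enum.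
Qed.

Section RationalSubrings.
Variables (n : nat) (L : subring 'M[rat]_n).

Lemma subring0 : 0 \in L.
Proof. by have [one sub _] := subringP L; rewrite -(subrr 1) sub. Qed.
Lemma subringN x : x \in L -> - x \in L.
Proof. by have [_ sub _] := subringP L; move=> xL; rewrite -[- x]sub0r sub // subring0. Qed.
Lemma subringD x y : x \in L -> y \in L -> x + y \in L.
Proof. by have [_ sub _] := subringP L; move=> xL yL; rewrite -[y]opprK sub // subringN. Qed.
Lemma subringM x y : x \in L -> y \in L -> x * y \in L.
Proof. by have [_ _ mul] := subringP L; exact: mul. Qed.
Lemma subring1 : 1 \in L.
Proof. by have [one _ _] := subringP L. Qed.
Lemma subringZ (k : int) x : x \in L -> x *~ k \in L.
Proof.
move=> xL; have H m : x *+ m \in L.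
  by elim: m => [|m IH]; rewrite ?mulr0n ?subring0 // mulrS subringD.
by case: k => m; rewrite ?NegzE ?mulrNz ?subringN // H.
Qed.

Lemma third_mod3 : (exists2 y, y \in L & y *+ 3 = 1) ->
  forall x, x \in L -> exists (k : int) y, y \in L /\ x = k%:~R + y *+ 3.
Proof.
move=> [y yL y3] x xL; exists 0, (y * x); split; first exact: subringM.
by rewrite add0r -mulrnAl y3 mul1r.
Qed.

(** Denominators in lowest terms are invertible in a ring of rational scalars. If the denominator b
    is divisible by 3, then 1/3 lies in [L]; otherwise b has an inverse t modulo 3, and a/b is
    congruent to the integer a t modulo 3L. *)
Lemma scalar_mod3 : (forall x, x \in L -> exists q : rat, x = q%:M) ->
  forall x, x \in L -> exists (k : int) y, y \in L /\ x = k%:~R + y *+ 3.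
Proof.
move=> Lq x xL; have [q qx] := Lq x xL.
set a := numq q; set b := denq q.
have b0 : (b%:~R : rat) != 0 by rewrite intr_eq0 denq_neq0.
have qE : q * b%:~R = a%:~R by rewrite -[q in LHS]divq_num_den divfK.
have intE (k : int) : (k%:~R : rat)%:M = k%:~R :> 'M[rat]_n.
  by rewrite -[RHS](rmorph_int (scalar_mx : rat -> 'M[rat]_n)).
have mz (r : rat) (m : int) : (r%:M : 'M[rat]_n) *~ m = (r *~ m)%:M by rewrite raddfMz.
have [[u v] /= uv] : exists uv : int * int, uv.1 * a + uv.2 * b = 1.
  have /coprimezP[[u v] /= uv] : coprimez a b by rewrite coprimezE coprime_num_den.
  by exists (u, v).
(* From u a + v b = 1 follows 1/b = u q + v. *)
have invL : (b%:~R^-1)%:M \in L.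
  have -> : b%:~R^-1 = q *~ u + v%:~R :> rat.
    apply: (mulIf b0); rewrite mulVf // mulrDl -[q *~ u]mulrzl -mulrA qE.
    by rewrite -!intrM -intrD uv.
  rewrite raddfD /= intE; apply: subringD; last exact: (subringZ v subring1).
  by rewrite -mz -qx; exact: subringZ.
have [/dvdzP[b' bE]|nb] := boolP (3 %| b)%Z.
  apply: third_mod3 => //; exists ((b%:~R^-1)%:M *~ b'); first exact: subringZ.
  rewrite mz -[_ *+ 3]/(_ *~ 3%:Z) mz -mulrzA -bE -mulrzl mulfV //.
(* From 3 s + b t = 1 follows a/b = a t + 3 (a s / b). *)
have [[s t] /= st] : exists st : int * int, st.1 * 3 + st.2 * b = 1.
  have /coprimezP[[s t] /= st] : coprimez 3 b.
    by rewrite coprimezE prime_coprime.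
  by exists (s, t).
exists (a * t), ((b%:~R^-1)%:M *~ (a * s)); split; first exact: subringZ.
rewrite -intE mz -[_ *+ 3]/(_ *~ 3%:Z) mz qx -raddfD /=; congr (_%:M).
apply: (mulIf b0); rewrite qE mulrDl -[b%:~R^-1 *~ _ *~ _]mulrzA -[b%:~R^-1 *~ _]mulrzl.
rewrite mulfVK // -intrM -intrD.
by congr (_%:~R); rewrite -[LHS]mulr1 -st; ring.
Qed.

End RationalSubrings.

(** * Rational representations of SL(2,3) *)

Section GeneratorsSL2F3.
Local Notation F3 := 'F_3.
Local Notation gl a b c d := (gl2 (mat2 a%R b%R c%R d%R)).

(** [gi] and [gj] generate the quaternion group with centre [gz], and conjugation by [gt], of order
    3, permutes [gi], [gj] and their product cyclically. *)
Definition gi : {'GL_2(3)} := gl2 (mat2 0 (-1) 1 0).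
Definition gj : {'GL_2(3)} := gl2 (mat2 1 1 1 (-1)).
Definition gt : {'GL_2(3)} := gl2 (mat2 1 (-1) 0 1).
Definition gz : {'GL_2(3)} := gl2 (mat2 (-1) 0 0 (-1)).

Lemma gl_mul (a b c d a' b' c' d' : F3) : a * d - b * c = 1 -> a' * d' - b' * c' = 1 ->
  (gl a b c d * gl a' b' c' d')%g =
  gl (a * a' + b * c') (a * b' + b * d') (c * a' + d * c') (c * b' + d * d').
Proof. by move=> h h'; rewrite gl2M ?mat2M // det_mat2. Qed.

Lemma gl_eq (a b c d a' b' c' d' : F3) : a = a' -> b = b' -> c = c' -> d = d' ->
  gl a b c d = gl a' b' c' d'.
Proof. by move=> -> -> -> ->. Qed.

Lemma gi_in : gi \in SL2F3. Proof. by apply: gl2_SL; rewrite det_mat2; apply: val_inj. Qed.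
Lemma gj_in : gj \in SL2F3. Proof. by apply: gl2_SL; rewrite det_mat2; apply: val_inj. Qed.
Lemma gt_in : gt \in SL2F3. Proof. by apply: gl2_SL; rewrite det_mat2; apply: val_inj. Qed.
Lemma gz_in : gz \in SL2F3. Proof. by apply: gl2_SL; rewrite det_mat2; apply: val_inj. Qed.

Lemma gl_1 : gl 1 0 0 1 = 1%g.
Proof.
apply: val_inj; rewrite /= [LHS]gl2K ?det_mat2; last by apply: val_inj.
by apply/matrixP => i j; rewrite !mxE; have [->|->] := ord2E i; have [->|->] := ord2E j.
Qed.

Ltac f3 := by apply: val_inj.
Ltac glmul := rewrite ?gl_mul; try f3; apply: gl_eq; f3.

Lemma gi_sqr : (gi * gi)%g = gz. Proof. rewrite /gi /gz; glmul. Qed.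
Lemma gj_sqr : (gj * gj)%g = gz. Proof. rewrite /gj /gz; glmul. Qed.
Lemma gz_sqr : (gz * gz)%g = 1%g. Proof. rewrite /gz -gl_1; glmul. Qed.
Lemma gj_gi : (gj * gi)%g = (gz * (gi * gj))%g.
Proof. rewrite /gj /gi /gz; glmul. Qed.
Lemma gi_gt : (gi * gt)%g = (gt * gj)%g. Proof. rewrite /gj /gi /gt; glmul. Qed.
Lemma gj_gt : (gj * gt)%g = (gt * (gi * gj))%g. Proof. rewrite /gj /gi /gt; glmul. Qed.
Lemma gk_gt : (gi * gj * gt)%g = (gt * gi)%g. Proof. rewrite /gj /gi /gt; glmul. Qed.
Lemma gt_cube : (gt * gt * gt)%g = 1%g. Proof. rewrite /gt -gl_1; glmul. Qed.

Lemma SL2F3_gl (g : {'GL_2(3)}) : g \in SL2F3 -> exists a b c d : F3,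
  g = gl a b c d /\ a * d - b * c = 1.
Proof.
rewrite inE => /eqP dg; have := mat2E (GLval g).
move: (GLval g ord0 ord0) (GLval g ord0 ord_max) (GLval g ord_max ord0) (GLval g ord_max ord_max).
move=> a b c d E; exists a, b, c, d; split; last by rewrite -det_mat2 -E.
by apply: val_inj; rewrite /= [RHS]gl2K -?E.
Qed.

Lemma F3_cases (a : F3) : [\/ a = 0, a = 1 | a = -1].
Proof.
by case: a => [[|[|[|]]] //] h; [apply: Or31|apply: Or32|apply: Or33]; apply: val_inj.
Qed.

(** Powers of [gt] are the upper unipotents, conjugation by [gi] turns them into the lower ones, and
    a matrix with nonzero lower left entry is upper times lower times upper. *)
Lemma SL2F3_gen (P : {'GL_2(3)} -> Prop) : P gi -> P gt ->
  (forall g h, g \in SL2F3 -> h \in SL2F3 -> P g -> P h -> P (g * h)%g) ->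
  forall g, g \in SL2F3 -> P g.
Proof.
move=> Pi Pt PM; pose Q g := g \in SL2F3 /\ P g.
have QM g h : Q g -> Q h -> Q (g * h)%g by move=> [? ?] [? ?]; split; [exact: groupM|exact: PM].
have Qi : Q gi by split; [exact: gi_in|].
have Qt : Q gt by split; [exact: gt_in|].
have Qtt : Q (gt * gt)%g by exact: (QM _ _ Qt Qt).
have Qttt : Q (gt * gt * gt)%g by exact: (QM _ _ Qtt Qt).
have Qu (x : F3) : Q (gl 1 x 0 1).
  have [->|->|->] := F3_cases x; last exact: Qt.
    rewrite (_ : gl _ _ _ _ = gt * gt * gt)%g; first exact: Qttt.
    by rewrite gt_cube gl_1.
  rewrite (_ : gl _ _ _ _ = gt * gt)%g; first exact: Qtt.
  rewrite /gt; glmul.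
(* The cube of [gi] is its inverse; [P] is only assumed to be stable under products. *)
have Qi3 : Q (gi * gi * gi)%g by exact: (QM _ _ (QM _ _ Qi Qi) Qi).
have Ql (x : F3) : Q (gl 1 0 x 1).
  rewrite (_ : gl _ _ _ _ = gi * gl 1 (- x)%R 0%R 1%R * (gi * gi * gi))%g.
    exact: (QM _ _ (QM _ _ Qi (Qu _)) Qi3).
  have [->|->|->] := F3_cases x; rewrite /gi; glmul.
have Qc (a b c d : F3) : c != 0 -> a * d - b * c = 1 -> Q (gl a b c d).
  (* Multiplication by [c] is division by [c], as [c] is 1 or -1. *)
  move=> c0 e; rewrite (_ : gl a b c d =
    gl 1 ((a - 1) * c) 0%R 1%R * gl 1%R 0%R c 1%R * gl 1%R ((d - 1) * c) 0%R 1%R)%g.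
    exact: (QM _ _ (QM _ _ (Qu _) (Ql _)) (Qu _)).
  move: c0 e; have [->|->|->] := F3_cases a; have [->|->|->] := F3_cases b;
  have [->|->|->] := F3_cases c; have [->|->|->] := F3_cases d => // c0 e;
  try (by move: e => /(congr1 val)); glmul.
move=> g /SL2F3_gl[a [b [c [d [-> e]]]]].
have [c0|] := eqVneq c 0; last by move=> c0; exact: (Qc _ _ _ _ c0 e).2.
(* If [c] is 0, multiplication by [gi] moves the nonzero entry [a] to the lower left corner. *)
suff [] : Q (gi * gi * gi * gl (- c) (- d) a b)%g.
  rewrite (_ : (_ * _)%g = gl a b c d) //.
  move: e c0; have [->|->|->] := F3_cases a; have [->|->|->] := F3_cases b;
  have [->|->|->] := F3_cases c; have [->|->|->] := F3_cases d => // e c0;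
  try (by move: e => /(congr1 val)); rewrite /gi; glmul.
apply: QM => //; apply: Qc.
  by apply/eqP => a0; move: e; rewrite a0 c0 mul0r mulr0 subrr => /(congr1 val).
by rewrite -e; ring.
Qed.

(* So a normal subgroup other than 1 contains gz. *)
Lemma SL2F3_central_word (g : {'GL_2(3)}) : g \in SL2F3 ->
  let w := (g * gi * g^-1 * gi^-1)%g in
  g = 1%g \/ [\/ g = gz, g * g = gz, g * g * g = gz | w = gz \/ w * w = gz]%g.
Proof.
move=> /SL2F3_gl[a [b [c [d [gE e]]]]].
have gV : (g^-1 = gl d (- b)%R (- c)%R a)%g.
  apply/eqP; rewrite eq_invg_mul gE -gl_1; apply/eqP.
  move: e; have [->|->|->] := F3_cases a; have [->|->|->] := F3_cases b;
  have [->|->|->] := F3_cases c; have [->|->|->] := F3_cases d => // e;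
  try (by move: e => /(congr1 val)); glmul.
have giV : (gi^-1 = gl 0 1 (- 1)%R 0)%g.
  by apply/eqP; rewrite eq_invg_mul -gl_1 /gi; apply/eqP; glmul.
rewrite gV giV gE -gl_1 /gz /gi {gV giV gE}.
move: e; have [->|->|->] := F3_cases a; have [->|->|->] := F3_cases b;
have [->|->|->] := F3_cases c; have [->|->|->] := F3_cases d => // e;
try (by move: e => /(congr1 val)); first [by left; glmul | right;
  first [by apply: Or41; glmul | by apply: Or42; glmul | by apply: Or43; glmul |
  by apply: Or44; left; glmul | by apply: Or44; right; glmul]].
Qed.

End GeneratorsSL2F3.

(** Multiplication by an element of determinant -1 exchanges the subgroup with its complement in the
    general linear group, of order 48. *)
Lemma card_SL2F3 : #|SL2F3| = 24%N.
Proof.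
pose d : {'GL_2(3)} := insubd (1%g : {'GL_2(3)}) (mat2 1 0 0 (-1) : 'M['F_3]_2).
have dE : \det (GLval d) = -1.
  rewrite (_ : GLval d = mat2 1 0 0 (-1)) ?det_mat2; first by apply: val_inj.
  by apply: (@insubdK _ _ {'GL_2(3)}); rewrite unfold_in /= unitmxE det_mat2.
have dM (g h : {'GL_2(3)}) : \det (GLval (g * h)%g) = \det (GLval g) * \det (GLval h).
  exact: det_mulmx.
have dN0 (g : {'GL_2(3)}) : \det (GLval g) != 0.
  have : \det (GLval g) * \det (GLval g^-1%g) = 1 by rewrite -dM mulgV det1.
  by move=> h; apply/eqP => g0; move: h; rewrite g0 mul0r => /(congr1 val).
have cE : #|~: (SL2F3 : {set {'GL_2(3)}})| = #|SL2F3|.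
  rewrite -(card_rcoset SL2F3 d); apply: eq_card => g; rewrite mem_rcoset !inE.
  have : \det (GLval (g * d^-1)%g) * (-1) = \det (GLval g) by rewrite -dE -dM mulgKV.
  move=> <-; have := dN0 (g * d^-1)%g; have [->|->|->] := F3_cases (\det (GLval (g * d^-1)%g)) => // _.
have c48 : #|{: {'GL_2(3)}}| = 48%N.
  by have := card_GL_2 'F_3; rewrite cardsT card_F3.
have := cardsC (SL2F3 : {set {'GL_2(3)}}); rewrite cE c48 addnn -[48%N]/(24.*2).
by move=> /double_inj.
Qed.

Section Relations.
Variables (F : fieldType) (n : nat) (rG : mx_representation F SL2F3 n).
Local Notation A := (rG gi).
Local Notation B := (rG gj).
Local Notation T := (rG gt).
Local Notation Z := (rG gz).

Let rM g h : g \in SL2F3 -> h \in SL2F3 -> rG (g * h)%g = rG g *m rG h.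
Proof. exact: repr_mxM. Qed.

Lemma rep_AA : A *m A = Z. Proof. by rewrite -rM ?gi_in // gi_sqr. Qed.
Lemma rep_BB : B *m B = Z. Proof. by rewrite -rM ?gj_in // gj_sqr. Qed.
Lemma rep_ZZ : Z *m Z = 1%:M. Proof. by rewrite -rM ?gz_in // gz_sqr repr_mx1. Qed.
Lemma rep_BA : B *m A = Z *m (A *m B).
Proof. by rewrite -!rM ?gi_in ?gj_in ?gz_in ?groupM ?gi_in ?gj_in // gj_gi. Qed.
Lemma rep_AT : A *m T = T *m B. Proof. by rewrite -!rM ?gi_in ?gj_in ?gt_in // gi_gt. Qed.
Lemma rep_BT : B *m T = T *m (A *m B).
Proof. by rewrite -!rM ?gi_in ?gj_in ?gt_in ?groupM ?gi_in ?gj_in // gj_gt. Qed.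
Lemma rep_KT : A *m B *m T = T *m A.
Proof. by rewrite -!rM ?gi_in ?gj_in ?gt_in ?groupM ?gi_in ?gj_in // gk_gt. Qed.
Lemma rep_TTT : T *m T *m T = 1%:M.
Proof. by rewrite -!rM ?gt_in ?groupM ?gt_in // gt_cube repr_mx1. Qed.

Lemma rep_module m (W : 'M_(m, n)) : (W *m A <= W)%MS -> (W *m T <= W)%MS -> mxmodule rG W.
Proof.
move=> WA WT; apply/mxmoduleP; apply: SL2F3_gen => // g h gG hG Wg Wh.
rewrite rM // mulmxA; apply: submx_trans Wh; exact: submxMr.
Qed.

Lemma rep_cent (f : 'M_n) : f *m A = A *m f -> f *m T = T *m f -> centgmx rG f.
Proof.
move=> fA fT; apply/centgmxP; apply: SL2F3_gen => // g h gG hG Wg Wh.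
by rewrite rM // mulmxA Wg -!mulmxA Wh.
Qed.

Lemma irr_full m (W : 'M_(m, n)) : mx_irreducible rG -> mxmodule rG W -> W != 0 ->
  row_full W.
Proof.
move=> [_ _ irr] mW W0; rewrite -sub1mx -(genmxE W); apply: irr.
- by rewrite (eqmx_module _ (genmxE W)).
- exact: submx1.
- by rewrite -submx0 genmxE submx0.
Qed.

End Relations.

(** The base change through the common coordinates intertwines the two generators, hence the whole
    group. *)
Lemma rep_rsim (F : fieldType) m n n' (rG : mx_representation F SL2F3 n)
    (rG' : mx_representation F SL2F3 n') (P : 'M_(m, n)) (P' : 'M_(m, n')) (SA ST : 'M_m) :
  row_free P -> row_full P -> row_free P' -> row_full P' ->
  P *m rG gi = SA *m P -> P *m rG gt = ST *m P ->
  P' *m rG' gi = SA *m P' -> P' *m rG' gt = ST *m P' -> mx_rsim rG rG'.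
Proof.
move=> Pf PF Pf' PF' PA PT PA' PT'.
have nm : n = m by rewrite -(eqP PF) (eqP Pf).
have nm' : n' = m by rewrite -(eqP PF') (eqP Pf').
have [Q [PQ QP]] : exists Q : 'M_(n, m), P *m Q = 1%:M /\ Q *m P = 1%:M.
  by exists (pinvmx P); rewrite mulmxVp ?mulVpmx.
have [Q' PQ'] : exists Q' : 'M_(n', m), P' *m Q' = 1%:M by exists (pinvmx P'); rewrite mulmxVp.
have key g (S : 'M_m) : P *m rG g = S *m P -> P' *m rG' g = S *m P' ->
    rG g *m (Q *m P') = Q *m P' *m rG' g.
  move=> h h'; rewrite -mulmxA h' -[rG g]mul1mx -QP -[Q *m P *m rG g]mulmxA h.
  by rewrite !mulmxA -[Q *m S *m P *m _]mulmxA PQ mulmx1.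
apply: (MxReprSim (B := Q *m P')); first by rewrite nm nm'.
  apply/row_freeP; exists (Q' *m P).
  by rewrite mulmxA -[Q *m P' *m _]mulmxA PQ' mulmx1 QP.
apply: SL2F3_gen; [exact: key PA PA'|exact: key PT PT'|] => g h gG hG Wg Wh.
by rewrite !repr_mxM // -[LHS]mulmxA Wh [LHS]mulmxA Wg [RHS]mulmxA.
Qed.

Section Monomial.
Variables (n : nat) (rG : mx_representation rat SL2F3 n).
Local Notation A := (rG gi).
Local Notation B := (rG gj).
Local Notation T := (rG gt).

(* The matrices of gi and gt on (v, v T, v T^2), when v is fixed by gi and
   negated by gj. *)
Definition mono_sign : 'M[rat]_3 := diag_mx (\row_(i < 3) if i == ord0 then 1 else -1).
Definition mono_shift : 'M[rat]_3 := \matrix_(i < 3) delta_mx 0 (ordS i).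

Section Basis.
Variable v : 'rV[rat]_n.
Hypotheses (v0 : v != 0) (vA : v *m A = v) (vB : v *m B = - v).

Definition mono_row (i : 'I_3) : 'rV[rat]_n :=
  if i == ord0 then v else if i == 1 then v *m T else v *m T *m T.
Definition mono_basis : 'M[rat]_(3, n) := \matrix_(i < 3) mono_row i.

Lemma mono_A1 : v *m T *m A = - (v *m T).
Proof. by rewrite -mulmxA -rep_KT !mulmxA vA vB mulNmx. Qed.

Lemma mono_A2 : v *m T *m T *m A = - (v *m T *m T).
Proof.
rewrite -[v *m T *m T *m A]mulmxA -rep_KT !mulmxA mono_A1 !mulNmx -[v *m T *m B]mulmxA -rep_AT.
by rewrite mulmxA vA.
Qed.

Lemma mono_T3 : v *m T *m T *m T = v.
Proof. by rewrite -!mulmxA [T *m (T *m T)]mulmxA rep_TTT mulmx1. Qed.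

Lemma ord3E (i : 'I_3) : [\/ i = ord0, i = 1 | i = ord_max].
Proof. by case: i => [[|[|[|i]]] hi] //; [apply: Or31|apply: Or32|apply: Or33]; apply: val_inj. Qed.

Lemma mono_basisA : mono_basis *m A = mono_sign *m mono_basis.
Proof.
apply/row_matrixP => i; rewrite row_mul rowK mul_diag_mx; apply/rowP => j; rewrite !mxE.
have -> : \sum_k mono_row i 0 k * A k j = (mono_row i *m A) 0 j by rewrite mxE.
case: (ord3E i) => ->; rewrite /mono_row /=.
- by rewrite vA mul1r.
- by rewrite mono_A1 mxE mulN1r.
- by rewrite mono_A2 mxE mulN1r.
Qed.

Lemma mono_basisT : mono_basis *m T = mono_shift *m mono_basis.
Proof.
apply/row_matrixP => i; rewrite !row_mul rowK [row i mono_shift]rowK -rowE rowK.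
case: (ord3E i) => ->; rewrite /mono_row //=.
exact: mono_T3.
Qed.

(** [gi] fixes the first vector and negates the other two, so the relation plus its image leaves
    twice the first term. *)
Lemma mono_indep (c0 c1 c2 : rat) :
  c0 *: v + c1 *: (v *m T) + c2 *: (v *m T *m T) = 0 -> c0 = 0.
Proof.
move=> h; have := congr1 (mulmx^~ A) h; rewrite /= mul0mx !mulmxDl -!scalemxAl.
rewrite vA mono_A1 mono_A2 !scalerN => h'.
have : (c0 + c0) *: v = 0.
  move: h h'; rewrite scalerDl -!addrA -opprD => h /eqP; rewrite subr_eq0 => /eqP h'.
  by rewrite {2}h'.
move/eqP; rewrite scaler_eq0 (negPf v0) orbF -mulr2n mulrn_eq0 /= => /eqP.
by [].
Qed.

Lemma mul_mono_basis (u : 'rV_3) :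
  u *m mono_basis = u 0 ord0 *: v + u 0 1 *: (v *m T) + u 0 ord_max *: (v *m T *m T).
Proof.
rewrite mulmx_sum_row !big_ord_recl big_ord0 addr0 !rowK addrA /mono_row /=.
by congr (_ *: _ + u 0 _ *: _ + u 0 _ *: _); apply: val_inj.
Qed.

(** [T] permutes the three vectors cyclically, so [mono_indep] reaches each coefficient. *)
Lemma mono_free : row_free mono_basis.
Proof.
apply: inj_row_free => u; rewrite mul_mono_basis.
set c0 := u 0 ord0; set c1 := u 0 1; set c2 := u 0 ord_max => h.
have rot (a b c : rat) : a *: v + b *: (v *m T) + c *: (v *m T *m T) = 0 ->
    c *: v + a *: (v *m T) + b *: (v *m T *m T) = 0.
  move=> /(congr1 (mulmx^~ T)); rewrite /= mul0mx !mulmxDl -!scalemxAl mono_T3 => <-.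
  by rewrite [RHS]addrC addrA.
have h' := rot _ _ _ h; have h'' := rot _ _ _ h'.
have e0 := mono_indep h; have e2 := mono_indep h'; have e1 := mono_indep h''.
by apply/rowP => i; rewrite mxE; case: (ord3E i) => ->.
Qed.

Lemma mono_full : mx_irreducible rG -> row_full mono_basis.
Proof.
move=> irr; apply: (irr_full irr).
  by apply: rep_module; rewrite ?mono_basisA ?mono_basisT submxMl.
apply: contraNneq v0 => P0; rewrite -[v]/(mono_row ord0) -[mono_row _](rowK mono_row).
by rewrite -/mono_basis P0 row0.
Qed.

(** An endomorphism preserves the vectors fixed by [gi], which form the line of [v]; commuting with
    [T], it has the same eigenvalue on the whole basis. *)
Lemma mono_scalar (f : 'M_n) : mx_irreducible rG -> centgmx rG f -> exists q, f = q%:M.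
Proof.
move=> irr /centgmxP cf; have PF := mono_full irr.
have fA : f *m A = A *m f := cf _ gi_in.
have fT : f *m T = T *m f := cf _ gt_in.
have [u uE] : exists u : 'rV_3, v *m f = u *m mono_basis.
  exact/submxP/submx_full.
have us : u *m mono_sign = u.
  apply: (row_free_inj mono_free); rewrite -mulmxA -mono_basisA mulmxA -uE.
  by rewrite -mulmxA fA mulmxA vA.
have uz i : i != ord0 -> u 0 i = 0.
  move=> /negPf i0; have := congr1 (fun w : 'rV_3 => w 0 i) us.
  rewrite mul_mx_diag !mxE i0 mulrN1 => /eqP.
  by rewrite eq_sym -addr_eq0 -mulr2n mulrn_eq0 /= => /eqP.
have vf : v *m f = u 0 ord0 *: v.
  by rewrite uE mul_mono_basis (uz 1) // (uz ord_max) // !scale0r !addr0.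
have vTf : v *m T *m f = u 0 ord0 *: (v *m T) by rewrite -mulmxA -fT mulmxA vf scalemxAl.
have vTTf : v *m T *m T *m f = u 0 ord0 *: (v *m T *m T).
  by rewrite -mulmxA -fT mulmxA vTf -scalemxAl.
exists (u 0 ord0); rewrite -[LHS]mul1mx -(mulVpmx PF) -mulmxA.
have -> : mono_basis *m f = u 0 ord0 *: mono_basis.
  apply/row_matrixP => i; rewrite row_mul [RHS]linearZ /= rowK.
  by case: (ord3E i) => ->; rewrite /mono_row /=.
by rewrite -scalemxAr mulVpmx // scalemx1.
Qed.

End Basis.
End Monomial.

Lemma mono_rsim n n' (rG : mx_representation rat SL2F3 n) (rG' : mx_representation rat SL2F3 n')
    (v : 'rV_n) (v' : 'rV_n') : mx_irreducible rG -> mx_irreducible rG' ->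
  v != 0 -> v *m rG gi = v -> v *m rG gj = - v ->
  v' != 0 -> v' *m rG' gi = v' -> v' *m rG' gj = - v' -> mx_rsim rG rG'.
Proof.
move=> irr irr' v0 vA vB v0' vA' vB'.
apply: (rep_rsim (P := mono_basis rG v) (P' := mono_basis rG' v') (SA := mono_sign)
  (ST := mono_shift)); by rewrite ?mono_free ?mono_full ?mono_basisA ?mono_basisT.
Qed.

Section Trivial.
Variables (n : nat) (rG : mx_representation rat SL2F3 n).
Hypotheses (irr : mx_irreducible rG) (A1 : rG gi = 1%:M) (T1 : rG gt = 1%:M).

Lemma triv_row_full (v : 'rV[rat]_n) : v != 0 -> row_full v.
Proof.
by move=> v0; apply: (irr_full irr) => //; apply: rep_module; rewrite ?A1 ?T1 mulmx1.
Qed.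

Lemma triv_row_free (v : 'rV[rat]_n) : v != 0 -> row_free v.
Proof. by move=> v0; rewrite /row_free rank_rV v0. Qed.

Lemma triv_vector : exists v : 'rV[rat]_n, v != 0.
Proof.
have /mx_irrP[n0 _] := irr; exists (delta_mx 0 (Ordinal n0)).
by apply/eqP => /matrixP/(_ 0 (Ordinal n0)) /eqP; rewrite !mxE !eqxx.
Qed.

Lemma triv_scalar (f : 'M[rat]_n) : exists q, f = q%:M.
Proof.
have [v v0] := triv_vector; have vF := triv_row_full v0.
have [u uE] : exists u : 'M_1, v *m f = u *m v by exact/submxP/submx_full.
exists (u 0 0); rewrite -[LHS]mul1mx -(mulVpmx vF) -mulmxA uE {1}[u]mx11_scalar.
by rewrite mul_scalar_mx -scalemxAr mulVpmx // scalemx1.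
Qed.

End Trivial.

Lemma triv_rsim n n' (rG : mx_representation rat SL2F3 n) (rG' : mx_representation rat SL2F3 n') :
  mx_irreducible rG -> mx_irreducible rG' ->
  rG gi = 1%:M -> rG gt = 1%:M -> rG' gi = 1%:M -> rG' gt = 1%:M -> mx_rsim rG rG'.
Proof.
move=> irr irr' A1 T1 A1' T1'.
have [v v0] := triv_vector irr; have [v' v0'] := triv_vector irr'.
apply: (rep_rsim (P := v) (P' := v') (SA := 1%:M) (ST := 1%:M)).
- exact: triv_row_free.
- exact: (triv_row_full irr A1 T1).
- exact: triv_row_free.
- exact: (triv_row_full irr' A1' T1').
- by rewrite A1 mulmx1 mul1mx.
- by rewrite T1 mulmx1 mul1mx.
- by rewrite A1' mulmx1 mul1mx.
- by rewrite T1' mulmx1 mul1mx.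
Qed.

(** Rules that push an entry through the additive operations, so that additive matrix identities
    reduce to [ring] on entries. *)
Lemma mx_linE (V : zmodType) m n (i : 'I_m) (j : 'I_n) :
  (forall X Y : 'M[V]_(m, n), (X + Y) i j = X i j + Y i j) *
  (forall X : 'M[V]_(m, n), (- X) i j = - X i j) * ((0 : 'M[V]_(m, n)) i j = 0).
Proof. by split=> [|/=]; [split=> *|]; rewrite mxE. Qed.

Ltac mx_linear := let i := fresh in let j := fresh in
  apply/matrixP => i j; rewrite !mx_linE; ring.

Section IrreducibleCases.
Variables (F : fieldType) (n : nat) (rG : mx_representation F SL2F3 n).
Hypotheses (irr : mx_irreducible rG) (two : (2%:R : F) != 0).
Local Notation A := (rG gi).
Local Notation B := (rG gj).
Local Notation T := (rG gt).
Local Notation Z := (rG gz).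

Lemma rep_AZ : A *m Z = Z *m A. Proof. by rewrite -rep_AA mulmxA. Qed.
Lemma rep_ZT : Z *m T = T *m Z.
Proof. by rewrite -{1}rep_AA -rep_BB -mulmxA rep_AT mulmxA rep_AT mulmxA. Qed.

Lemma irr_gt0 : (0 < n)%N.
Proof. by have /mx_irrP[] := irr. Qed.

Lemma irr_one_neq0 : (1%:M : 'M[F]_n) != 0.
Proof. by rewrite -mxrank_eq0 mxrank1 -lt0n irr_gt0. Qed.

(** By Schur the central endomorphism Z - 1 is zero or invertible, and its product with Z + 1 is
    zero. *)
Lemma irr_center : Z = 1%:M \/ Z = - 1%:M.
Proof.
have cZ : centgmx rG (Z - 1%:M).
  apply: rep_cent; rewrite mulmxBl mulmxBr mul1mx mulmx1 ?rep_ZT //.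
  by rewrite rep_AZ.
have [/eqP|Z1] := eqVneq (Z - 1%:M) 0; first by rewrite subr_eq0 => /eqP; left.
right; have uZ := mx_Schur irr cZ Z1; apply/eqP; rewrite -addr_eq0; apply/eqP.
have : (Z - 1%:M) *m (Z + 1%:M) = 0.
  by rewrite mulmxBl mulmxDr !mul1mx mulmx1 rep_ZZ; mx_linear.
by move=> /(congr1 (mulmx (invmx (Z - 1%:M)))); rewrite mulKmx // mulmx0.
Qed.

Hypothesis Z1 : Z = 1%:M.

Let AA : A *m A = 1%:M. Proof. by rewrite rep_AA. Qed.
Let BB : B *m B = 1%:M. Proof. by rewrite rep_BB. Qed.
Let BA : B *m A = A *m B. Proof. by rewrite rep_BA Z1 mul1mx. Qed.

(** [E] is, up to the factor 4, the projection onto the vectors fixed by the Klein group of [A] and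
    [B], and it commutes with the representation. If it is invertible, that group acts trivially; if
    it is zero, every vector fixed by [A] is negated by [B]. *)
Lemma irr_klein : (exists v : 'rV[F]_n, [/\ v != 0, v *m A = v & v *m B = - v]) \/
  (A = 1%:M /\ B = 1%:M).
Proof.
pose E : 'M_n := (1%:M + A) *m (1%:M + B).
have EE : E = 1%:M + A + B + A *m B.
  by rewrite /E mulmxDl mul1mx mulmxDr mulmx1; mx_linear.
have EA : E *m A = E.
  rewrite EE !mulmxDl mul1mx AA BA -!mulmxA BA mulmxA AA mul1mx.
  mx_linear.
have AE : A *m E = E by rewrite /E mulmxA [A *m (_ + _)]mulmxDr mulmx1 AA [A + _]addrC.
have EB : E *m B = E by rewrite /E -mulmxA [(_ + B) *m B]mulmxDl mul1mx BB [B + _]addrC.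
have ET : E *m T = T *m E.
  rewrite EE !mulmxDl !mulmxDr mul1mx mulmx1 rep_AT rep_BT rep_KT.
  mx_linear.
have [E0|E0] := eqVneq E 0; last first.
  right; have uE := mx_Schur irr (rep_cent (etrans EA (esym AE)) ET) E0.
  by split; [move: EA|move: EB] => /(congr1 (mulmx (invmx E))); rewrite mulKmx // mulVmx.
(* A = -1 is impossible: conjugation by [T] would give B = -1, making AB = 1 conjugate to -1. *)
left; have [A1|A1] := eqVneq (1%:M + A) 0.
  have AN : A = - 1%:M by apply/eqP; rewrite -addr_eq0 addrC A1.
  have TB : T *m B = - T by rewrite -rep_AT AN mulNmx mul1mx.
  have uT : T \in unitmx by apply: repr_mx_unit; exact: gt_in.
  have BN : B = - 1%:M.
    by move: TB => /(congr1 (mulmx (invmx T))); rewrite mulKmx // mulmxN mulVmx.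
  have := rep_KT rG; rewrite AN BN !(mulmxN, mulNmx, mul1mx, mulmx1, opprK).
  move=> /eqP; rewrite -addr_eq0 -mulr2n -scaler_nat scaler_eq0 (negPf two) /= => /eqP T0.
  by move: irr_one_neq0; rewrite -(rep_TTT rG) T0 mulmx0 eqxx.
have /rowV0Pn[v /submxP[c vE] v0] := A1; exists v; split=> //.
  by rewrite vE -mulmxA mulmxDl mul1mx AA [A + _]addrC.
apply/eqP; rewrite -addr_eq0 -[X in _ + X]mulmx1 -mulmxDr vE -mulmxA [B + _]addrC.
by rewrite -/E E0 mulmx0.
Qed.

End IrreducibleCases.

Section ClosedFieldReps.
Variables (F : closedFieldType) (n : nat) (rG : mx_representation F SL2F3 n).
Hypotheses (irr : mx_irreducible rG) (two : (2%:R : F) != 0).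
Local Notation A := (rG gi).
Local Notation B := (rG gj).
Local Notation T := (rG gt).
Local Notation Z := (rG gz).

Lemma closed_eigenvector (f : 'M[F]_n) : exists (l : F) (v : 'rV_n), v != 0 /\ v *m f = l *: v.
Proof.
have [l rl] : exists l, root (char_poly f) l.
  by apply/closed_rootP; rewrite size_char_poly; have := irr_gt0 irr; case: (n).
move: rl; rewrite -eigenvalue_root_char => /eigenvalueP[v vf v0].
by exists l, v.
Qed.

Lemma closed_scalar (f : 'M_n) : centgmx rG f -> exists l, f = l%:M.
Proof.
move=> cf; have [l [v [v0 vf]]] := closed_eigenvector f; exists l.
apply/eqP; rewrite -subr_eq0; apply/negPn/negP => fl.
have cfl : centgmx rG (f - l%:M).
  apply/centgmxP => g gG; have /centgmxP/(_ _ gG) e := cf.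
  by rewrite mulmxBl mulmxBr e scalar_mxC.
have := mx_Schur irr cfl fl => ufl; move: v0; rewrite -[v](mulmxK ufl) mulmxBr vf.
by rewrite mul_mx_scalar subrr mul0mx eqxx.
Qed.

Lemma closed_dim_quaternion : Z = - 1%:M -> (n <= 2)%N.
Proof.
move=> ZN.
have AA : A *m A = - 1%:M by rewrite rep_AA.
have BB : B *m B = - 1%:M by rewrite rep_BB.
have BA : B *m A = - (A *m B) by rewrite rep_BA ZN mulNmx mul1mx.
(* T w commutes with A and T, since conjugation by T and by w^-1 agree on the
   quaternions; so T is a multiple of u by Schur, and an eigenvector of A spans
   with its image under B a submodule. *)
pose w : 'M_n := 1%:M + A + B + A *m B; pose u : 'M_n := 1%:M - A - B - A *m B.
have wT : w *m T = T *m w.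
  rewrite !mulmxDl !mulmxDr mul1mx mulmx1 rep_AT rep_BT rep_KT.
  mx_linear.
have AAB : A *m (A *m B) = - B by rewrite mulmxA AA mulNmx mul1mx.
have ABA : A *m B *m A = B by rewrite -mulmxA BA mulmxN AAB opprK.
have ABB : A *m B *m B = - A by rewrite -mulmxA BB mulmxN mulmx1.
have BAB : B *m (A *m B) = A by rewrite mulmxA BA mulNmx ABB opprK.
have ABAB : A *m B *m (A *m B) = - 1%:M by rewrite -mulmxA BAB AA.
have Bw : B *m w = w *m A.
  rewrite !mulmxDl !mulmxDr mul1mx mulmx1 AA BB BA BAB ABA.
  mx_linear.
(* [w] and [u] are conjugate quaternions of norm 4. *)
have wu : w *m u = 4%:R *: 1%:M.
  rewrite mulmxDl !mulmxDl !mulmxBr !mul1mx !mulmx1 AA BB BA BAB ABA AAB ABB ABAB scaler_nat.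
  mx_linear.
have four : (4%:R : F) != 0 by rewrite (natrM _ 2 2) mulf_neq0.
have TwA : T *m w *m A = A *m (T *m w) by rewrite [RHS]mulmxA rep_AT -!mulmxA Bw.
have TwT : T *m w *m T = T *m (T *m w) by rewrite -mulmxA wT.
have [l lE] := closed_scalar (rep_cent TwA TwT).
have TE : T = (l / 4%:R) *: u.
  apply: (scalerI four); rewrite scalerA mulrCA mulfV // mulr1 -[l *: u]mul_scalar_mx -lE.
  by rewrite -mulmxA wu -scalemxAr mulmx1.
have [m [v [v0 vA]]] := closed_eigenvector A.
pose W : 'M_(1 + 1, n) := col_mx v (v *m B).
have vW : (v <= W)%MS by rewrite -addsmxE addsmxSl.
have vBW : (v *m B <= W)%MS by rewrite -addsmxE addsmxSr.
have WA : (W *m A <= W)%MS.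
  rewrite mul_col_mx col_mx_sub vA scalemx_sub //= -mulmxA BA mulmxN mulmxA vA.
  by rewrite -scalemxAl -scaleNr scalemx_sub.
have WB : (W *m B <= W)%MS.
  by rewrite mul_col_mx col_mx_sub vBW -mulmxA BB mulmxN mulmx1 eqmx_opp.
have WT : (W *m T <= W)%MS.
  rewrite TE -scalemxAr scalemx_sub // /u !mulmxDr mulmx1 !mulmxN mulmxA.
  by rewrite !addmx_sub ?eqmx_opp // (submx_trans (submxMr _ WA)).
have := irr_full irr (rep_module WA WT).
have W0 : W != 0.
  by apply: contraNneq v0 => W0; rewrite -submx0 (submx_trans vW) // W0 submx0.
by move=> /(_ W0) /eqP <-; rewrite rank_leq_row.
Qed.

Lemma closed_dim_cyclic : A = 1%:M -> n = 1%N.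
Proof.
move=> A1; have [m [v [v0 vT]]] := closed_eigenvector T.
have := irr_full irr (rep_module (W := v) _ _); rewrite A1 mulmx1 vT scalemx_sub //.
by move=> /(_ (submx_refl v) isT v0) /eqP <-; rewrite rank_rV v0.
Qed.

End ClosedFieldReps.

(** * Divisibility of omega by 3 *)

Section Omega.
Variables (K : realType) (n : nat) (rG : mx_representation rat SL2F3 n).
Hypothesis irr : mx_irreducible rG.
Local Notation cG := (complexification K rG).

(** A nonzero module of finite dimension has a simple submodule, so the default 0 in
    [constituent_dim] is not taken. *)
Lemma constituent_dimP :
  exists2 U : 'M[K[i]]_n, mxsimple cG U & \rank U = constituent_dim K rG.
Proof.
pose P := [set d | exists2 U : 'M[K[i]]_n, mxsimple cG U & \rank U = d].
suff [d Pd] : exists d, P d by apply: (@xgetPex _ 0%N P); exists d.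
have one0 : (1%:M : 'M[K[i]]_n) != 0.
  by rewrite -mxrank_eq0 mxrank1 -lt0n (irr_gt0 irr).
have : `[< exists V : 'M[K[i]]_n, mxsimple cG V >].
  apply: (mxsimple_exists (mxmodule1 cG) one0) => -[V sV _]; apply/asboolP.
  by exists V.
by move=> /asboolP[V sV]; exists (\rank V), V.
Qed.

Let two0 : (2%:R : K[i]) != 0. Proof. by rewrite pnatr_eq0. Qed.

Lemma submod_repr_eq (U : 'M[K[i]]_n) (mU : mxmodule cG U) g (l : rat) : g \in SL2F3 ->
  rG g = l%:M -> submod_repr mU g = (ratr l)%:M.
Proof.
move=> gG gl; apply: (can_inj val_submodK); rewrite -[submod_repr mU g]mul1mx.
rewrite [LHS](val_submodJ mU 1%:M gG) map_reprE gl map_scalar_mx /=.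
by rewrite mul_mx_scalar -[in RHS]scalemx1 [RHS]linearZ.
Qed.

Lemma constituent_dim_quaternion : rG gz = - 1%:M ->
  constituent_dim K rG \in [:: 1%N; 2%N].
Proof.
move=> ZN; have [U sU <-] := constituent_dimP; have [mU U0 _] := sU.
have irrU : mx_irreducible (submod_repr mU) by apply/submod_mx_irr.
have := closed_dim_quaternion irrU two0.
have ZN' : rG gz = (-1)%:M by rewrite ZN raddfN.
rewrite (submod_repr_eq mU gz_in ZN') raddfN /= rmorph1 raddfN => /(_ erefl).
have := irr_gt0 irrU; case: (\rank U) => [|[|[|r]]] //.
Qed.

Lemma constituent_dim_cyclic : rG gi = 1%:M -> constituent_dim K rG = 1%N.
Proof.
move=> A1; have [U sU <-] := constituent_dimP; have [mU U0 _] := sU.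
have irrU : mx_irreducible (submod_repr mU) by apply/submod_mx_irr.
by apply: (closed_dim_cyclic irrU); rewrite (submod_repr_eq mU gi_in A1) rmorph1.
Qed.

(** A nontrivial element of the kernel would put [gz] in the kernel, by [SL2F3_central_word]; so the
    representation is faithful. Then omega is 24 divided by 1 or 2, in either case a multiple of
    3. *)
Lemma omega_quaternion : rG gz = - 1%:M -> (3 %| omega K rG)%N /\ (0 < omega K rG)%N.
Proof.
move=> ZN; have Z1 : rG gz <> 1%:M.
  move=> Z1; move: ZN; rewrite Z1 => /eqP; rewrite -addr_eq0 -mulr2n -scaler_nat.
  by rewrite scaler_eq0 (negPf (irr_one_neq0 irr)).
have -> : omega K rG = (24 %/ (1 * constituent_dim K rG))%N.
{ rewrite /omega card_SL2F3; congr (_ %/ (_ * _))%N.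
  suff -> : rker rG = 1%g by rewrite cards1.
  apply/trivgP/fintype.subsetP => g /rkerP[gG g1].
  have [->|h] := SL2F3_central_word gG; [exact: group1|case: Z1].
  have giV : gi^-1%g \in SL2F3 by rewrite groupV gi_in.
  have gV : g^-1%g \in SL2F3 by rewrite groupV.
  have w1 : rG (g * gi * g^-1 * gi^-1)%g = 1%:M.
    rewrite !repr_mxM ?groupM ?gi_in // g1 mul1mx repr_mxV // g1 invmx1 mulmx1.
    by rewrite -repr_mxM ?gi_in // mulgV repr_mx1.
  case: h => [<-|<-|<-|[<-|<-]] //.
  - by rewrite repr_mxM // g1 mul1mx.
  - by rewrite !repr_mxM ?groupM // g1 !mul1mx.
  - by rewrite repr_mxM ?groupM ?gi_in // w1 mul1mx. }
by have := constituent_dim_quaternion ZN; rewrite !inE => /orP[] /eqP ->.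
Qed.

(** The constituents have dimension 1, so omega is the index of the kernel, and [gt] has order 3 in
    the quotient. *)
Lemma omega_cyclic : rG gi = 1%:M -> rG gt != 1%:M ->
  (3 %| omega K rG)%N /\ (0 < omega K rG)%N.
Proof.
move=> A1 T1.
have -> : omega K rG = #|SL2F3 : rker rG|%g.
  by rewrite /omega constituent_dim_cyclic // muln1 divgS // (normal_sub (rker_normal rG)).
split; last exact: indexg_gt0.
rewrite -card_quotient ?rker_norm //.
have tN : gt \in 'N(rker rG)%g by apply: (fintype.subsetP (rker_norm rG)); exact: gt_in.
have o3 : #[coset (rker rG) gt]%g = 3%N.
  have : #[coset (rker rG) gt]%g \in divisors 3.
    rewrite -dvdn_divisors // cyclic.order_dvdn !expgS expg0 mulg1 -!morphM ?groupM //.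
    by rewrite mulgA gt_cube morph1.
  rewrite !inE => /orP[|/eqP //]; rewrite order_eq1 => /eqP/coset_idr.
  by rewrite tN => /(_ isT) /rkerP[_ T1']; rewrite T1' eqxx in T1.
by have := cyclic.order_dvdG (mem_quotient (rker rG) gt_in); rewrite o3.
Qed.

End Omega.

(** An order is stable under Z[1/w], which contains 1/3 when 3 divides [w]. *)
Lemma order_third (w n : nat) (D : {pred 'M[rat]_n}) (L : subring 'M[rat]_n) :
  is_order w D L -> (3 %| w)%N -> (0 < w)%N -> exists2 y, y \in L & y *+ 3 = 1.
Proof.
move=> [_ [m [v vP]] _] /dvdnP[q wE] w0.
have [c [cw c1]] := (vP 1).1 (subring1 L).
have w0' : (w%:R : rat) != 0 by rewrite pnatr_eq0 -lt0n.
have wq : w%:R = q%:R * 3%:R :> rat by rewrite wE natrM.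
have q0 : (q%:R : rat) != 0 by apply: contraNneq w0'; rewrite wq => ->; rewrite mul0r.
exists (\sum_(i < m) (c i / 3%:R) *: v i).
  apply/vP; exists (fun i => c i / 3%:R); split=> // i.
  (* With w = 3 q, the coefficient a / (3 w^k) is a q / w^(k+1). *)
  have [a [k ->]] := cw i; exists (a * q%:Z), k.+1.
  have := expf_neq0 k w0'; rewrite intrM exprS; move: (w%:R ^+ k) => p p0.
  by rewrite wq -pmulrn; field; rewrite p0 q0.
rewrite [RHS]c1 -sumrMnl; apply: eq_bigr => i _.
by rewrite -scaler_nat scalerA mulrCA mulfV ?mulr1.
Qed.

(** In characteristic 0, the component of the group algebra attached to [irr_repr i] recovers [i]
    and depends only on the isomorphism class. *)
Lemma rsim_irr_repr (sG : irrType rat SL2F3) (i j : sG) :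
  mx_rsim (irr_repr i) (irr_repr j) -> i = j.
Proof.
have cG : pgroup.pgroup [pchar rat]^' SL2F3.
  by rewrite /pgroup.pgroup pcharf'_nat card_SL2F3.
by move=> ij; rewrite -(irr_reprK_pchar cG i) -(irr_reprK_pchar cG j) (irr_comp_rsim_pchar sG cG ij).
Qed.

Definition monomial_irr n (rG : mx_representation rat SL2F3 n) :=
  exists v : 'rV[rat]_n, [/\ v != 0, v *m rG gi = v & v *m rG gj = - v].
Definition trivial_irr n (rG : mx_representation rat SL2F3 n) :=
  rG gi = 1%:M /\ rG gt = 1%:M.

Lemma irr_order_cases (K : realType) n (rG : mx_representation rat SL2F3 n)
    (L : subring 'M[rat]_n) :
  mx_irreducible rG -> is_order (omega K rG) (endo_algebra rG) L ->
  (exists2 y, y \in L & y *+ 3 = 1) \/ (monomial_irr rG \/ trivial_irr rG).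
Proof.
move=> irr oL.
have [Z1|ZN] := irr_center irr; last first.
  by left; have [h h'] := omega_quaternion K irr ZN; exact: (order_third oL).
have [|[A1 B1]] := irr_klein irr isT Z1; first by right; left.
have [T1|T1] := eqVneq (rG gt) 1%:M; first by right; right.
by left; have [h h'] := omega_cyclic K irr A1 T1; exact: (order_third oL).
Qed.

Lemma irr_scalar n (rG : mx_representation rat SL2F3 n) (f : 'M_n) :
  mx_irreducible rG -> monomial_irr rG \/ trivial_irr rG -> centgmx rG f ->
  exists q, f = q%:M.
Proof.
move=> irr [[v [v0 vA vB]]|[A1 T1]] cf; first exact: (mono_scalar v0 vA vB irr cf).
exact: triv_scalar irr A1 T1 f.
Qed.

(** [t] is the value when no index satisfies [P]. Each exceptional type thus contributes at most one
    vector, whether or not it occurs. *)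
Lemma card_le1_common (sG : finType) (P : sG -> Prop) (T : Type) (u : sG -> T) (t : T) :
  (forall i j, P i -> P j -> i = j) -> exists u0, forall i, P i -> u i = u0.
Proof.
move=> uniqP; have [[i Pi]|nP] := pselect (exists i, P i).
  by exists (u i) => j Pj; rewrite (uniqP _ _ Pi Pj).
by exists t => i Pi; case: nP; exists i.
Qed.

Lemma row3_annihilator (K : fieldType) (u v : 'cV[K]_3) :
  exists2 l : 'rV[K]_3, l != 0 & l *m u = 0 /\ l *m v = 0.
Proof.
have /rowV0Pn[l /sub_kermxP lk l0] : kermx (row_mx u v) != 0.
  rewrite kermx_eq0; apply/negP => /eqP r; have := rank_leq_col (row_mx u v).
  by rewrite r.
exists l => //; move: lk; rewrite mul_mx_row -[X in _ = X -> _]row_mx0.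
by move=> /eq_row_mx.
Qed.

(** * Conclusion *)

Section ThreeWindings.
Variable K : realType.
Local Notation A := (grpring 'F_3 (subg_of SL2F3)).

(** The list has two entries: at the last index [nth] returns its default 1, which is the third
    idempotent. *)
Definition three_windings (f : Gtheory K A 0) : 'cV[K]_3 :=
  \col_k chi_winding (nth 1 [:: idem_quarter; idem_half] k) f.

Lemma three_idem (k : 'I_3) : let e := nth 1 [:: idem_quarter; idem_half] k in e * e = e.
Proof.
by case: k => [[|[|[|k]]] hk] //=;
  rewrite ?idem_quarter_idem ?idem_half_idem ?mulr1.
Qed.

Lemma three_windings_homotopic (f g : Gtheory K A 0) : peq f g ->
  three_windings f = three_windings g.
Proof.
move=> fg; have [s sP] := grpring_finite; apply/colP => k; rewrite !mxE.
exact: (chi_winding_homotopic sP (three_idem k) fg).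
Qed.

Lemma three_windings_op (f g : Gtheory K A 0) :
  three_windings (pop f g) = three_windings f + three_windings g.
Proof.
have [s sP] := grpring_finite; apply/colP => k; rewrite !mxE.
exact: (chi_winding_concat sP (three_idem k)).
Qed.

Lemma three_windings_mod_loop (M : fgmod A) :
  three_windings (loop_sphere (mod_loop_loop K M)) =
  \col_k (euler_mod (nth 1 [:: idem_quarter; idem_half] k) M)%:R.
Proof.
have [s sP] := grpring_finite; apply/colP => k; rewrite !mxE.
exact: (chi_winding_mod_loop sP (three_idem k)).
Qed.

(** The values (1, 1, 1), (0, 0, 2) and (2, 4, 4) on the test modules form an invertible matrix in
    characteristic 0. *)
Lemma three_windings_span (l : 'rV[K]_3) :
  (forall f, l *m three_windings f = 0) -> l = 0.
Proof.
move=> l0.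
have ev (M : fgmod A) a b c : [/\ euler_mod idem_quarter M = a, euler_mod idem_half M = b
    & euler_mod 1 M = c] -> l 0 ord0 * a%:R + l 0 1 * b%:R + l 0 ord_max * c%:R = 0.
  move=> [ea eb ec]; have := congr1 (fun X : 'M_1 => X 0 0) (l0 (loop_sphere (mod_loop_loop K M))).
  rewrite three_windings_mod_loop !mxE !big_ord_recl big_ord0 !mxE /= ea eb ec addr0 addrA => <-.
  by congr (_ * _ + l 0 _ * _ + l 0 _ * _); apply: val_inj.
have := ev _ _ _ _ euler_triv; have := ev _ _ _ _ euler_nat; have := ev _ _ _ _ euler_conj.
move=> h1 h2 h3; apply/rowP => k; rewrite mxE.
have z2 : l 0 ord_max = 0 by lra.
have z1 : l 0 1 = 0 by lra.
have z0 : l 0 ord0 = 0 by lra.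
by case: (ord3E k) => ->.
Qed.

End ThreeWindings.

Theorem theoremA (K : realType) (sG : irrType rat SL2F3)
    (L : forall rho : sG, subring 'M[rat]_(irr_degree rho)) :
  (forall rho : sG,
     is_maximal_order (omega K (irr_repr rho)) (endo_algebra (irr_repr rho))
       (L rho)) ->
  ~ HTW_decomposition K L.
Proof.
move=> maxL /(_ 'F_3 0%N noetherian_F3) [phi [phi_eq phi_op phi_surj]].
pose T rho := tensor 'F_3 (subring_type (L rho)).
pose gen rho : Gtheory K (T rho) 0 := loop_sphere (mod_loop_loop K (row_fgmod (T rho) 1)).
(* The vector of windings carried by the generator of the factor at [rho], read through the inverse
   of [phi]. *)
pose u rho : 'cV[K]_3 := component phi_surj (@three_windings K) (gen rho).
have irr (rho : sG) : mx_irreducible (irr_repr rho) := socle_irr rho.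
have [um umE] : exists u0, forall rho, monomial_irr (irr_repr rho) -> u rho = u0.
  apply: (card_le1_common _ 0) => i j [v [v0 vA vB]] [v' [v0' vA' vB']].
  exact: (rsim_irr_repr (mono_rsim (irr i) (irr j) v0 vA vB v0' vA' vB')).
have [ut utE] : exists u0, forall rho, trivial_irr (irr_repr rho) -> u rho = u0.
  apply: (card_le1_common _ 0) => i j [A1 T1] [A1' T1'].
  exact: (rsim_irr_repr (triv_rsim (irr i) (irr j) A1 T1 A1' T1')).
have [l l0 [lm lt]] := row3_annihilator um ut.
case/eqP: l0; apply: (@three_windings_span K).
pose psi (f : Gtheory K (grpring 'F_3 (subg_of SL2F3)) 0) := l *m three_windings f.
have psi_eq x y : peq x y -> psi x = psi y.
  by move=> xy; rewrite /psi (three_windings_homotopic xy).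
have psi_op x y : psi (pop x y) = psi x + psi y.
  by rewrite /psi three_windings_op mulmxDr.
apply: (transported_eq0 phi_eq phi_op (phi_surj := phi_surj) psi_eq psi_op) => rho.
have ch := component_homotopic phi_eq phi_surj psi_eq (i := rho).
have cc := component_concat phi_eq phi_op phi_surj psi_eq psi_op (i := rho).
have [oL _] := maxL rho.
(* If 3 is invertible in the order, the factor lives over the zero ring; for the two exceptional
   types it is controlled by one loop, whose vector [l] annihilates. *)
have [third|type] := irr_order_cases (irr rho) oL.
  exact: (loop_functional_trivial ch cc (tensor_trivial third)).
have L3 := scalar_mod3 (L := L rho).
have Lq x : x \in L rho -> exists q : rat, x = q%:M.
  by have [LD _ _] := oL; move=> /LD; exact: irr_scalar.
apply: (loop_functional_eq0 ch cc (tensor_div (scalar_mod3 Lq))).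
rewrite (loop_valE _ (mod_loop_loop K _)).
(* [transported] evaluates its functional at a preimage that depends on [phi_surj] alone, so
   applying [l] commutes with [component] by conversion. *)
change (l *m u rho = 0); by case: type => [/umE ->|/utE ->].
Qed.
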